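(* Fix any $\mu>0$, $\nu>0$ and $0<\lambda<1$. The sequence of steady states $(\boldsymbol q^N(\infty),\boldsymbol\delta^N(\infty))$ of the systems with $N$ servers under the TABS scheme (defined for all sufficiently large $N$, for which the system is positive recurrent) converges weakly, as $N\to\infty$, to the deterministic point $(\boldsymbol q^\star,\boldsymbol\delta^\star)$ given by $$\delta_0^\star=1-\lambda,\qquad \delta_1^\star=0,\qquad q_1^\star=\lambda,\qquad q_i^\star=0\ \text{ for all } i\ge 2 .$$
   Context: **TABS model.** There are $N$ identical servers and one dispatcher. Tasks arrive as a Poisson process of rate $\lambda N$; service requirements are i.i.d. exponential with mean $1$; every server has an infinite buffer and serves at unit rate whenever it is busy (with a discipline oblivious to the service requirements, e.g. FCFS). At each time every server is in exactly one of four states: busy (queue length $\ge 1$, counting the task in service), idle-on, idle-off, or in setup; the last three have queue length $0$. The dynamics are as follows (all exponential clocks are independent). - When a busy server's queue empties, it becomes idle-on. An idle-on server turns idle-off after an $\mathrm{Exp}(\mu)$ time (mean $1/\mu$), unless it is assigned a task before that. - When a task arrives and there is at least one idle-on server, the task is assigned to an idle-on server chosen uniformly at random, which becomes busy. - When a task arrives and there is no idle-on server, the task is assigned to a busy server chosen uniformly at random (and is lost if there is no busy server); in addition, if there is at least one idle-off server at that epoch, one of them, chosen uniformly at random, starts its setup procedure (moves to the setup state). - A setup takes an $\mathrm{Exp}(\nu)$ time (mean $1/\nu$), is never aborted, and at its end the server becomes idle-on. **Notation.** $Q_i^N(t)$, $i\ge 1$, is the number of servers with queue length at least $i$ at time $t$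 (including a task in service), $\mathbf Q^N(t)=(Q_1^N(t),Q_2^N(t),\dots)$; $\Delta_0^N(t)$ and $\Delta_1^N(t)$ are the numbers of idle-off servers and of servers in setup. The process $(\mathbf Q^N(t),\Delta_0^N(t),\Delta_1^N(t))$ is an irreducible countable-state continuous-time Markov chain. Set $q_i^N(t)=Q_i^N(t)/N$, $\delta_j^N(t)=\Delta_j^N(t)/N$ ($j=0,1$), $\boldsymbol q^N=(q_1^N,q_2^N,\dots)$, $\boldsymbol\delta^N=(\delta_0^N,\delta_1^N)$. These take values in $$E=\{(\boldsymbol q,\boldsymbol\delta)\in[0,1]^\infty:\ q_i\ge q_{i+1}\ \forall i,\ \delta_0+\delta_1+q_1\le 1\},$$ endowed with the product topology. When the chain is positive recurrent, $(\boldsymbol q^N(\infty),\boldsymbol\delta^N(\infty))$ denotes a random element with the (unique) stationary distribution of $(\boldsymbol q^N(t),\boldsymbol\delta^N(t))$. *)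

(* Defs.v *)
From HB Require Import structures.
From mathcomp Require Import all_boot all_order all_algebra.
From mathcomp Require Import all_classical all_reals all_analysis.
From mathcomp Require Import measurable_realfun.
Set Implicit Arguments.
Unset Strict Implicit.
Unset Printing Implicit Defensive.
Import Order.TTheory GRing.Theory Num.Theory.
Import numFieldNormedType.Exports.

Local Open Scope classical_set_scope.
Local Open Scope ring_scope.

(* Continuous-time Markov chains, in the jump chain / holding time formulation.
   The state space is meant to be countable with its discrete sigma-algebra.
   [rate x y] is the transition rate from x to y for x != y; the diagonal of
   [rate] is ignored. *)
Section Chain.
Context (R : realType) (dS : measure_display) (S : measurableType dS).
Implicit Types (rate : S -> S -> R) (x y : S).

Definition exit_rate rate x : R :=
  fine (\esum_(y in [set y | y != x]) (rate x y)%:E)%E.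

Definition jump_prob rate x y : R :=
  if exit_rate rate x == 0 then (x == y)%:R
  else if x == y then 0 else rate x y / exit_rate rate x.

(* A chain with the given rates, as a family of laws indexed by the initial
   state. [jump k] is the state occupied after k jumps and [hold k] the time
   spent there. Given the jump chain, the holding times are independent and
   exponential with parameter the exit rate of the current state; they are
   extended reals because they are infinite (exit rate 0) in absorbing states. *)
Record ctmc rate := Ctmc {
  paths_display : measure_display ;
  paths : measurableType paths_display ;
  law : S -> probability paths R ;
  jump : nat -> paths -> S ;
  hold : nat -> paths -> \bar R ;
  measurable_jump : forall k, measurable_fun [set: paths] (jump k) ;
  measurable_hold : forall k, measurable_fun [set: paths] (hold k) ;
  hold_gt0 : forall k w, (0 < hold k w)%E ;
  jump_holdE : forall x (n : nat) (y : nat -> S) (h : nat -> R),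
    (forall k, 0 <= h k) ->
    law x [set w | forall k, (k <= n)%N ->
                     jump k w = y k /\ ((h k)%:E < hold k w)%E] =
    ((y 0%N == x)%:R
     * (\prod_(k < n) jump_prob rate (y k) (y k.+1))
     * (\prod_(k < n.+1) expR (- (exit_rate rate (y k) * h k))))%:E }.

Context (rate : S -> S -> R) (X : ctmc rate).

Definition jump_time (n : nat) (w : paths X) : \bar R :=
  (\sum_(k < n) hold k w)%E.

(* The event that the chain is in A at time t. *)
Definition in_at (t : R) (A : set S) : set (paths X) :=
  [set w | exists n, [/\ (jump_time n w <= t%:E)%E,
                         (t%:E < jump_time n.+1 w)%E & A (jump n w)]].

(* First time at or after the first jump at which the chain is in x; +oo if
   there is none. *)
Definition return_time (x : S) (w : paths X) : \bar R :=
  ereal_inf [set t%:E | t in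
    [set t : R | (jump_time 1 w <= t%:E)%E /\ in_at t [set x] w]].

Definition positive_recurrent : Prop :=
  forall x, exit_rate rate x = 0
            \/ (\int[law X x]_w return_time x w < +oo)%E.

Definition stationary (pi : probability S R) : Prop :=
  forall (t : R) (A : set S), 0 <= t -> measurable A ->
    (\int[pi]_x law X x (in_at t A))%E = pi A.

End Chain.

(* For each n, Z n is a random element defined on (S n, P n) with values in E;
   the Z n converge weakly, on E with the subspace topology, to the constant z. *)
Definition weak_cvg_to_point (R : realType) (T : topologicalType) (E : set T)
    (d : nat -> measure_display) (S : forall n, measurableType (d n))
    (P : forall n, probability (S n) R) (Z : forall n, S n -> T) (z : T) : Prop :=
  forall f : T -> R, {within E, continuous f} ->
    (exists M : R, forall u, E u -> `|f u| <= M) ->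
    (\int[P n]_x (f (Z n x))%:E)%E @[n --> \oo] --> (f z)%:E.

(* A state (Q, off, setup) consists of the occupancy sequence with its trailing
   zeros removed, Q = [:: Q_1; ...; Q_L] with Q_1 >= ... >= Q_L >= 1, the number
   of idle-off servers and the number of servers in setup. With nth, occupancies
   are numbered from 0: nth 0 Q i is Q_(i+1). *)
Definition raw_state : Type := (seq nat * nat * nat)%type.

Definition valid_state (N : nat) (x : raw_state) : bool :=
  let: (Q, off, setup) := x in
  [&& sorted geq Q, 0 \notin Q & head 0 Q + off + setup <= N]%N.

Definition state (N : nat) : Type := {x : raw_state | valid_state N x}.

Lemma valid_all_idle (N : nat) : valid_state N ([::], 0, 0)%N.
Proof. by []. Qed.

HB.instance Definition _ (N : nat) := Countable.on (state N).
HB.instance Definition _ (N : nat) := SubType.on (state N).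
HB.instance Definition _ (N : nat) :=
  isPointed.Build (state N) (Sub ([::], 0, 0)%N (valid_all_idle N)).
HB.instance Definition _ (N : nat) :=
  @isMeasurable.Build default_measure_display (state N)
    discrete_measurable discrete_measurable0
    discrete_measurableC discrete_measurableU.

Section Tabs.
Context (R : realType) (lambda mu nu : R) (N : nat).

Definition decr_nth (Q : seq nat) (i : nat) : seq nat :=
  [seq k <- set_nth 0%N Q i (nth 0%N Q i).-1 | k != 0%N].

Definition exactly (Q : seq nat) (i : nat) : nat :=
  (nth 0 Q i - nth 0 Q i.+1)%N.

(* An arriving task finding no idle-on server. The last two components implement
   the start of a setup when off > 0. Joining a server with i+1 tasks
   increments Q_(i+2), i.e. the entry of index i+1; if nobody is busy the task
   is lost. *)
Definition blocked_arrivals (x : raw_state) : seq (R * raw_state) :=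
  let: (Q, off, setup) := x in
  let off' := off.-1 in
  let setup' := (setup + (0 < off))%N in
  let Q1 := head 0%N Q in
  if Q1 == 0%N then [:: (lambda * N%:R, (Q, off', setup'))]
  else [seq (lambda * N%:R * ((exactly Q i)%:R / Q1%:R),
             (incr_nth Q i.+1, off', setup')) | i <- iota 0 (size Q)].

Definition transitions (x : raw_state) : seq (R * raw_state) :=
  let: (Q, off, setup) := x in
  let idle_on := (N - (head 0 Q + off + setup))%N in
  (if (0 < idle_on)%N then [:: (lambda * N%:R, (incr_nth Q 0, off, setup))]
   else blocked_arrivals x)
  ++ [seq ((exactly Q i)%:R, (decr_nth Q i, off, setup)) | i <- iota 0 (size Q)]
  ++ [:: (mu * idle_on%:R, (Q, off.+1, setup));
         (nu * setup%:R, (Q, off, setup.-1))].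

Definition tabs_rate (x y : state N) : R :=
  \sum_(e <- transitions (val x) | e.2 == val y) e.1.

(* The pair (q, (delta_0, delta_1)); coordinate i of q is q_(i+1). *)
Definition fraction_space : topologicalType := ({ptws nat -> R} * (R * R))%type.

Definition fractions (x : state N) : fraction_space :=
  let: (Q, off, setup) := val x in
  ((fun i => (nth 0%N Q i)%:R / N%:R), (off%:R / N%:R, setup%:R / N%:R)).

Definition fraction_domain : set fraction_space :=
  [set z | [/\ forall i, 0 <= z.1 i <= 1,
               0 <= z.2.1 <= 1 & 0 <= z.2.2 <= 1]
           /\ (forall i, z.1 i.+1 <= z.1 i) /\ z.2.1 + z.2.2 + z.1 0%N <= 1].

Definition fixed_point : fraction_space :=
  ((fun i => if i == 0%N then lambda else 0), (1 - lambda, 0)).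

End Tabs.

(* Main.v *)
Require Import Defs.
From HB Require Import structures.
From mathcomp Require Import all_boot all_order all_algebra.
From mathcomp Require Import all_classical all_reals all_analysis.
From mathcomp Require Import measurable_realfun.
From mathcomp Require Import zify ring lra.
Set Implicit Arguments.
Unset Strict Implicit.
Unset Printing Implicit Defensive.
Import Order.TTheory GRing.Theory Num.Theory.
Import numFieldNormedType.Exports.
Local Open Scope classical_set_scope.
Local Open Scope ring_scope.

(* Let x, s, i be the fractions of busy, setup and idle-on servers.

   A law is stationary exactly when it balances the generator: the one-step
   kernel exp(-Lam s) (I + s (Lam + L)) bounds the transition probabilities from
   below, which gives a one-sided bound for indicators, and passing to complements
   makes it two-sided. Conversely, balanced weights obtained from an excursion of
   the jump chain are invariant.

   Stability comes from Foster's criterion. The drift of V1 = \sum_i i Q_i is at most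
   lambda N + (\sum_i Q_i) (r - 1), where r = lambda / x if no server is idle-on and
   r = 0 otherwise. The congestion r can exceed 1, but there is a bounded function g
   of (x, s, i) with drift at most 1 - e - r for large N, so V1 + (\sum_i Q_i) g has
   negative drift outside a finite set. To build g, combine two effects: as long as
   x < lambda, setups are created and turned into busy servers, so a smoothed
   combination of x, i and s increases (its truncated cube, scaled by N, pays for all
   states with x well below lambda); near x = lambda, either a setup is in progress and
   increases x + i, or one is about to start.

   The limit follows by applying the balance equation to bounded functions of
   (x, s, i): the truncated cube gives (lambda - x)_+ -> 0, while E x <= lambda from
   the task count; the functions x + i (with i cut off), s^2, s, x + s + i and x then
   force, in this order, the setups seen by blocked arrivals, s, i, the probability of
   being blocked, and Q_2 / N to vanish. *)

(** * Transition probabilities of a chain *)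

(** All that is known of a chain is the joint law of finitely many jumps and holding-time tails;
    there is no semigroup, and non-explosion is not given. Hence transition probabilities are
    bounded from below only, through events with at most one jump per time step.

    The obstacle to stability is that [V1] alone has positive drift in blocked states with few busy
    servers, however many tasks there are. Since [x] can be as small as [1 / N], the congestion [r]
    can reach order [N], so the low-load part of [g] carries a factor [N]. This dictates the cube.
    If [w] is the truncated shortfall of the smoothed combination, the drift of [- w ^+ 3] is at
    least [c w^2 - C w / N - C / N^2], and [N] times this is at least [- O(1 / N)] by completing the
    square. The same bound for a square would leave, after multiplication by [N], an error of order
    1 even where [w = 0]. *)

Section TailSigmaAlgebra.
Context (R : realType).

(** [None] leaves a coordinate free. The whole space is then a cylinder, and the cylinders form a
    pi-system generating the events of the first [n.+1] coordinates. *)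
Definition tail_cyl (n : nat) (h : nat -> option R) : set (nat -> \bar R) :=
  [set v | forall k, (k <= n)%N -> if h k is Some r then (r%:E < v k)%E else true].

Definition tail_cyls (n : nat) : set (set (nat -> \bar R)) :=
  [set A | exists h, A = tail_cyl n h].

Definition tail_space (n : nat) := g_sigma_algebraType (tail_cyls n).

Lemma tail_cyls_setI (n : nat) : setI_closed (tail_cyls n).
Proof.
move=> _ _ [h ->] [g ->].
exists (fun k => if h k is Some r then
  (if g k is Some s then Some (Num.max r s) else Some r) else g k).
apply/seteqP; split => v /=.
  move=> [hv gv] k kn; have := hv k kn; have := gv k kn.
  case: (h k) => [r|]; case: (g k) => [s|] //= sv rv.
  by rewrite EFin_max gt_max rv sv.
move=> hg; split=> k kn; have := hg k kn.
  case: (h k) => [r|] //; case: (g k) => [s|] //.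
  by rewrite EFin_max gt_max => /andP[].
case: (h k) => [r|] //; case: (g k) => [s|] //.
by rewrite EFin_max gt_max => /andP[].
Qed.

Lemma tail_cyls_setT (n : nat) : tail_cyls n setT.
Proof. by exists (fun _ => None); apply/seteqP; split. Qed.

Lemma measurable_tail_cyl (n : nat) (h : nat -> option R) :
  measurable (tail_cyl n h : set (tail_space n)).
Proof. by apply: sub_sigma_algebra; exists h. Qed.

Lemma measurable_coord (n k : nat) : (k <= n)%N ->
  measurable_fun setT (fun v : tail_space n => (v : nat -> \bar R) k).
Proof.
move=> kn; apply: (measurability _ (ErealGenOInfty.measurableE R)).
move=> _ [_ [r ->] <-].
suff -> : setT `&` (fun v : tail_space n => v k) @^-1` `]r%:E, +oo[ =
    tail_cyl n (fun j => if j == k then Some r else None).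
  exact: measurable_tail_cyl.
rewrite setTI; apply/seteqP; split => v /=.
  by rewrite in_itv/= andbT => rv j _; case: eqP => // ->.
by move=> /(_ k kn); rewrite eqxx in_itv/= andbT.
Qed.

Context d (T : measurableType d) (P : probability T R).

Lemma measurable_to_tail (n : nat) (f : T -> nat -> \bar R) :
  (forall k, measurable_fun setT (f ^~ k)) ->
  measurable_fun setT (f : T -> tail_space n).
Proof.
move=> mf; apply: (@measurability _ _ T (tail_space n) setT f (tail_cyls n)) => //.
move=> _ [_ [h ->] <-]; rewrite setTI.
have -> : f @^-1` tail_cyl n h = \bigcap_(k in [set k | (k <= n)%N])
    (if h k is Some r then [set w | (r%:E < f w k)%E] else setT).
  apply/seteqP; split => w /= H k /= kn; have := H k kn; by case: (h k).
apply: bigcap_measurable; first by exists 0%N.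
move=> k _; case: (h k) => [r|] //.
rewrite -[X in measurable X]setTI.
exact: emeasurable_fun_o_infty.
Qed.

(* Two laws of sequences which agree, up to a factor, on tail events agree on
   all events of the first n+1 coordinates. *)
Lemma tail_transfer (n : nat) (E1 E2 : set T) (f1 f2 : T -> nat -> \bar R)
    (c : R) : 0 <= c -> measurable E1 -> measurable E2 ->
  (forall k, measurable_fun setT (f1 ^~ k)) ->
  (forall k, measurable_fun setT (f2 ^~ k)) ->
  (forall h, P (E1 `&` f1 @^-1` tail_cyl n h) =
             (c%:E * P (E2 `&` f2 @^-1` tail_cyl n h))%E) ->
  forall D : set (tail_space n), measurable D ->
    P (E1 `&` f1 @^-1` D) = (c%:E * P (E2 `&` f2 @^-1` D))%E.
Proof.
move=> c0 mE1 mE2 /(measurable_to_tail (n := n)) mf1 /(measurable_to_tail (n := n)) mf2 cyl D mD.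
pose m1 : {measure set (tail_space n) -> \bar R} :=
  pushforward (mrestr P mE1) (f1 : T -> tail_space n).
pose m2 : {measure set (tail_space n) -> \bar R} :=
  mscale (NngNum c0) (pushforward (mrestr P mE2) (f2 : T -> tail_space n)).
suff : m1 mf1 D = m2 mf2 D.
  by rewrite /m1 /m2/= /mscale/= /pushforward /mrestr setIC => ->; rewrite setIC.
apply: (@measure_unique _ R (tail_space n) (tail_cyls n) (fun _ => setT) _ _ _ _
  (m1 mf1) (m2 mf2)) => //=.
- exact: tail_cyls_setI.
- by move=> _; exact: tail_cyls_setT.
- by rewrite bigcup_const.
- move=> _ [h ->].
  by rewrite /m1 /m2/= /mscale/= /pushforward /mrestr setIC cyl setIC.
- move=> _; rewrite /m1 /= /pushforward /mrestr preimage_setT setTI.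
  by rewrite (le_lt_trans (probability_le1 _ _))// ltry.
Qed.

End TailSigmaAlgebra.

(** The series runs over the codes of [I]; a number that codes no element contributes the empty
    set. *)
Lemma measure_countable_partition d (T : measurableType d) (R : realType)
    (mu : {measure set T -> \bar R}) (I : countType) (B : I -> set T) (E : set T) :
  (forall i, measurable (B i)) -> (forall i j w, B i w -> B j w -> i = j) ->
  (forall w, exists i, B i w) -> measurable E ->
  mu E = (\sum_(k <oo) mu (if @pickle_inv I k is Some i then B i `&` E else set0))%E.
Proof.
move=> mB tB cB mE.
pose F k := if @pickle_inv I k is Some i then B i `&` E else set0.
have mF k : measurable (F k).
  by rewrite /F; case: (pickle_inv k) => [i|//]; exact: measurableI.
have EF : E = \bigcup_k F k.
  apply/seteqP; split => w; last by move=> [k _]; rewrite /F; case: pickle_inv => // i [].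
  move=> Ew; have [i Bi] := cB w; exists (pickle i) => //.
  by rewrite /F pickleK_inv.
rewrite {1}EF measure_semi_bigcup//; do ?exact: bigcupT_measurable.
move=> k l _ _ [w []]; rewrite /F.
case: (pickle_inv k) (@pickle_invK I k) => //= i <- [Bi _].
case: (pickle_inv l) (@pickle_invK I l) => //= j <- [Bj _].
by rewrite (tB i j w).
Qed.

Lemma measure_disjoint_sum_le d (T : measurableType d) (R : realType)
    (mu : {measure set T -> \bar R}) (I : eqType) (Z : seq I) (F : I -> set T) (E : set T) :
  uniq Z -> (forall i, measurable (F i)) -> measurable E ->
  (forall i j w, F i w -> F j w -> i = j) -> (forall i, i \in Z -> F i `<=` E) ->
  (\sum_(i <- Z) mu (F i) <= mu E)%E.
Proof.
move=> + mF + dF; elim: Z E => [|i Z IH] E /=; first by rewrite big_nil.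
move=> /andP[iZ uZ] mE FE; rewrite big_cons.
have -> : mu E = (mu (F i) + mu (E `\` F i))%E.
  rewrite -measureU//; [|exact: measurableD|by rewrite setDE setICA setICr setI0].
  by rewrite setUDr setDv setD0 setUidr//; apply: FE; exact: mem_head.
rewrite leeD2l//; apply: IH => //; first exact: measurableD.
move=> j jZ w Fj; split; first by apply: FE Fj; rewrite inE jZ orbT.
by move=> Fi; move: iZ; rewrite (dF i j w Fi Fj) jZ.
Qed.

(** * Memorylessness and lower bounds on transition probabilities *)

Section ChainMarkov.
Context (R : realType) (N : nat) (rate : state N -> state N -> R) (X : ctmc rate).
Local Notation q := (exit_rate rate).
Local Notation p := (jump_prob rate).
Implicit Types (x z : state N) (y : nat -> state N) (n : nat) (t s : R).

Hypothesis rate_ge0 : forall x z, 0 <= rate x z.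

Lemma exit_rate_ge0 x : 0 <= q x.
Proof. by apply: fine_ge0; apply: esum_ge0 => z _; rewrite lee_fin. Qed.

Lemma jump_prob_ge0 x z : 0 <= p x z.
Proof.
rewrite /jump_prob; case: ifP => // _; case: ifP => // _.
by rewrite divr_ge0// exit_rate_ge0.
Qed.

Definition path_set y n : set (paths X) :=
  [set w | forall k, (k <= n)%N -> jump k w = y k].

Lemma measurable_jump_in n (A : set (state N)) :
  measurable [set w : paths X | A (jump n w)].
Proof. rewrite -[X in measurable X]setTI; exact: (@measurable_jump _ _ _ _ X n). Qed.

Lemma measurable_path_set y n : measurable (path_set y n).
Proof.
have -> : path_set y n = \bigcap_(k in [set k | (k <= n)%N]) [set w | jump k w = y k] by [].
apply: bigcap_measurable; first by exists 0%N.
by move=> k _; exact: (measurable_jump_in k [set y k]).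
Qed.

Lemma measurable_hold_gt k (a : \bar R) : measurable [set w : paths X | (a < hold k w)%E].
Proof.
rewrite -[X in measurable X]setTI; apply: emeasurable_fun_o_infty => //.
exact: measurable_hold.
Qed.

Lemma law_path x y n :
  law X x (path_set y n) = ((y 0%N == x)%:R * \prod_(k < n) p (y k) (y k.+1))%:E.
Proof.
have := @jump_holdE _ _ _ _ X x n y (fun _ => 0) (fun _ => lexx 0).
under [X in _ * X]eq_bigr do rewrite mulr0 oppr0 expR0.
rewrite big1_eq mulr1 => <-; congr (law X x _).
apply/seteqP; split => w Hw k kn; last by have [] := Hw k kn.
by split; [exact: Hw|exact: hold_gt0].
Qed.

(** Memorylessness: once [a] has elapsed in the [n]-th state, the residual holding time, jointly
    with the earlier ones, is distributed as the original one, up to the probability of surviving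
    [a] and of the prescribed [j] further jumps and holds. Only [j = 0] and [j = 1] are used. *)
Lemma path_set_transfer x y n j (b : nat -> R) (a : R) :
  0 <= a -> (forall k, 0 <= b k) ->
  forall D : set (tail_space R n), measurable D ->
  law X x ([set w | [/\ forall k, (k <= n + j)%N -> jump k w = y k,
       forall k, (n < k <= n + j)%N -> ((b k)%:E < hold k w)%E & (a%:E < hold n w)%E]]
     `&` (fun w k => if k == n then (hold k w - a%:E)%E else hold k w) @^-1` D) =
  ((\prod_(n <= k < n + j) p (y k) (y k.+1)
     * (\prod_(n.+1 <= k < (n + j).+1) expR (- (q (y k) * b k)) *
     expR (- (q (y n) * a))))%:E *
  law X x (path_set y n `&` (fun w k => hold k w) @^-1` D))%E.
Proof.
move=> a0 b0; apply: tail_transfer.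
- rewrite !mulr_ge0 ?expR_ge0//.
    apply: prodr_ge0 => k _; exact: jump_prob_ge0.
  by apply: prodr_ge0 => k _; exact: expR_ge0.
- have -> : [set w : paths X | [/\ forall k, (k <= n + j)%N -> jump k w = y k,
       forall k, (n < k <= n + j)%N -> ((b k)%:E < hold k w)%E & (a%:E < hold n w)%E]]
     = path_set y (n + j) `&` ((\bigcap_(k in [set k | (n < k <= n + j)%N])
         [set w | ((b k)%:E < hold k w)%E]) `&` [set w | (a%:E < hold n w)%E]).
    apply/seteqP; split => w /=; first by case=> ? ? ?; split => //; split => // k.
    by case=> ? [bw ?]; split => // k; exact: bw.
  apply: measurableI; first exact: measurable_path_set.
  apply: measurableI; last exact: measurable_hold_gt.
  apply: bigcap_measurableType => k _; exact: measurable_hold_gt.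
- exact: measurable_path_set.
- move=> k /=; case: (k == n); last exact: measurable_hold.
  have := @emeasurable_funB _ _ R setT (fun w : paths X => hold k w) (fun _ => a%:E)
    (@measurable_hold _ _ _ _ X k) (@measurable_cst _ _ _ _ _ _).
  exact.
- by move=> k; exact: measurable_hold.
move=> h.
(* Absent or negative thresholds become 0, which changes nothing as holding times are positive. *)
pose h0 k : R := if h k is Some r then Num.max 0 r else 0.
have h0_ge0 k : 0 <= h0 k by rewrite /h0; case: (h k) => // r; rewrite le_max lexx.
have h0P k w : ((h0 k)%:E < hold k w)%E =
    (if h k is Some r then (r%:E < hold k w)%E else true).
  rewrite /h0; case: (h k) => [r|]; last by rewrite hold_gt0.
  by rewrite EFin_max gt_max hold_gt0.
(* Thresholds of the unshifted holding times: raised by [a] at [n], given by [b] after [n]. *)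
pose H k : R := if (k < n)%N then h0 k else if k == n then h0 n + a else b k.
have H_ge0 k : 0 <= H k.
  by rewrite /H; case: ifP => // _; case: ifP => // _; exact: addr_ge0.
have -> : path_set y n `&` (fun w k => hold k w) @^-1` tail_cyl n h =
    [set w | forall k, (k <= n)%N -> jump k w = y k /\ ((h0 k)%:E < hold k w)%E].
  apply/seteqP; split => w /=.
    by move=> [yw hw] k kn; rewrite yw// h0P; split=> //; exact: hw.
  move=> Hw; split=> k kn; have [] := Hw k kn => //.
  by rewrite h0P.
rewrite (@jump_holdE _ _ _ _ X x n y h0)//.
transitivity (law X x [set w | forall k, (k <= n + j)%N ->
    jump k w = y k /\ ((H k)%:E < hold k w)%E]).
  congr (law X x _); apply/seteqP; split => w /=.
    move=> [[yw bw aw] hw] k knj; split; first exact: yw.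
    rewrite /H; case: ltnP => [kn|nk].
      by have := hw k (ltnW kn); rewrite /= h0P ltn_eqF.
    case: eqVneq => [kn|kn]; last by apply: bw; rewrite ltn_neqAle eq_sym kn nk.
    have := hw n (leqnn n); rewrite /= eqxx EFinD kn /h0; case: (h n) => [r|_].
      rewrite EFinN lteBrDr// => ra; rewrite -EFinD addr_maxl add0r.
      by rewrite EFin_max gt_max aw.
    by rewrite add0e.
  move=> Hw.
  have an : (a%:E < hold n w)%E.
    have [_] := Hw n (leq_addr _ _); rewrite /H ltnn eqxx; apply: le_lt_trans.
    by rewrite lee_fin lerDr.
  split; first split => //.
  - by move=> k kn; have [] := Hw k kn.
  - move=> k /andP[nk knj]; have [_] := Hw k knj.
    by rewrite /H ltnNge (ltnW nk) gtn_eqF.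
  move=> k kn; have [_] := Hw k (leq_trans kn (leq_addr _ _)).
  rewrite /H; move: kn; rewrite leq_eqVlt => /predU1P[->|kn].
    rewrite /= ltnn eqxx /h0; case: (h n) => [r|//].
    by rewrite EFinN lteBrDr// addr_maxl EFin_max gt_max => /andP[_].
  by rewrite /= kn h0P ltn_eqF.
rewrite (@jump_holdE _ _ _ _ X x (n + j) y H)// -EFinM; congr EFin.
rewrite -!(big_mkord xpredT (fun k => p (y k) (y k.+1))).
rewrite -(big_mkord xpredT (fun k => expR (- (q (y k) * H k)))).
rewrite -(big_mkord xpredT (fun k => expR (- (q (y k) * h0 k)))).
rewrite (@big_cat_nat _ _ _ n 0 (n + j))//= ?leq_addr//.
rewrite (@big_cat_nat _ _ _ n 0 (n + j).+1)//=; last by rewrite leqW// leq_addr.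
rewrite (@big_ltn _ _ _ n (n + j).+1)//; last by rewrite ltnS leq_addr.
rewrite [X in _ = _ * (_ * X)]big_nat_recr//=.
have -> : \prod_(0 <= k < n) expR (- (q (y k) * H k)) =
          \prod_(0 <= k < n) expR (- (q (y k) * h0 k)).
  by apply: eq_big_nat => k /andP[_ kn]; rewrite /H kn.
have -> : \prod_(n.+1 <= k < (n + j).+1) expR (- (q (y k) * H k)) =
          \prod_(n.+1 <= k < (n + j).+1) expR (- (q (y k) * b k)).
  apply: eq_big_nat => k /andP[nk _].
  by rewrite /H ltnNge (ltnW nk) gtn_eqF.
have -> : H n = h0 n + a by rewrite /H ltnn eqxx.
rewrite mulrDr opprD expRD.
ring.
Qed.

(** The paths of the first [n] jumps form a countable partition, so proportionality may be checked
    on each of them. *)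
Lemma law_path_ext x n (E1 E2 : set (paths X)) (c : R) :
  0 <= c -> measurable E1 -> measurable E2 ->
  (forall y, law X x (path_set y n `&` E1) = (c%:E * law X x (path_set y n `&` E2))%E) ->
  law X x E1 = (c%:E * law X x E2)%E.
Proof.
move=> c0 mE1 mE2 Ey.
pose B (i : n.+1.-tuple (state N)) := path_set (nth point i) n.
have mB i : measurable (B i) by exact: measurable_path_set.
have tB (i j : n.+1.-tuple (state N)) w : B i w -> B j w -> i = j.
  move=> Bi Bj; apply/val_inj/(@eq_from_nth _ point); rewrite ?size_tuple// => k kn.
  by rewrite -Bi// Bj.
have cB w : exists i, B i w.
  exists (mktuple (fun k : 'I_n.+1 => jump k w)) => k kn.
  by rewrite -(tnth_nth point _ (Ordinal (kn : (k < n.+1)%N))) tnth_mktuple.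
rewrite (@measure_countable_partition _ _ _ _ _ B)//.
rewrite [in RHS](@measure_countable_partition _ _ _ _ _ B)// -nneseriesZl//.
apply: eq_eseriesr => k _; case: (pickle_inv k) => [i|]; last by rewrite measure0 mule0.
exact: Ey.
Qed.

Lemma jump_timeS n (w : paths X) : jump_time n.+1 w = (jump_time n w + hold n w)%E.
Proof. by rewrite /jump_time big_ord_recr. Qed.

Lemma jump_time_ge0 n (w : paths X) : (0 <= jump_time n w)%E.
Proof. by apply: sume_ge0 => k _; exact/ltW/hold_gt0. Qed.

Lemma jump_time_le n m (w : paths X) : (n <= m)%N -> (jump_time n w <= jump_time m w)%E.
Proof.
move=> /subnK <-; elim: (m - n)%N => [//|k IH]; rewrite addSn jump_timeS.
by apply: (le_trans IH); rewrite leeDl// ltW// hold_gt0.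
Qed.

Lemma measurable_jump_time n : measurable_fun setT (@jump_time _ _ _ _ X n).
Proof.
apply: (@emeasurable_sum _ _ R setT _ _ (fun (k : 'I_n) (w : paths X) => hold k w)) => k.
exact: measurable_hold.
Qed.

Lemma measurable_jump_time_le n t : measurable [set w : paths X | (jump_time n w <= t%:E)%E].
Proof.
rewrite -[X in measurable X]setTI.
exact: (emeasurable_fun_infty_c measurableT (@measurable_jump_time n)).
Qed.

Lemma measurable_jump_time_gt n t : measurable [set w : paths X | (t%:E < jump_time n w)%E].
Proof.
rewrite -[X in measurable X]setTI.
exact: (emeasurable_fun_o_infty measurableT (@measurable_jump_time n)).
Qed.

Definition occupies n z t : set (paths X) :=
  [set w | [/\ jump n w = z, (jump_time n w <= t%:E)%E & (t%:E < jump_time n.+1 w)%E]].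

Lemma set_and3 T (A B C : set T) : [set w | [/\ A w, B w & C w]] = A `&` B `&` C.
Proof. by apply/seteqP; split => w /=; [case|case=> -[]]. Qed.

Lemma measurable_occupies n z t : measurable (occupies n z t).
Proof.
rewrite /occupies set_and3; apply: measurableI; last exact: measurable_jump_time_gt.
apply: measurableI; last exact: measurable_jump_time_le.
exact: (measurable_jump_in n [set z]).
Qed.

(** The chain is in its [n]-th state at time [t], as an event on the holding times alone. *)
Let window n t : set (tail_space R n) :=
  [set v : nat -> \bar R | (\sum_(k < n) v k <= t%:E)%E /\ (t%:E < \sum_(k < n.+1) v k)%E].

Arguments window : clear implicits.

Let measurable_window n t : measurable (window n t).
Proof.
have mS m : (m <= n.+1)%N ->
    measurable_fun setT (fun v : tail_space R n => \sum_(k < m) (v : nat -> \bar R) k)%E.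
  move=> mn; apply: (@emeasurable_sum _ _ R setT _ _
    (fun (k : 'I_m) (v : tail_space R n) => (v : nat -> \bar R) k)) => k.
  by apply: measurable_coord; rewrite -ltnS (leq_trans _ mn).
apply: measurableI.
  rewrite -[X in measurable X]setTI.
  exact: (emeasurable_fun_infty_c measurableT (mS n (leqnSn n))).
rewrite -[X in measurable X]setTI.
exact: (emeasurable_fun_o_infty measurableT (mS n.+1 (leqnn _))).
Qed.

Let window_shiftE n t a (w : paths X) : 0 <= a ->
  ((a%:E < hold n w)%E /\
   window n t (fun k => if k == n then (hold k w - a%:E)%E else hold k w)) <->
  (jump_time n w <= t%:E)%E /\ ((t + a)%:E < jump_time n.+1 w)%E.
Proof.
move=> a0; rewrite /window /= big_ord_recr/= eqxx.
have -> : (\sum_(i < n) (if (i : nat) == n then hold i w - a%:E else hold i w) =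
          jump_time n w)%E.
  by apply: eq_bigr => i _; rewrite ltn_eqF.
rewrite jump_timeS; have := jump_time_ge0 n w; have := hold_gt0 n w.
case: (jump_time n w) => [T||]//=; case: (hold n w) => [h||]//=.
- rewrite !lee_fin !lte_fin => h0 T0.
  by split=> [[ah [Tt tT]]|[Tt tT]]; [split; lra|split; [lra|split; lra]].
- by rewrite !ltry => _ T0; split=> [[_ [? _]]|[? _]].
- by move=> _ _; split=> [[_ []]|[]].
- by move=> _ _; split=> [[_ []]|[]].
Qed.

Let path_set_disjoint y n z (E : set (paths X)) : y n != z ->
  (forall w, E w -> jump n w = z) -> path_set y n `&` E = set0.
Proof.
move=> yz Ez; apply/seteqP; split=> w //= [yw /Ez].
by rewrite yw// => /eqP; rewrite (negbTE yz).
Qed.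

Lemma law_occupies_stay x n z t a : 0 <= a ->
  law X x [set w | [/\ jump n w = z, (jump_time n w <= t%:E)%E &
                       ((t + a)%:E < jump_time n.+1 w)%E]] =
  ((expR (- (q z * a)))%:E * law X x (occupies n z t))%E.
Proof.
move=> a0; apply: (@law_path_ext x n) => //.
- rewrite set_and3; apply: measurableI; last exact: measurable_jump_time_gt.
  apply: measurableI; last exact: measurable_jump_time_le.
  exact: (measurable_jump_in n [set z]).
- exact: measurable_occupies.
move=> y; have [yz|yz] := eqVneq (y n) z; last first.
  by rewrite !(path_set_disjoint yz) ?measure0 ?mule0// => w [].
have := @path_set_transfer x y n 0 (fun _ => 0) a a0 (fun _ => lexx 0) _ (@measurable_window n t).
rewrite addn0 !big_geq// !mul1r yz => H.
transitivity (law X x (path_set y n `&` (fun w k => hold k w) @^-1` window n t) *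
   (expR (- (q z * a)))%:E)%E.
  rewrite muleC -H; congr (law X x _); apply/seteqP; split => w /=.
    move=> [yw [_ Tn Tn1]].
    have [an wn] := (@window_shiftE n t a w a0).2 (conj Tn Tn1).
    by split=> //; split=> // k /andP[nk]; rewrite leqNgt nk.
  move=> [[yw _ an] wn]; split=> //.
  have [] := (@window_shiftE n t a w a0).1 (conj an wn).
  by split => //; rewrite yw.
rewrite muleC; congr (_ * law X x _)%E; apply/seteqP; split => w /=.
  by move=> [yw [? ?]]; split => //; split => //; rewrite yw.
by move=> [yw [_ ? ?]].
Qed.

(** The difference of the cases [a = 0] and [a = s] is the probability that the next jump falls
    within time [s] after [t], leads to [z'], and is followed by a stay longer than [s]. *)
Lemma law_occupies_move x n z z' t a s : 0 <= a -> 0 <= s ->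
  law X x [set w | [/\ jump n w = z, (jump_time n w <= t%:E)%E,
     ((t + a)%:E < jump_time n.+1 w)%E, jump n.+1 w = z' & (s%:E < hold n.+1 w)%E]] =
  ((p z z' * expR (- (q z' * s)) * expR (- (q z * a)))%:E * law X x (occupies n z t))%E.
Proof.
move=> a0 s0; apply: (@law_path_ext x n) => //.
- by rewrite !mulr_ge0 ?expR_ge0 ?jump_prob_ge0.
- have -> : [set w : paths X | [/\ jump n w = z, (jump_time n w <= t%:E)%E,
     ((t + a)%:E < jump_time n.+1 w)%E, jump n.+1 w = z' & (s%:E < hold n.+1 w)%E]] =
   [set w | jump n w = z] `&` [set w | (jump_time n w <= t%:E)%E] `&`
   [set w | ((t + a)%:E < jump_time n.+1 w)%E] `&` [set w | jump n.+1 w = z'] `&`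
   [set w | (s%:E < hold n.+1 w)%E].
    by apply/seteqP; split => w /=; [case|case=> -[[[]]]].
  apply: measurableI; last exact: measurable_hold_gt.
  apply: measurableI; last exact: (measurable_jump_in n.+1 [set z']).
  apply: measurableI; last exact: measurable_jump_time_gt.
  apply: measurableI; last exact: measurable_jump_time_le.
  exact: (measurable_jump_in n [set z]).
- exact: measurable_occupies.
move=> y; have [yz|yz] := eqVneq (y n) z; last first.
  by rewrite !(path_set_disjoint yz) ?measure0 ?mule0// => w [].
pose y' k := if k == n.+1 then z' else y k.
have y'E k : (k <= n)%N -> y' k = y k by move=> kn; rewrite /y' ltn_eqF.
have y'n : y' n.+1 = z' by rewrite /y' eqxx.
have pathE : path_set y' n = path_set y n.
  by apply/seteqP; split => w yw k kn; rewrite yw// y'E.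
have := @path_set_transfer x y' n 1 (fun _ => s) a a0 (fun _ => s0) _ (@measurable_window n t).
rewrite addn1 !big_nat1 y'n (y'E n)// yz pathE mulrA => H.
transitivity (law X x (path_set y n `&` (fun w k => hold k w) @^-1` window n t) *
   (p z z' * expR (- (q z' * s)) * expR (- (q z * a)))%:E)%E.
  rewrite muleC -H; congr (law X x _); apply/seteqP; split => w /=.
    move=> [yw [_ Tn Tn1 jz' sh]].
    have [an wn] := (@window_shiftE n t a w a0).2 (conj Tn Tn1).
    split=> //; split=> // k.
      by rewrite leq_eqVlt => /predU1P[->|kn]; rewrite ?y'n// y'E// yw.
    by rewrite -eqn_leq => /eqP <-.
  move=> [[yw hw an] wn].
  have [Tn Tn1] := (@window_shiftE n t a w a0).1 (conj an wn).
  split; first by move=> k kn; rewrite yw ?y'E// leqW.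
  split => //.
  - by rewrite yw ?y'E.
  - by rewrite yw// y'n.
  - by apply: hw; rewrite !leqnn.
rewrite muleC; congr (_ * law X x _)%E; apply/seteqP; split => w /=.
  by move=> [yw [? ?]]; split => //; split => //; rewrite yw.
by move=> [yw [_ ? ?]].
Qed.

Lemma occupies_inj n m z z' t (w : paths X) : occupies n z t w -> occupies m z' t w -> n = m /\ z = z'.
Proof.
move=> [jn Tn tn] [jm Tm tm]; suff nm : n = m by split => //; rewrite -jn -jm nm.
apply/eqP; rewrite eqn_leq; apply/andP; split; rewrite leqNgt; apply/negP => lt.
- by have := lt_le_trans tm (le_trans (jump_time_le w lt) Tn); rewrite ltxx.
- by have := lt_le_trans tn (le_trans (jump_time_le w lt) Tm); rewrite ltxx.
Qed.

Lemma in_at1E t z : in_at t [set z] = \bigcup_n occupies n z t.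
Proof.
by apply/seteqP; split => w /=; [move=> [n [? ? ?]]|move=> [n _ [? ? ?]]]; exists n.
Qed.

Lemma measurable_in_at t (A : set (state N)) : measurable (in_at t A : set (paths X)).
Proof.
have -> : in_at t A = \bigcup_n ([set w : paths X | (jump_time n w <= t%:E)%E] `&`
   [set w | (t%:E < jump_time n.+1 w)%E] `&` [set w | A (jump n w)]).
  apply/seteqP; split => w /=.
    by move=> [n [? ? ?]]; exists n.
  by move=> [n _ [[? ?] ?]]; exists n.
apply: bigcupT_measurable => n; apply: measurableI; last exact: measurable_jump_in.
by apply: measurableI; [exact: measurable_jump_time_le|exact: measurable_jump_time_gt].
Qed.

Lemma in_at_inj t z z' (w : paths X) : in_at t [set z] w -> in_at t [set z'] w -> z = z'.
Proof.
by rewrite !in_at1E => -[n _ wn] [m _ wm]; have [] := occupies_inj wn wm.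
Qed.

Lemma law_in_at1 x t z :
  law X x (in_at t [set z]) = (\sum_(n <oo) law X x (occupies n z t))%E.
Proof.
rewrite in_at1E measure_semi_bigcup//.
- by move=> n; exact: measurable_occupies.
- by move=> n m _ _ [w [wn wm]]; have [] := occupies_inj wn wm.
- by apply: bigcupT_measurable => n; exact: measurable_occupies.
Qed.

Hypothesis rate_le : forall z z', z != z' -> rate z z' <= q z.
Variable Lam : R.
Hypothesis Lam_ge : forall z, 2 * q z <= Lam.

(* The entries of exp(-Lam s) (I + s (Lam + L)), where L is the generator. This
   kernel is below the transition probabilities over a time s, agrees with them
   up to order s^2, and multiplies every invariant vector of L by a constant. *)
Definition euler_kernel s z z' : R :=
  expR (- (Lam * s)) * (if z == z' then 1 + (Lam - q z) * s else s * rate z z').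

Lemma Lam_ge0 : 0 <= Lam.
Proof. by apply: le_trans (Lam_ge point); rewrite mulr_ge0// exit_rate_ge0. Qed.

Lemma euler_kernel_ge0 s z z' : 0 <= s -> 0 <= euler_kernel s z z'.
Proof.
move=> s0; rewrite mulr_ge0 ?expR_ge0//; case: ifP => _; last by rewrite mulr_ge0.
rewrite addr_ge0// mulr_ge0// subr_ge0; apply: le_trans (Lam_ge z).
by rewrite ler_peMl ?exit_rate_ge0// ler1n.
Qed.

Lemma euler_kernel_diag s z : 0 <= s -> euler_kernel s z z <= expR (- (q z * s)).
Proof.
move=> s0; rewrite /euler_kernel eqxx.
have -> : - (q z * s) = - (Lam * s) + (Lam - q z) * s by ring.
by rewrite expRD ler_wpM2l ?expR_ge0// expR_ge1Dx.
Qed.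

(** The right-hand side is the probability of jumping to [z'] within time [s] and then staying
    longer than [s]. The bound combines [u * expR (- u) <= 1 - expR (- u)] with [q z + q z' <= Lam];
    the latter is the reason for the factor 2 in [Lam_ge]. *)
Lemma euler_kernel_offdiag s z z' : 0 <= s -> z != z' ->
  euler_kernel s z z' <= (1 - expR (- (q z * s))) * (p z z' * expR (- (q z' * s))).
Proof.
move=> s0 zz'; rewrite /euler_kernel (negbTE zz') /jump_prob.
have [q0|q0] := eqVneq (q z) 0.
  have -> : rate z z' = 0.
    by apply/eqP; rewrite eq_le rate_ge0 andbT -q0 rate_le.
  by rewrite q0 mul0r oppr0 expR0 subrr mul0r !mulr0.
rewrite (negbTE zz').
have qz : 0 < q z by rewrite lt0r q0 exit_rate_ge0.
have e1 : expR (- (q z * s)) * (q z * s) <= 1 - expR (- (q z * s)).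
  rewrite lerBrDr -[X in _ + X <= _]mulr1 -mulrDr -[leRHS](expRxMexpNx_1 (q z * s)).
  by rewrite [leRHS]mulrC ler_wpM2l ?expR_ge0// addrC expR_ge1Dx.
apply: (@le_trans _ _ (expR (- (q z * s)) * (q z * s) * (rate z z' / q z * expR (- (q z' * s))))).
  have -> : expR (- (q z * s)) * (q z * s) * (rate z z' / q z * expR (- (q z' * s))) =
     expR (- (q z * s)) * expR (- (q z' * s)) * (s * rate z z') by field.
  rewrite -expRD ler_wpM2r ?mulr_ge0// ler_expR -opprD lerN2 -mulrDl ler_wpM2r//.
  by have := Lam_ge z; have := Lam_ge z'; lra.
by rewrite ler_wpM2r// mulr_ge0 ?expR_ge0// divr_ge0// exit_rate_ge0.
Qed.

Let step x t s z (y : state N) : 0 <= s ->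
  ((euler_kernel s z y)%:E * law X x (in_at t [set z]) <=
   law X x (in_at t [set z] `&` in_at (t + s) [set y]))%E.
Proof.
move=> s0; have [<-{y}|zy] := eqVneq z y.
  pose A n : set (paths X) := [set w | [/\ jump n w = z, (jump_time n w <= t%:E)%E &
                       ((t + s)%:E < jump_time n.+1 w)%E]].
  have Aocc n w : A n w -> occupies n z t w /\ occupies n z (t + s) w.
    move=> [jz Tn tT]; split; split => //.
      by apply: le_lt_trans tT; rewrite lee_fin lerDl.
    by apply: (le_trans Tn); rewrite lee_fin lerDl.
  have mA n : measurable (A n).
    rewrite /A set_and3; apply: measurableI; last exact: measurable_jump_time_gt.
    apply: measurableI; last exact: measurable_jump_time_le.
    exact: (measurable_jump_in n [set z]).
  apply: (@le_trans _ _ (law X x (\bigcup_n A n))); last first.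
    apply: le_measure; rewrite ?inE.
    - exact: bigcupT_measurable.
    - by apply: measurableI; exact: measurable_in_at.
    - by move=> w [n _ /Aocc[wn wn']]; rewrite !in_at1E; split; exists n.
  rewrite measure_semi_bigcup//; last 2 first.
  - by move=> n m _ _ [w [/Aocc[wn _] /Aocc[wm _]]]; have [] := occupies_inj wn wm.
  - exact: bigcupT_measurable.
  rewrite law_in_at1 -nneseriesZl//; apply: lee_nneseries => [n _ _|n _].
    by rewrite mule_ge0// lee_fin euler_kernel_ge0.
  apply: (@le_trans _ _ ((expR (- (q z * s)))%:E * law X x (occupies n z t))%E);
    last by rewrite -(law_occupies_stay x n z t s0).
  by rewrite lee_wpmul2r// lee_fin euler_kernel_diag.
pose G n a : set (paths X) := [set w | [/\ jump n w = z, (jump_time n w <= t%:E)%E,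
     ((t + a)%:E < jump_time n.+1 w)%E, jump n.+1 w = y & (s%:E < hold n.+1 w)%E]].
have mG n a : measurable (G n a).
  have -> : G n a =
   [set w | jump n w = z] `&` [set w | (jump_time n w <= t%:E)%E] `&`
   [set w | ((t + a)%:E < jump_time n.+1 w)%E] `&` [set w | jump n.+1 w = y] `&`
   [set w | (s%:E < hold n.+1 w)%E].
    by apply/seteqP; split => w /=; [case|case=> -[[[]]]].
  apply: measurableI; last exact: measurable_hold_gt.
  apply: measurableI; last exact: (measurable_jump_in n.+1 [set y]).
  apply: measurableI; last exact: measurable_jump_time_gt.
  apply: measurableI; last exact: measurable_jump_time_le.
  exact: (measurable_jump_in n [set z]).
(* The jump to [y] occurs after [t] and no later than [t + s], and [y] is then held longer than [s],
   so the chain is in [y] at time [t + s]. *)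
pose B n := G n 0 `\` G n s.
have Bocc n w : B n w -> occupies n z t w /\ occupies n.+1 y (t + s) w.
  move=> [[jz Tn tT jy sh] nG]; rewrite addr0 in tT; split; split => //.
    by rewrite leNgt; apply/negP => tsT; apply: nG.
  rewrite jump_timeS EFinD; apply: lteD => //.
have mB n : measurable (B n) by exact: measurableD.
apply: (@le_trans _ _ (law X x (\bigcup_n B n))); last first.
  apply: le_measure; rewrite ?inE.
  - exact: bigcupT_measurable.
  - by apply: measurableI; exact: measurable_in_at.
  - by move=> w [n _ /Bocc[wn wn']]; rewrite !in_at1E; split; [exists n|exists n.+1].
rewrite measure_semi_bigcup//; last 2 first.
- by move=> n m _ _ [w [/Bocc[wn _] /Bocc[wm _]]]; have [] := occupies_inj wn wm.
- exact: bigcupT_measurable.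
rewrite law_in_at1 -nneseriesZl//; apply: lee_nneseries => [n _ _|n _].
  by rewrite mule_ge0// lee_fin euler_kernel_ge0.
rewrite /B measureD//; last by rewrite (le_lt_trans (probability_le1 _ _))// ltry.
have -> : G n 0 `&` G n s = G n s.
  apply/setIidPr => w [? ? ts ? ?]; split => //.
  by apply: le_lt_trans ts; rewrite addr0 lee_fin lerDl.
have G0 := law_occupies_move x n z y t (lexx 0) s0.
have Gs := law_occupies_move x n z y t s0 s0.
rewrite [X in (_ <= X - _)%E]G0 [X in (_ <= _ - X)%E]Gs mulr0 oppr0 expR0 mulr1.
have : law X x (occupies n z t) \is a fin_num.
  by rewrite fin_num_measure//; exact: measurable_occupies.
have : (0 <= law X x (occupies n z t))%E by [].
case: (law X x (occupies n z t)) => [r||]//=; rewrite lee_fin => r0 _.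
rewrite -!EFinM -EFinB lee_fin -mulrBl ler_wpM2r//.
apply: (le_trans (euler_kernel_offdiag s0 zy)).
by rewrite le_eqVlt; apply/orP; left; apply/eqP; ring.
Qed.

(** A one-sided Chapman-Kolmogorov relation: the events of passing through the different states [z]
    at time [t] are disjoint. *)
Lemma in_at_step x t s (Z : seq (state N)) (y : state N) : 0 <= s -> uniq Z ->
  (\sum_(z <- Z) (euler_kernel s z y)%:E * law X x (in_at t [set z]) <=
   law X x (in_at (t + s) [set y]))%E.
Proof.
move=> s0 uZ.
apply: (@le_trans _ _ (\sum_(z <- Z) law X x (in_at t [set z] `&` in_at (t + s) [set y]))%E).
  by apply: lee_sum => z _; exact: step.
have mC z : measurable (in_at t [set z] `&` in_at (t + s) [set y] : set (paths X)).
  by apply: measurableI; exact: measurable_in_at.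
apply: measure_disjoint_sum_le => //.
- exact: measurable_in_at.
- by move=> z z' w [wz _] [wz' _]; exact: in_at_inj wz wz'.
Qed.

End ChainMarkov.

(** * Stationary laws and the generator *)

Lemma esumZl (R : realType) (T : choiceType) (I : set T) (a : T -> \bar R) (c : R) :
  0 <= c -> (forall i, 0 <= a i)%E ->
  (\esum_(i in I) (c%:E * a i) = c%:E * \esum_(i in I) a i)%E.
Proof.
have le (k : R) (f : T -> \bar R) : 0 <= k -> (forall i, 0 <= f i)%E ->
    (\esum_(i in I) (k%:E * f i) <= k%:E * \esum_(i in I) f i)%E.
  move=> k0 f0; apply: ge_ereal_sup => _ [B [fB BI] <-].
  rewrite -ge0_mule_fsumr//.
  by rewrite lee_wpmul2l//; apply: ereal_sup_ubound; exists B.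
move=> c0 a0; have [->|cn] := eqVneq c 0.
  by rewrite mul0e esum1// => i _; rewrite mul0e.
apply/eqP; rewrite eq_le le//=.
have := le c^-1 (fun i => c%:E * a i)%E.
under eq_esum do rewrite muleA -EFinM mulVf// mul1e.
have c1 : 0 <= c^-1 by rewrite invr_ge0.
move=> /(_ c1) H.
have {}H : (\esum_(i in I) a i <= c^-1%:E * \esum_(i in I) (c%:E * a i))%E.
  by apply: H => i; rewrite mule_ge0.
by have := lee_wpmul2l (x := c%:E) c0 H; rewrite muleA -EFinM divff// mul1e.
Qed.

Lemma bernoulli_ineq (R : realDomainType) (u : R) n : 0 <= u <= 1 -> 1 - n%:R * u <= (1 - u) ^+ n.
Proof.
move=> /andP[u0 u1]; elim: n => [|n IH]; first by rewrite mul0r subr0 expr0.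
rewrite exprS; apply: (@le_trans _ _ ((1 - u) * (1 - n%:R * u))); last first.
  by rewrite ler_wpM2l// subr_ge0.
have : 0 <= n%:R * u ^+ 2 by rewrite mulr_ge0 ?sqr_ge0.
by rewrite -natr1; lra.
Qed.

Lemma nneseries_pickle (R : realType) (I : countType) (a : I -> \bar R) :
  (forall i, 0 <= a i)%E ->
  (\sum_(k <oo) (if @pickle_inv I k is Some i then a i else 0) =
   \esum_(i in [set: I]) a i)%E.
Proof.
move=> a0; pose F k : set I := if @pickle_inv I k is Some i then [set i] else set0.
have FT : setT = \bigcup_k F k.
  apply/seteqP; split => [y _|//]; exists (pickle y); first exact: Logic.I.
  by rewrite /F pickleK_inv.
have tF : trivIset setT F.
  move=> k l _ _ [w []]; rewrite /F.
  case: (pickle_inv k) (@pickle_invK I k) => //= i <- ->.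
  by case: (pickle_inv l) (@pickle_invK I l) => //= j <- ->.
rewrite FT esum_bigcupT// -nneseries_esumT; last by move=> k; exact: esum_ge0.
apply: eq_eseriesr => k _; rewrite /F; case: (pickle_inv k) => [i|].
  by rewrite esum_set1.
by rewrite esum_set0.
Qed.

(** * Means of bounded functions of the state *)

Section StateMeans.
Context (R : realType) (N : nat).
Implicit Types (f g : state N -> R).

Definition bounded_by (M : R) f := forall x, `|f x| <= M.
Definition bdd f := exists M, bounded_by M f.

Lemma bdd_cst (c : R) : bdd (fun _ => c).
Proof. by exists `|c|. Qed.

Lemma bdd_indic (A : set (state N)) : bdd (\1_A : state N -> R).
Proof.
exists 1 => x; rewrite indicE; case: (_ \in _); first by rewrite normr1.
by rewrite normr0.
Qed.

Lemma bddD f g : bdd f -> bdd g -> bdd (fun x => f x + g x).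
Proof.
move=> [M Mf] [K Kg]; exists (M + K) => x.
by rewrite (le_trans (ler_normD _ _))// lerD.
Qed.

Lemma bddN f : bdd f -> bdd (fun x => - f x).
Proof. by move=> [M Mf]; exists M => x; rewrite normrN. Qed.

Lemma bddB f g : bdd f -> bdd g -> bdd (fun x => f x - g x).
Proof. by move=> bf bg; apply: bddD => //; exact: bddN. Qed.

Lemma bddM f g : bdd f -> bdd g -> bdd (fun x => f x * g x).
Proof.
move=> [M Mf] [K Kg]; exists (M * K) => x.
by rewrite normrM ler_pM.
Qed.

Lemma bddZ (c : R) f : bdd f -> bdd (fun x => c * f x).
Proof. exact/bddM/bdd_cst. Qed.

Lemma bdd_sum (I : Type) (r : seq I) (P : pred I) (F : I -> state N -> R) :
  (forall i, bdd (F i)) -> bdd (fun x => \sum_(i <- r | P i) F i x).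
Proof.
move=> bF; elim: r => [|i r IH].
  by under eq_fun do rewrite big_nil; exact: bdd_cst.
under eq_fun do rewrite big_cons; case: (P i) => //; exact: bddD.
Qed.

Variable pi : probability (state N) R.

Lemma bdd_integrable f : bdd f -> pi.-integrable setT (EFin \o f).
Proof.
move=> [M Mf]; apply: measurable_bounded_integrable => //.
- by rewrite -ge0_fin_numE// fin_num_measure.
- exists M; split; first exact: num_real.
  by move=> K MK x _; rewrite /= (le_trans (Mf x))// ltW.
Qed.

Lemma mean_cst (c : R) : (\int[pi]_x c = c)%R.
Proof.
apply: etrans (Rintegral_cst _ _ _) _ => //.
by rewrite -[RHS]mulr1; congr (_ * _); exact: (congr1 fine (probability_setT pi)).
Qed.

Lemma meanD f g : bdd f -> bdd g ->
  (\int[pi]_x (f x + g x) = \int[pi]_x f x + \int[pi]_x g x)%R.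
Proof. by move=> bf bg; rewrite RintegralD//; exact: bdd_integrable. Qed.

Lemma meanB f g : bdd f -> bdd g ->
  (\int[pi]_x (f x - g x) = \int[pi]_x f x - \int[pi]_x g x)%R.
Proof. by move=> bf bg; rewrite RintegralB//; exact: bdd_integrable. Qed.

Lemma meanZ (c : R) f : bdd f ->
  (\int[pi]_x (c * f x) = c * \int[pi]_x f x)%R.
Proof. by move=> bf; rewrite RintegralZl//; exact: bdd_integrable. Qed.

Lemma meanN f : bdd f -> (\int[pi]_x (- f x) = - \int[pi]_x f x)%R.
Proof.
move=> bf; have := meanZ (-1) bf; rewrite mulN1r => <-.
by apply: eq_Rintegral => x _; rewrite mulN1r.
Qed.

Lemma mean_le f g : bdd f -> bdd g -> (forall x, f x <= g x) ->
  (\int[pi]_x f x <= \int[pi]_x g x)%R.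
Proof. by move=> bf bg fg; apply: le_Rintegral => //; exact: bdd_integrable. Qed.

Lemma mean_indic (A : set (state N)) : (\int[pi]_x \1_A x = fine (pi A))%R.
Proof. by rewrite /Rintegral integral_indic// setIT. Qed.

Lemma mean_sum (I : Type) (r : seq I) (P : pred I) (F : I -> state N -> R) :
  (forall i, bdd (F i)) ->
  (\int[pi]_x (\sum_(i <- r | P i) F i x) = \sum_(i <- r | P i) \int[pi]_x F i x)%R.
Proof.
move=> bF; elim: r => [|i r IH].
  by under eq_Rintegral do rewrite big_nil; rewrite mean_cst big_nil.
rewrite big_cons; under eq_Rintegral do rewrite big_cons.
case: (P i) => //; rewrite meanD ?IH//; exact: bdd_sum.
Qed.

Lemma meanE f : bdd f -> ((\int[pi]_x f x)%R%:E = \int[pi]_x (f x)%:E)%E.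
Proof.
by move=> bf; rewrite /Rintegral fineK//; apply: integrable_fin_num => //; exact: bdd_integrable.
Qed.

Lemma EFin_prob (A : set (state N)) : (fine (pi A))%:E = pi A.
Proof. by rewrite fineK// fin_num_measure. Qed.

End StateMeans.

Lemma integral_state (R : realType) (N : nat) (mu : {measure set (state N) -> \bar R})
    (f : state N -> \bar R) : (forall x, 0 <= f x)%E ->
  (\int[mu]_x f x = \esum_(y in [set: state N]) (f y * mu [set y]))%E.
Proof.
move=> f0; pose F k : set (state N) := if @pickle_inv (state N) k is Some y then [set y] else set0.
have FT : setT = \bigcup_k F k.
  apply/seteqP; split => [y _|//]; exists (pickle y); first exact: I.
  by rewrite /F pickleK_inv.
have tF : trivIset setT F.
  move=> k l _ _ [w []]; rewrite /F.
  case: (pickle_inv k) (@pickle_invK (state N) k) => //= i <- ->.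
  by case: (pickle_inv l) (@pickle_invK (state N) l) => //= j <- ->.
rewrite -nneseries_pickle; last by move=> y; rewrite mule_ge0.
rewrite FT ge0_integral_bigcup//; apply: eq_eseriesr => k _; rewrite /F.
case: (pickle_inv k) => [y|]; last by rewrite integral_set0.
rewrite (eq_integral (cst (f y))); last by move=> x; rewrite inE => /= ->.
by rewrite integral_cst.
Qed.

(** * Stationarity, balance of the generator and uniqueness *)

Section Stationarity.
Context (R : realType) (N : nat) (rate : state N -> state N -> R) (X : ctmc rate).
Local Notation q := (exit_rate rate).
Local Notation p := (jump_prob rate).
Implicit Types (x y z : state N) (A : set (state N)).

Hypothesis rate_ge0 : forall x y, 0 <= rate x y.
Variable succ : state N -> seq (state N).
Hypothesis succ_uniq : forall x, uniq (succ x).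
Hypothesis succ_irr : forall x, x \notin succ x.
Hypothesis rate_succ : forall x y, y != x -> y \notin succ x -> rate x y = 0.

Lemma exit_rateE x : q x = \sum_(y <- succ x) rate x y.
Proof.
rewrite /exit_rate (_ : esum _ _ = (\sum_(y <- succ x) rate x y)%:E)//.
rewrite -sumEFin (fsbig_seq _ _ (succ_uniq x)) -esum_fset//; last first.
  by move=> y _; rewrite lee_fin.
rewrite esum_mkcond [in RHS]esum_mkcond; apply: eq_esum => y _.
have -> : (y \in [set y | y != x]) = (y != x) by apply/idP/idP; rewrite inE.
have -> : (y \in [set` succ x]) = (y \in succ x) by apply/idP/idP; rewrite inE.
have [->|yx] := eqVneq y x; first by rewrite (negbTE (succ_irr x)).
by have [//|ys] := boolP (y \in succ x); rewrite rate_succ.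
Qed.

Lemma rate_le_exit x y : x != y -> rate x y <= q x.
Proof.
move=> xy; have [ys|ys] := boolP (y \in succ x); last first.
  by rewrite rate_succ// 1?eq_sym// exit_rateE sumr_ge0.
by rewrite exit_rateE (big_rem _ ys)/= lerDl sumr_ge0.
Qed.

Definition gen (f : state N -> R) x : R := \sum_(y <- succ x) rate x y * (f y - f x).

Variable Lam : R.
Hypothesis Lam_ge : forall x, 2 * q x <= Lam.

Let Lam0 : 0 <= Lam := Lam_ge0 rate_ge0 Lam_ge.

Lemma q_le x : q x <= Lam.
Proof. by apply: le_trans (Lam_ge x); rewrite ler_peMl ?exit_rate_ge0// ler1n. Qed.

Lemma gen_bound f M x : bounded_by M f -> `|gen f x| <= 2 * M * Lam.
Proof.
move=> Mf; apply: le_trans (ler_norm_sum _ _ _) _.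
apply: (@le_trans _ _ (\sum_(y <- succ x) rate x y * (2 * M))).
  apply: ler_sum => y _; rewrite normrM ger0_norm// ler_wpM2l//.
  by apply: le_trans (ler_normB _ _) _; have := Mf y; have := Mf x; lra.
rewrite -mulr_suml -exit_rateE mulrC ler_wpM2l ?q_le// mulr_ge0//.
exact: le_trans (Mf x).
Qed.

Lemma bdd_gen f : bdd f -> bdd (gen f).
Proof. by move=> [M Mf]; exists (2 * M * Lam) => x; exact: gen_bound. Qed.

Lemma in_at0 x z : law X x (in_at 0 [set z]) = (x == z)%:R%:E.
Proof.
have jz y : law X x [set w | jump 0 w = y] = (x == y)%:R%:E.
  have := law_path X x (fun _ => y) 0; rewrite big_ord0 mulr1 eq_sym => <-.
  congr (law X x _); apply/seteqP; split => w /=.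
    by move=> jy k; rewrite leqn0 => /eqP ->.
  by move=> /(_ 0%N); exact.
rewrite -jz; congr (law X x _); rewrite in_at1E; apply/seteqP; split => w /=.
  move=> [n _ [jn Tn tn]].
  have o0 : occupies 0 (jump 0 w) 0 w.
    by split; rewrite // /jump_time ?big_ord0// big_ord1 hold_gt0.
  by have [_ ->] := @occupies_inj _ _ _ _ n 0 z (jump 0 w) 0 w (And3 jn Tn tn) o0.
move=> jz0; exists 0%N => //; split; rewrite // /jump_time ?big_ord0// big_ord1 hold_gt0//.
Qed.

Let euler_le_law x s y : 0 <= s ->
  ((euler_kernel rate Lam s x y)%:E <= law X x (in_at s [set y]))%E.
Proof.
move=> s0; have := @in_at_step _ _ _ X rate_ge0 rate_le_exit Lam Lam_ge x 0 s [:: x] y s0 isT.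
by rewrite big_seq1 in_at0 eqxx mule1 add0r.
Qed.

(** The Euler kernel started at [x] is carried by [x] and [succ x]; summing it over those of them
    that lie in [A] gives a first-order lower bound with a finite sum. *)
Lemma law_in_at_ge x s A : 0 <= s ->
  ((expR (- (Lam * s)) * ((1 + Lam * s) * \1_A x + s * gen \1_A x))%:E <=
   law X x (in_at s A))%E.
Proof.
move=> s0.
pose Z := [seq y <- x :: succ x | y \in A].
have uZ : uniq Z by rewrite filter_uniq//= succ_irr succ_uniq.
apply: (@le_trans _ _ (\sum_(y <- Z) law X x (in_at s [set y]))%E); last first.
  apply: measure_disjoint_sum_le => //.
  - by move=> y; exact: measurable_in_at.
  - exact: measurable_in_at.
  - by move=> y y' w; exact: in_at_inj.
  - move=> y; rewrite mem_filter inE => /andP[yA _] w [n [Tn tn /= jy]].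
    by exists n; split => //; rewrite jy; rewrite inE in yA.
apply: (@le_trans _ _ (\sum_(y <- Z) (euler_kernel rate Lam s x y)%:E)%E); last first.
  by apply: lee_sum => y _; exact: euler_le_law.
rewrite sumEFin lee_fin /Z big_filter big_mkcond big_cons/=.
rewrite (eq_big_seq (fun y => expR (- (Lam * s)) * s * (rate x y * \1_A y))); last first.
  move=> y ys; rewrite indicE /euler_kernel; case: ifPn => _; rewrite ?mulr0//.
  have -> : (x == y) = false.
    by apply: contraTF ys => /eqP <-; exact: succ_irr.
  by rewrite /= mulr1 mulrA.
rewrite -mulr_sumr /gen.
under [X in _ * (_ + _ * X) <= _]eq_bigr do rewrite mulrBr.
rewrite sumrB -mulr_suml -exit_rateE /euler_kernel eqxx.
rewrite [\1_A x]indicE; case: (x \in A) => /=; rewrite ?(mulr1, mulr0, add0r, subr0).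
  by rewrite -mulrA -mulrDr ler_wpM2l ?expR_ge0//; lra.
by rewrite mulrA.
Qed.

Lemma eq_gen f g : f =1 g -> gen f =1 gen g.
Proof. by move=> fg x; apply: eq_bigr => y _; rewrite !fg. Qed.

Lemma gen_sum (I : Type) (r : seq I) (P : pred I) (c : I -> R) (F : I -> state N -> R) x :
  gen (fun x => \sum_(i <- r | P i) c i * F i x) x = \sum_(i <- r | P i) c i * gen (F i) x.
Proof.
rewrite /gen; under [RHS]eq_bigr do rewrite mulr_sumr.
rewrite exchange_big/=; apply: eq_bigr => y _.
by rewrite -sumrB mulr_sumr; apply: eq_bigr => i _; ring.
Qed.

Lemma gen_indicC A x : gen \1_(~` A) x = - gen \1_A x.
Proof.
rewrite /gen -sumrN; apply: eq_bigr => y _.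
by rewrite !indicE !in_setC; case: (y \in A); case: (x \in A) => /=; ring.
Qed.

Section StationaryGen.
Variable pi : probability (state N) R.
Hypothesis st : stationary X pi.

(** Integrating the first-order lower bound against [pi] returns [pi A] on both sides, so a positive
    mean drift [G] would create mass for small [s]. *)
Lemma stationary_gen_indic_le0 A : (\int[pi]_x gen \1_A x)%R <= 0.
Proof.
rewrite leNgt; apply/negP; set G := (\int[pi]_x gen \1_A x)%R => G0.
(* [D] dominates the coefficient of the second-order loss, so [s = G / (2 * D)] keeps that loss at
   [G / 2]; the summand 1 makes [D] positive. *)
pose D := Lam ^+ 2 + Lam * G + 1.
have D0 : 0 < D by rewrite /D; have := Lam0; nra.
pose s := G / (2 * D).
have s0 : 0 < s by rewrite divr_gt0// mulr_gt0.
pose P := fine (pi A).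
have P0 : 0 <= P by exact: fine_ge0.
have P1 : P <= 1 by rewrite -lee_fin EFin_prob probability_le1.
pose l x := fine (law X x (in_at s A)).
have mA : measurable (in_at s A : set (paths X)) by exact: measurable_in_at.
have El x : (l x)%:E = law X x (in_at s A) by rewrite fineK// fin_num_measure.
have bl : bdd l.
  exists 1 => x; rewrite ger0_norm; last exact: fine_ge0.
  by rewrite -lee_fin El probability_le1.
have lP : (\int[pi]_x l x)%R = P.
  by rewrite /Rintegral; under eq_integral do rewrite El; rewrite st// ltW.
have bi := bdd_indic R A; have bg := bdd_gen bi.
have : (\int[pi]_x (expR (- (Lam * s)) * ((1 + Lam * s) * \1_A x + s * gen \1_A x)) <=
        \int[pi]_x l x)%R.
  apply: mean_le => // [|x]; last by rewrite -lee_fin El law_in_at_ge// ltW.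
  by apply: bddZ; apply: bddD; exact: bddZ.
rewrite lP meanZ; last by apply: bddD; exact: bddZ.
rewrite (meanD pi (bddZ (1 + Lam * s) bi) (bddZ s bg)).
rewrite meanZ// meanZ// mean_indic -/P -/G.
have E1 : 1 - Lam * s <= expR (- (Lam * s)) by rewrite expR_ge1Dx.
have B0 : 0 <= (1 + Lam * s) * P + s * G.
  have := Lam0; have := mulr_ge0 Lam0 (ltW s0); have := mulr_ge0 (ltW s0) (ltW G0) => sG Ls _.
  by apply: addr_ge0 => //; apply: mulr_ge0 => //; apply: addr_ge0.
move=> H.
have H1 : (1 - Lam * s) * ((1 + Lam * s) * P + s * G) <= P.
  by apply: le_trans H; rewrite ler_wpM2r.
have H2 : s * (G - s * (Lam * G + Lam ^+ 2 * P)) <= 0.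
  by rewrite -subr_le0 in H1; apply: le_trans H1; rewrite le_eqVlt; apply/orP; left; apply/eqP; ring.
have H3 : G <= s * (Lam * G + Lam ^+ 2 * P).
  by rewrite pmulr_rle0// in H2; rewrite -subr_le0.
have H4 : s * (Lam * G + Lam ^+ 2 * P) <= s * D.
  rewrite ler_wpM2l ?(ltW s0)// /D; have : Lam ^+ 2 * P <= Lam ^+ 2.
    by rewrite ler_piMr// sqr_ge0.
  lra.
have H5 : s * D = G / 2 by rewrite /s; field; rewrite gt_eqF.
lra.
Qed.

Lemma stationary_gen_indic A : (\int[pi]_x gen \1_A x = 0)%R.
Proof.
apply/eqP; rewrite eq_le stationary_gen_indic_le0 /=.
have := stationary_gen_indic_le0 (~` A).
under eq_Rintegral do rewrite gen_indicC.
by rewrite meanN ?oppr_le0//; apply/bdd_gen/bdd_indic.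
Qed.

(** Functions of finite range, written through [phi], are finite combinations of indicators, so no
    limit has to be exchanged with an integral. *)
Lemma stationary_gen (I : finType) (phi : state N -> I) (c : I -> R) :
  (\int[pi]_x gen (fun x => c (phi x)) x = 0)%R.
Proof.
have E : (fun x => c (phi x)) =1 (fun x => \sum_(i : I) c i * \1_(phi @^-1` [set i]) x).
  move=> x; rewrite (bigD1 (phi x))//= big1 ?addr0.
    by rewrite indicE mem_set// mulr1.
  by move=> i ix; rewrite indicE memNset ?mulr0//= => /esym/eqP; rewrite (negbTE ix).
under eq_Rintegral do rewrite (eq_gen E) gen_sum.
rewrite mean_sum; last by move=> i; apply/bddZ/bdd_gen/bdd_indic.
rewrite big1// => i _.
by rewrite meanZ ?stationary_gen_indic ?mulr0//; apply/bdd_gen/bdd_indic.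
Qed.

End StationaryGen.

Lemma prob_singletons (pi : probability (state N) R) A :
  pi A = (\sum_(k <oo) pi (if @pickle_inv (state N) k is Some y then [set y] `&` A else set0))%E.
Proof.
rewrite (@measure_countable_partition _ _ _ pi (state N) (fun y => [set y]) A)//.
- by move=> y y' z /= <- <-.
- by move=> z; exists z.
Qed.

Lemma law_in_at_singletons x t A : law X x (in_at t A) =
  (\sum_(k <oo) law X x (in_at t
     (if @pickle_inv (state N) k is Some y then [set y] `&` A else set0)))%E.
Proof.
pose F k := if @pickle_inv (state N) k is Some y then [set y] `&` A else set0.
rewrite (_ : in_at t A = \bigcup_k in_at t (F k)).
  rewrite measure_semi_bigcup//.
  - by move=> k; exact: measurable_in_at.
  - move=> k l _ _ [w [[n [Tn tn]]]]; rewrite /F.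
    case: (pickle_inv k) (@pickle_invK (state N) k) => //= y <- [jy _].
    move=> [m [Tm tm]].
    case: (pickle_inv l) (@pickle_invK (state N) l) => //= y' <- [jy' _].
    by have [_ ->] := occupies_inj (And3 jy Tn tn) (And3 jy' Tm tm).
  - by apply: bigcupT_measurable => k; exact: measurable_in_at.
apply/seteqP; split => w /=.
  move=> [n [Tn tn An]]; exists (pickle (jump n w)) => //.
  by exists n; rewrite /F pickleK_inv; split.
move=> [k _ [n [Tn tn]]]; rewrite /F; case: pickle_inv => // y [_ An].
by exists n.
Qed.

Section Balance.
Variable pi : probability (state N) R.
Hypothesis bal : forall y, ((q y)%:E * pi [set y] <=
  \esum_(z in [set z | z != y]) ((rate z y)%:E * pi [set z]))%E.

Let F t y := (\int[pi]_x law X x (in_at t [set y]))%E.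

Let F_step t s y (Z : seq (state N)) : uniq Z -> 0 <= s ->
  (\sum_(z <- Z) (euler_kernel rate Lam s z y)%:E * F t z <= F (t + s) y)%E.
Proof.
move=> uZ s0; rewrite /F.
have K0 z := euler_kernel_ge0 rate_ge0 Lam_ge z y s0.
under eq_bigr do rewrite -ge0_integralZl_EFin//.
rewrite -ge0_integral_sum//; last first.
  by move=> z x _; rewrite mule_ge0// lee_fin.
apply: ge0_le_integral => //.
  by move=> x _; apply: sume_ge0 => z _; rewrite mule_ge0// lee_fin.
move=> x _; exact: (in_at_step X rate_ge0 rate_le_exit Lam_ge).
Qed.

(** In the Euler kernel the diagonal term [- q y * s] is compensated by the inflow that [bal]
    guarantees. What remains is a factor [1 - O(s ^+ 2)], so the losses over many short steps are
    negligible. *)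
Let kernel_mass s y : 0 <= s ->
  ((expR (- (Lam * s)) * (1 + Lam * s))%:E * pi [set y] <=
   \esum_(z in setT) ((euler_kernel rate Lam s z y)%:E * pi [set z]))%E.
Proof.
move=> s0; have e0 := expR_ge0 (- (Lam * s)).
have qL : 0 <= Lam - q y by rewrite subr_ge0 q_le.
rewrite (esumID [set y])//; last first.
  by move=> z _; rewrite mule_ge0// lee_fin euler_kernel_ge0.
rewrite !setTI esum_set1; last by rewrite mule_ge0// lee_fin euler_kernel_ge0.
have -> : (\esum_(z in ~` [set y]) ((euler_kernel rate Lam s z y)%:E * pi [set z]) =
    (expR (- (Lam * s)) * s)%:E * \esum_(z in [set z | z != y]) ((rate z y)%:E * pi [set z]))%E.
  rewrite -esumZl ?mulr_ge0//; last by move=> z; rewrite mule_ge0// lee_fin.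
  have -> : ~` [set y] = [set z | z != y].
    by apply/seteqP; split => z /= => [|/eqP//]; move/eqP.
  by apply: eq_esum => z /negbTE zy; rewrite /euler_kernel zy muleA -EFinM mulrA.
apply: (@le_trans _ _ ((euler_kernel rate Lam s y y)%:E * pi [set y] +
    (expR (- (Lam * s)) * s)%:E * ((q y)%:E * pi [set y]))%E).
  rewrite muleA -EFinM -ge0_muleDl ?lee_fin ?euler_kernel_ge0 ?mulr_ge0 ?exit_rate_ge0//.
  rewrite -EFinD lee_wpmul2r// lee_fin /euler_kernel eqxx le_eqVlt; apply/orP; left.
  by apply/eqP; ring.
by apply: leeD2l; apply: lee_wpmul2l => //; rewrite lee_fin mulr_ge0.
Qed.

Let F0 y : F 0 y = pi [set y].
Proof.
transitivity (\int[pi]_x (\1_[set y] x : R)%:E)%E; last by rewrite integral_indic// setIT.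
apply: eq_integral => x _.
have xy : (x \in [set y]) = (x == y) by apply/idP/idP; rewrite inE => /eqP.
by rewrite in_at0 indicE xy.
Qed.

Let F_iter n s y : 0 <= s ->
  (((expR (- (Lam * s)) * (1 + Lam * s)) ^+ n)%:E * pi [set y] <= F (n%:R * s) y)%E.
Proof.
move=> s0; set c := expR _ * _.
have c0 : 0 < c.
  by rewrite mulr_gt0 ?expR_gt0// ltr_pwDl// mulr_ge0.
elim: n y => [|n IH] y; first by rewrite expr0 mul1e mul0r F0.
have -> : n.+1%:R * s = n%:R * s + s by rewrite -natr1; ring.
have cn : 0 < c ^+ n by rewrite exprn_gt0.
apply: (@le_trans _ _ ((c ^+ n)%:E *
    \esum_(z in setT) ((euler_kernel rate Lam s z y)%:E * pi [set z]))%E).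
  by rewrite exprS EFinM -muleA muleCA lee_wpmul2l ?kernel_mass// lee_fin ltW.
rewrite -esumZl ?(ltW cn)//; last first.
  by move=> z; rewrite mule_ge0// lee_fin euler_kernel_ge0.
(* The sum over all states is a supremum over finite sets, and [F_step] applies to each of these. *)
apply: ge_ereal_sup => _ [B [fB _] <-].
rewrite fsbig_finite//=; apply: le_trans (F_step _ _ (finmap.fset_uniq (fset_set B)) s0).
apply: lee_sum => z _; rewrite muleCA lee_wpmul2l ?IH//.
by rewrite lee_fin euler_kernel_ge0.
Qed.

(** Cutting [t] into [n] steps, the accumulated relative loss is at most [(Lam * t) ^+ 2 / n], by
    Bernoulli's inequality. *)
Let F_ge t y : 0 <= t -> (pi [set y] <= F t y)%E.
Proof.
move=> t0; have := @F_iter; have Pi0 : (0 <= pi [set y])%E by [].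
rewrite -(EFin_prob pi); set P := fine (pi [set y]) => Fi.
have P1 : P <= 1 by rewrite -lee_fin EFin_prob probability_le1.
have P0 : 0 <= P by exact: fine_ge0.
apply/lee_addgt0Pr => e e0.
pose a := Lam * t.
have a0 : 0 <= a by exact: mulr_ge0.
(* The first summand makes the loss [a ^+ 2 / n] at most [e]; the second makes [b = a / n] at most
   1. *)
pose n := (Num.truncn (a ^+ 2 / e + a)).+1.
have n0 : 0 < n%:R :> R by rewrite ltr0n.
have nae : a ^+ 2 / e + a < n%:R by exact: truncnS_gt.
have ae0 : 0 <= a ^+ 2 / e by rewrite divr_ge0 ?sqr_ge0// ltW.
have nae1 : a <= n%:R by lra.
have nae2 : a ^+ 2 / n%:R <= e.
  by rewrite ler_pdivrMr// mulrC -ler_pdivrMr//; lra.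
pose b := a / n%:R.
have b1 : b <= 1 by rewrite ler_pdivrMr// mul1r.
have b0 : 0 <= b by rewrite divr_ge0// ltW.
have tn0 : 0 <= t / n%:R by rewrite divr_ge0// ltW.
have := Fi n (t / n%:R) y tn0; rewrite [n%:R * _]mulrC divfK; last by rewrite gt_eqF.
have -> : Lam * (t / n%:R) = b by rewrite mulrA.
move=> Fn.
have e1 : 1 - b ^+ 2 <= expR (- b) * (1 + b).
  apply: (@le_trans _ _ ((1 - b) * (1 + b))); first by rewrite le_eqVlt; apply/orP; left; apply/eqP; ring.
  by rewrite ler_wpM2r ?addr_ge0// expR_ge1Dx.
have b2 : 0 <= b ^+ 2 <= 1 by rewrite sqr_ge0 expr_le1.
have e2 : 1 - e <= (expR (- b) * (1 + b)) ^+ n.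
  apply: (@le_trans _ _ ((1 - b ^+ 2) ^+ n)); last first.
    have b3 : 0 <= 1 - b ^+ 2 by rewrite subr_ge0; case/andP: b2.
    by rewrite lerXn2r ?nnegrE//; apply: le_trans e1.
  apply: le_trans (bernoulli_ineq n b2).
  have -> : n%:R * b ^+ 2 = a ^+ 2 / n%:R by rewrite /b; field; rewrite gt_eqF.
  lra.
apply: (@le_trans _ _ (((expR (- b) * (1 + b)) ^+ n)%:E * (fine (pi [set y]))%:E + e%:E)%E); last first.
  by apply: leeD2r; rewrite EFin_prob in Fn *.
rewrite -EFinM -EFinD lee_fin -/P.
have := ler_wpM2r P0 e2; have : e * P <= e by rewrite ler_piMr// ltW.
lra.
Qed.

Let rho_ge t A : 0 <= t -> (pi A <= \int[pi]_x law X x (in_at t A))%E.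
Proof.
move=> t0; rewrite prob_singletons.
under eq_integral do rewrite law_in_at_singletons.
rewrite integral_nneseries//.
apply: lee_nneseries => // k _.
case: (pickle_inv k) => [y|]; last by rewrite measure0 integral_ge0.
have [yA|yA] := pselect (A y).
  have -> : [set y] `&` A = [set y] by apply/setIidPl => _ ->.
  exact: F_ge.
have -> : [set y] `&` A = set0 by apply/seteqP; split => z //= -[->].
by rewrite measure0 integral_ge0.
Qed.

(** Being in [A] and being in its complement at time [t] are disjoint events of total mass at most
    1. The lower bounds [pi A] and [1 - pi A] leave no slack, so in particular no mass is lost by
    explosion. *)
Lemma balance_stationary : stationary X pi.
Proof.
move=> t A t0 mA; apply/eqP; rewrite eq_le rho_ge// andbT.
have := rho_ge (~` A) t0; rewrite probability_setC//.
set a := (\int[pi]_x law X x (in_at t A))%E.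
set b := (\int[pi]_x law X x (in_at t (~` A)))%E => ba.
have ab : (a + b <= 1)%E.
  rewrite /a /b -ge0_integralD//.
  apply: (@le_trans _ _ (\int[pi]_x cst 1 x)%E); last first.
    by rewrite integral_cst// mul1e; exact: probability_le1.
  apply: ge0_le_integral => // x _; first exact: adde_ge0.
  have mB B : measurable (in_at t B : set (paths X)) by exact: measurable_in_at.
  have dA : in_at t A `&` in_at t (~` A) = set0 :> set (paths X).
    apply/seteqP; split => w //= -[[n [Tn tn An]] [m [Tm tm nA]]].
    by have [nm _] := occupies_inj (And3 erefl Tn tn) (And3 erefl Tm tm); rewrite -nm in nA.
  by have := measureU (law X x) (mB A) (mB (~` A)) dA => /= <-;
    apply: probability_le1; exact: measurableU.
have a0 : (0 <= a)%E by exact: integral_ge0.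
have b0 : (0 <= b)%E by exact: integral_ge0.
move: ba ab a0 b0; rewrite -(EFin_prob pi A) -EFinB.
case: a => [a||]; case: b => [b||]//=.
rewrite -EFinD !lee_fin; lra.
Qed.
End Balance.

Inductive reach x : state N -> Prop :=
| reach_refl : reach x x
| reach_step y z : reach x y -> 0 < rate y z -> reach x z.

Lemma reach_trans x y z : reach x y -> reach y z -> reach x z.
Proof. by move=> xy; elim=> // y' z' _ xy' r; exact: reach_step r. Qed.

Lemma reach_closed A x y : A x -> (forall x' y', A x' -> 0 < rate x' y' -> A y') ->
  reach x y -> A y.
Proof. by move=> Ax cA; elim=> // y' z' _ Ay' r; exact: cA r. Qed.

Let gen_in A x : A x -> gen \1_A x <= 0.
Proof.
move=> Ax; apply: sumr_le0 => y _; apply: mulr_ge0_le0 => //.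
rewrite subr_le0 [leRHS]indicE mem_set// indicE; by case: (_ \in _).
Qed.

Let gen_out A x : ~ A x -> 0 <= gen \1_A x.
Proof.
move=> Ax; apply: sumr_ge0 => y _; apply: mulr_ge0 => //.
rewrite subr_ge0 indicE memNset// indicE; by case: (_ \in _).
Qed.

Let gen_exit A x y : A x -> ~ A y -> 0 < rate x y -> gen \1_A x < 0.
Proof.
move=> Ax Ay r; have yx : y != x by apply/eqP => yx; rewrite yx in Ay.
have ys : y \in succ x by apply: contraLR r => ys; rewrite -leNgt rate_succ.
rewrite /gen (big_rem _ ys)/=.
have -> : (\1_A y : R) = 0 by rewrite indicE memNset.
have Ax1 : (\1_A x : R) = 1 by rewrite indicE mem_set.
rewrite Ax1 sub0r mulrN1; set S := (X in _ + X < 0).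
suff : S <= 0 by lra.
by apply: sumr_le0 => z _; apply: mulr_ge0_le0.
Qed.

(** Let [A] be the set where [pi] exceeds [pi']. Under either law the flow out of [A] equals the
    flow into it. The outflow is larger for [pi] and the inflow larger for [pi'], so all four agree,
    and no state of [A] can have a transition out of [A]. By irreducibility [A] is everything, which
    contradicts equal total masses. *)
Lemma stationary_unique_le (pi pi' : probability (state N) R) :
  (forall x y, reach x y) -> stationary X pi -> stationary X pi' ->
  forall x, (pi [set x] <= pi' [set x])%E.
Proof.
move=> irr st st' x0; rewrite leNgt; apply/negP => x0A.
pose A := [set x | (pi' [set x] < pi [set x])%E].
pose g := gen \1_A.
have bg : bdd g by exact/bdd_gen/bdd_indic.
(* [gin] is the rate of leaving [A] and [gout] that of entering it; the names tell where they are
   supported. *)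
pose gin x := - g x * \1_A x.
pose gout x := g x * \1_(~` A) x.
have bin : bdd gin by apply: bddM; [exact: bddN|exact: bdd_indic].
have bout : bdd gout by apply: bddM => //; exact: bdd_indic.
have gE x : g x = gout x - gin x.
  rewrite /gout /gin !indicE in_setC; case: (x \in A) => /=; ring.
have gin0 x : 0 <= gin x.
  rewrite /gin indicE; case: (boolP (x \in A)) => [|_]; rewrite ?mulr0// inE => Ax.
  by rewrite mulr1 oppr_ge0 gen_in.
have gout0 x : 0 <= gout x.
  rewrite /gout indicE in_setC; case: (boolP (x \in A)) => [_|]; rewrite ?mulr0// => /negP Ax.
  by rewrite mulr1 gen_out// => Ax'; apply: Ax; rewrite inE.
have eqm (P : probability (state N) R) : stationary X P ->
    (\int[P]_x (gin x)%:E = \int[P]_x (gout x)%:E)%E.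
  move=> stP; rewrite -!meanE//; congr EFin; apply/eqP; rewrite eq_sym -subr_eq0.
  rewrite -meanB//; under eq_Rintegral do rewrite -gE.
  by rewrite stationary_gen_indic.
have le1 : (\int[pi']_x (gin x)%:E <= \int[pi]_x (gin x)%:E)%E.
  rewrite !integral_state//; apply: le_esum => y _.
  have [Ay|Ay] := pselect (A y); first by rewrite lee_wpmul2l// ?lee_fin// ltW.
  by rewrite /gin indicE memNset// mulr0 !mul0e.
have le2 : (\int[pi]_x (gout x)%:E <= \int[pi']_x (gout x)%:E)%E.
  rewrite !integral_state//; apply: le_esum => y _.
  have [Ay|Ay] := pselect (A y).
    by rewrite /gout indicE in_setC mem_set// mulr0 !mul0e.
  by rewrite lee_wpmul2l// ?lee_fin// leNgt; apply/negP.
have eq1 : (\int[pi]_x (gin x)%:E = \int[pi']_x (gin x)%:E)%E.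
  by apply/eqP; rewrite eq_le le1 (eqm pi)// (eqm pi')// le2.
(* Equality of the two outflows, together with [pi' < pi] at [x], forces [gin x = 0]. *)
have closedA x y : A x -> 0 < rate x y -> A y.
  move=> Ax r; apply: contrapT => Ay.
  have gx : 0 < gin x by rewrite /gin indicE mem_set// mulr1 oppr_gt0; exact: gen_exit r.
  have fE (P : probability (state N) R) : (\int[P]_x (gin x)%:E = (gin x)%:E * P [set x] +
      \esum_(y in ~` [set x]) ((gin y)%:E * P [set y]))%E.
    have nn y' : (0 <= (gin y')%:E * P [set y'])%E by rewrite mule_ge0// lee_fin.
    by rewrite integral_state// (esumID [set x])// !setTI esum_set1.
  have fin (P : probability (state N) R) : (\int[P]_x (gin x)%:E)%E \is a fin_num.
    by rewrite -meanE.
  move: eq1 (fin pi); rewrite !fE.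
  set e := esum _ _; set e' := esum _ _ => ee fe.
  have e'e : (e' <= e)%E.
    apply: le_esum => y' _; have [Ay'|Ay'] := pselect (A y').
      by rewrite lee_wpmul2l// ?lee_fin// ltW.
    by rewrite /gin indicE memNset// mulr0 !mul0e.
  have e'0 : (0 <= e')%E by apply: esum_ge0 => y' _; rewrite mule_ge0// lee_fin.
  move: ee fe Ax; rewrite /A /= -(EFin_prob pi) -(EFin_prob pi').
  case: e e'e => [e||]; case: e' e'0 => [e'||]//=.
  rewrite !lee_fin => e'0 e'e [] ee _; rewrite lte_fin => lt.
  have := ltr_pM2l gx (fine (pi' [set x])) (fine (pi [set x])).
  by rewrite lt => /esym; lra.
have AT : A = setT.
  by apply/seteqP; split => // y _; apply: reach_closed (irr x0 y).
(* Compared off [x0] only, to keep the strict inequality at [x0] for the contradiction. *)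
have : (pi' (~` [set x0]) <= pi (~` [set x0]))%E.
  rewrite (prob_singletons pi) (prob_singletons pi').
  apply: lee_nneseries => // k _; case: (pickle_inv k) => [y|]; last by rewrite !measure0.
  have [yx|yx] := eqVneq y x0.
    rewrite (_ : _ `&` _ = set0) ?measure0//.
    by apply/seteqP; split => z //= -[->]; rewrite yx.
  have -> : [set y] `&` ~` [set x0] = [set y].
    by apply/setIidPl => _ ->; apply/eqP.
  by apply: ltW; have : A y by rewrite AT.
rewrite !probability_setC//; move: x0A.
by rewrite -(EFin_prob pi) -(EFin_prob pi') -!EFinB !lee_fin lte_fin; lra.
Qed.

Lemma stationary_unique (pi pi' : probability (state N) R) :
  (forall x y, reach x y) -> stationary X pi -> stationary X pi' ->
  forall A, pi A = pi' A.
Proof.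
move=> irr st st' A; rewrite !prob_singletons; apply: eq_eseriesr => k _.
case: (pickle_inv k) => [y|]; last by rewrite !measure0.
have [Ay|Ay] := pselect (A y).
  have -> : [set y] `&` A = [set y] by apply/setIidPl => _ ->.
  by apply/eqP; rewrite eq_le !stationary_unique_le.
have -> : [set y] `&` A = set0 by apply/seteqP; split => z //= -[->].
by rewrite !measure0.
Qed.

End Stationarity.

(** * Foster's criterion *)

Lemma exchange_esum (R : realType) (S T : choiceType) (a : S -> T -> \bar R) :
  (forall i j, 0 <= a i j)%E ->
  (\esum_(i in [set: S]) \esum_(j in [set: T]) a i j =
   \esum_(j in [set: T]) \esum_(i in [set: S]) a i j)%E.
Proof.
have le (U V : choiceType) (b : U -> V -> \bar R) : (forall i j, 0 <= b i j)%E ->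
    (\esum_(i in [set: U]) \esum_(j in [set: V]) b i j <=
     \esum_(j in [set: V]) \esum_(i in [set: U]) b i j)%E.
  move=> b0; apply: ge_ereal_sup => _ [B [fB _] <-].
  rewrite fsbig_finite//= -esum_sum//; apply: le_esum => j _.
  by apply: ereal_sup_ubound; exists B => //; rewrite fsbig_finite.
by move=> a0; apply/eqP; rewrite eq_le !le.
Qed.

Lemma measure_esum_partition d (T : measurableType d) (R : realType)
    (mu : {measure set T -> \bar R}) (I : countType) (B : I -> set T) (E : set T) :
  (forall i, measurable (B i)) -> (forall i j w, B i w -> B j w -> i = j) ->
  (forall w, exists i, B i w) -> measurable E ->
  mu E = (\esum_(i in [set: I]) mu (B i `&` E))%E.
Proof.
move=> mB tB cB mE; rewrite (@measure_countable_partition _ _ _ mu I B)// -nneseries_pickle//.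
by apply: eq_eseriesr => k _; case: (pickle_inv k).
Qed.

Lemma nneseries_le_bound (R : realType) (a : nat -> \bar R) (M : \bar R) :
  (forall k, 0 <= a k)%E -> (forall n, \sum_(0 <= k < n) a k <= M)%E ->
  (\sum_(k <oo) a k <= M)%E.
Proof.
move=> a0 aM; apply: lime_le; first exact: is_cvg_nneseries.
by apply: nearW => n; exact: aM.
Qed.

(** The integral of a nonnegative function is a supremum over the simple functions below it, so
    monotonicity needs no measurability. This is applied to [return_time]. *)
Lemma ge0_le_integral_nonmeas d (T : measurableType d) (R : realType)
    (mu : {measure set T -> \bar R}) (f g : T -> \bar R) :
  (forall x, 0 <= f x)%E -> (forall x, f x <= g x)%E ->
  (\int[mu]_x f x <= \int[mu]_x g x)%E.
Proof.
move=> f0 fg; rewrite !ge0_integralTE//; last by move=> x; exact: le_trans (fg x).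
apply: ge_ereal_sup => _ [h hf <-]; apply: ereal_sup_ubound; exists h => // x.
exact: le_trans (fg x).
Qed.

(** At least [h] natural numbers lie below [h]. Expected holding times are thereby bounded by sums
    of tail probabilities at the integers. *)
Lemma le_count (R : realType) (h : \bar R) : (0 <= h)%E ->
  (h <= \sum_(m <oo) (nat_of_bool (m%:R%:E < h)%E)%:R%:E)%E.
Proof.
have nn (k : nat) : (0 <= (nat_of_bool (k%:R%:E < h)%E)%:R%:E :> \bar R)%E by rewrite lee_fin.
have lb n : (forall m : nat, (m < n)%N -> (m%:R%:E < h)%E) ->
    (n%:R%:E <= \sum_(m <oo) (nat_of_bool (m%:R%:E < h)%E)%:R%:E :> \bar R)%E.
  move=> nh; apply: (@le_trans _ _ (\sum_(0 <= m < n) (nat_of_bool (m%:R%:E < h)%E)%:R%:E)%E); last first.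
    exact: nneseries_lim_ge.
  rewrite (eq_big_nat _ _ (F2 := fun _ => 1%E)); last first.
    by move=> m /andP[_ mn]; rewrite nh.
  by rewrite sumEFin big_const_nat subn0 iter_addr addr0.
case: h nn lb => [h||]//= nn lb; rewrite ?lee_fin => h0.
  have hn : h < (Num.truncn h).+1%:R by exact: truncnS_gt.
  have nh : (Num.truncn h)%:R <= h by rewrite truncn_le.
  have [e|ne] := eqVneq (Num.truncn h)%:R h.
    rewrite -{1}e; apply: lb => m mn.
    by rewrite lte_fin (lt_le_trans _ nh)// ltr_nat.
  apply: le_trans (lb (Num.truncn h).+1 _); first by rewrite lee_fin ltW.
  move=> m; rewrite ltnS => mn; rewrite lte_fin.
  by rewrite (@le_lt_trans _ _ (Num.truncn h)%:R) ?ler_nat// lt_neqAle ne.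
rewrite leye_eq; apply/eqP/eqyP => r r0.
apply: le_trans (lb (Num.truncn r).+1 _) => [|m _]; last exact: ltry.
by rewrite lee_fin; apply/ltW/truncnS_gt.
Qed.

Lemma weights_prob (R : realType) (N : nat) (w : state N -> R) :
  (forall y, 0 <= w y) -> (0 < \esum_(y in [set: state N]) (w y)%:E < +oo)%E ->
  exists (pi : probability (state N) R) (c : R),
    0 < c /\ forall y, pi [set y] = (c * w y)%:E.
Proof.
move=> w0 /andP[W0 Woo].
pose mw k : {measure set (state N) -> \bar R} :=
  if @pickle_inv (state N) k is Some y then mscale (NngNum (w0 y)) (dirac y) else mzero.
pose mu : {measure set (state N) -> \bar R} := mseries mw 0.
have muE A : mu A = (\esum_(z in [set: state N]) ((w z)%:E * \d_z A))%E.
  rewrite /mu /= /mseries -nneseries_pickle; last by move=> z; rewrite mule_ge0// lee_fin.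
  by apply: eq_eseriesr => k _; rewrite /mw; case: (pickle_inv k).
have muT : mu setT = (\esum_(y in [set: state N]) (w y)%:E)%E.
  by rewrite muE; apply: eq_esum => z _; rewrite diracT mule1.
have mu1 y : mu [set y] = (w y)%:E.
  rewrite muE (esumID [set y])//; last by move=> z _; rewrite mule_ge0// lee_fin.
  rewrite !setTI esum_set1; last by rewrite mule_ge0// lee_fin.
  rewrite diracE mem_set// mule1 esum1 ?adde0// => z /= zy.
  by rewrite diracE memNset ?mule0//= => /esym.
exists (mnormalize mu (dirac point)), (fine (mu setT))^-1; split.
  by rewrite invr_gt0 fine_gt0// muT W0 Woo.
move=> y; rewrite /= /mnormalize ifF; last by rewrite muT gt_eqF// lt_eqF.
by rewrite -[X in (X * _)%E]/(mu [set y]) mu1 -EFinM mulrC.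
Qed.

(** * Excursions from a state: return times and invariant weights *)

Section Recurrence.
Context (R : realType) (N : nat) (rate : state N -> state N -> R) (X : ctmc rate).
Local Notation q := (exit_rate rate).
Local Notation p := (jump_prob rate).
Implicit Types (x y z : state N) (A : set (state N)).

Hypothesis rate_ge0 : forall x y, 0 <= rate x y.
Variable succ : state N -> seq (state N).
Hypothesis succ_uniq : forall x, uniq (succ x).
Hypothesis succ_irr : forall x, x \notin succ x.
Hypothesis rate_succ : forall x y, y != x -> y \notin succ x -> rate x y = 0.
Variable qmin : R.
Hypothesis qmin_gt0 : 0 < qmin.
Hypothesis q_ge : forall x, qmin <= q x.

Let q_gt0 x : 0 < q x. Proof. exact: lt_le_trans (q_ge x). Qed.

Lemma jump_probE x y : y != x -> p x y = rate x y / q x.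
Proof. by move=> yx; rewrite /jump_prob gt_eqF// eq_sym (negbTE yx). Qed.

Lemma jump_probxx x : p x x = 0.
Proof. by rewrite /jump_prob gt_eqF// eqxx. Qed.

Lemma jump_prob_succ x y : y \in succ x -> p x y = rate x y / q x.
Proof. by move=> yx; apply: jump_probE; apply: contraTneq yx => ->. Qed.

Lemma sum_jump_prob x : \sum_(y <- succ x) p x y = 1.
Proof.
rewrite (eq_big_seq (fun y => rate x y / q x)); last by move=> y; exact: jump_prob_succ.
by rewrite -mulr_suml -(exit_rateE rate_ge0 succ_uniq succ_irr rate_succ) divff// gt_eqF.
Qed.

Lemma esum_jump_prob x (f : state N -> \bar R) : (forall y, 0 <= f y)%E ->
  (\esum_(y in [set: state N]) ((p x y)%:E * f y) = \sum_(y <- succ x) (p x y)%:E * f y)%E.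
Proof.
move=> f0; rewrite (fsbig_seq _ _ (succ_uniq x)) -esum_fset//; last first.
  by move=> y _; rewrite mule_ge0// lee_fin jump_prob_ge0.
rewrite [in RHS]esum_mkcond; apply: eq_esum => y _.
have -> : (y \in [set` succ x]) = (y \in succ x) by apply/idP/idP; rewrite inE.
have [//|ys] := boolP (y \in succ x).
have [->|yx] := eqVneq y x; first by rewrite jump_probxx mul0e.
by rewrite jump_probE// rate_succ// mul0r mul0e.
Qed.

Variable o : state N.

Definition taboo k : set (paths X) := [set w | forall j, (0 < j <= k)%N -> jump j w != o].

Let measurable_jump1 n y : measurable [set w : paths X | jump n w = y].
Proof. exact: (@measurable_jump_in _ _ _ X n [set y]). Qed.

Lemma measurable_taboo k : measurable (taboo k).
Proof.
have -> : taboo k = \bigcap_(j in [set j | (0 < j <= k)%N]) [set w | jump j w != o] by [].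
apply: bigcap_measurableType => j _.
exact: (@measurable_jump_in _ _ _ X j [set z | z != o]).
Qed.

Definition taboo_at k z : set (paths X) := taboo k `&` [set w | jump k w = z].

Lemma measurable_taboo_at k z : measurable (taboo_at k z).
Proof. by apply: measurableI; [exact: measurable_taboo|exact: measurable_jump1]. Qed.

(** Given the first [k] jumps, [taboo_at k z] is either certain or impossible; with [law_path_ext]
    this yields the Markov property at step [k] on taboo events. *)
Let path_taboo k z (y : nat -> state N) :
  (y k = z /\ forall E : set (paths X),
     path_set y k `&` (taboo_at k z `&` E) = path_set y k `&` E) \/
  (forall E : set (paths X), path_set y k `&` (taboo_at k z `&` E) = set0).
Proof.
have [[yo yz]|H] := pselect ((forall j, (0 < j <= k)%N -> y j != o) /\ y k = z).
  left; split => // E; apply/seteqP; split => w /=; first by case=> ? [].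
  move=> [yw Ew]; split => //; split => //; split => /=; last by rewrite yw.
  by move=> j /andP[j0 jk]; rewrite yw// yo// j0.
right => E; apply/seteqP; split => w //= -[yw [[tw wz] _]]; apply: H; split.
  by move=> j /andP[j0 jk]; rewrite -yw// tw// j0.
by rewrite -yw.
Qed.

Lemma law_taboo_next x k z (y : state N) :
  law X x (taboo_at k z `&` [set w | jump k.+1 w = y]) =
  ((p z y)%:E * law X x (taboo_at k z))%E.
Proof.
apply: (@law_path_ext _ _ _ X x k).
- exact: jump_prob_ge0.
- by apply: measurableI; [exact: measurable_taboo_at|exact: measurable_jump1].
- exact: measurable_taboo_at.
move=> u; case: (path_taboo k z u) => [[uz H]|H]; last first.
  by rewrite H -[taboo_at k z]setIT H !measure0 mule0.
rewrite H -[taboo_at k z]setIT H setIT.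
pose u' j := if j == k.+1 then y else u j.
have u'E j : (j <= k)%N -> u' j = u j by move=> jk; rewrite /u' ltn_eqF.
have -> : path_set u k `&` [set w | jump k.+1 w = y] = path_set u' k.+1 :> set (paths X).
  apply/seteqP; split => w /=.
    move=> [uw wy] j; rewrite leq_eqVlt => /predU1P[->|jk]; first by rewrite /u' eqxx.
    by rewrite u'E// uw.
  move=> uw; split; first by move=> j jk; rewrite uw ?u'E// leqW.
  by rewrite uw// /u' eqxx.
rewrite !law_path big_ord_recr/= u'E// -EFinM; congr EFin.
have -> : \prod_(i < k) p (u' i) (u' i.+1) = \prod_(i < k) p (u i) (u i.+1).
  by apply: eq_bigr => i _; rewrite !u'E// ltnW.
by rewrite u'E// uz /u' eqxx; ring.
Qed.

Lemma law_taboo_hold x k z (h : R) : 0 <= h ->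
  law X x (taboo_at k z `&` [set w | (h%:E < hold k w)%E]) =
  ((expR (- (q z * h)))%:E * law X x (taboo_at k z))%E.
Proof.
move=> h0; apply: (@law_path_ext _ _ _ X x k).
- exact: expR_ge0.
- by apply: measurableI; [exact: measurable_taboo_at|exact: measurable_hold_gt].
- exact: measurable_taboo_at.
move=> u; case: (path_taboo k z u) => [[uz H]|H]; last first.
  by rewrite H -[taboo_at k z]setIT H !measure0 mule0.
rewrite H -[taboo_at k z]setIT H setIT.
pose hh j : R := if j == k then h else 0.
have hh0 j : 0 <= hh j by rewrite /hh; case: ifP.
have := @jump_holdE _ _ _ _ X x k u hh hh0.
have hk : hh k = h by rewrite /hh eqxx.
rewrite [X in _ * X]big_ord_recr/= hk uz [X in _ * (X * _)]big1 ?mul1r; last first.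
  by move=> i _; rewrite /hh ltn_eqF// mulr0 oppr0 expR0.
move=> Hh; rewrite law_path -EFinM [expR _ * _]mulrC -Hh; congr (law X x _).
apply/seteqP; split => w /=.
  move=> [uw hw] j jk; split; first exact: uw.
  by rewrite /hh; case: eqP => [->//|_]; exact: hold_gt0.
move=> uw; split; first by move=> j jk; have [] := uw j jk.
by have [_] := uw k (leqnn k); rewrite /hh eqxx.
Qed.

Let jump_part k (E : set (paths X)) x : measurable E ->
  law X x E = (\esum_(z in [set: state N]) law X x ([set w | jump k w = z] `&` E))%E.
Proof.
move=> mE; apply: measure_esum_partition => //.
- by move=> z z' w /= <- <-.
- by move=> w; exists (jump k w).
Qed.

Lemma law_taboo k x : law X x (taboo k) =
  (\esum_(z in [set: state N]) law X x (taboo_at k z))%E.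
Proof.
rewrite (jump_part k)//; last exact: measurable_taboo.
by apply: eq_esum => z _; rewrite setIC.
Qed.

Lemma law_taboo_jump k x y : law X x (taboo k `&` [set w | jump k.+1 w = y]) =
  (\esum_(z in [set: state N]) ((p z y)%:E * law X x (taboo_at k z)))%E.
Proof.
rewrite (jump_part k); last by apply: measurableI; [exact: measurable_taboo|].
by apply: eq_esum => z _; rewrite -law_taboo_next setIA [_ `&` taboo k]setIC.
Qed.

Lemma law_tabooS k x y : law X x (taboo_at k.+1 y) =
  (if y == o then 0 else \esum_(z in [set: state N]) ((p z y)%:E * law X x (taboo_at k z)))%E.
Proof.
have [->|yo] := eqVneq y o.
  rewrite (_ : taboo_at _ _ = set0) ?measure0//.
  by apply/seteqP; split => w //= -[/(_ k.+1) + wo]; rewrite /= leqnn wo eqxx => /(_ isT).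
rewrite -law_taboo_jump; congr (law X x _); apply/seteqP; split => w /=.
  by move=> [tw wy]; split => // j /andP[j0 jk]; rewrite tw// j0 leqW.
move=> [tw wy]; split => // j /andP[j0]; rewrite leq_eqVlt => /predU1P[->|jk].
  by rewrite wy.
by rewrite tw// j0.
Qed.

Lemma law_taboo0 x z : law X x (taboo_at 0 z) = (x == z)%:R%:E.
Proof.
have := law_path X x (fun _ => z) 0; rewrite big_ord0 mulr1 eq_sym => <-.
congr (law X x _); apply/seteqP; split => w /=.
  by move=> [_ wz] k; rewrite leqn0 => /eqP ->.
move=> uw; split; last by exact: uw.
by move=> j /andP[j0]; rewrite leqNgt j0.
Qed.

Section Lyapunov.
Variables (W : state N -> R) (e : R).
Hypothesis W_ge0 : forall z, 0 <= W z.
Hypothesis e_gt0 : 0 < e.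
Hypothesis W_drift : forall z, \sum_(y <- succ z | y != o) p z y * W y <= W z - e.

(** The mean of [W] after [k] jumps, restricted to paths that have not yet returned to [o]; it
    decreases at each jump by at least [e] times the surviving mass. *)
Let M k x : \bar R := (\esum_(z in [set: state N]) ((W z)%:E * law X x (taboo_at k z)))%E.

Let M_step k x : (M k.+1 x + e%:E * law X x (taboo k) <= M k x)%E.
Proof.
have P0 z y : (0 <= (p z y)%:E :> \bar R)%E by rewrite lee_fin jump_prob_ge0.
pose W' y := if y == o then 0 else W y.
have W'0 y : 0 <= W' y by rewrite /W'; case: ifP.
have -> : M k.+1 x = (\esum_(z in [set: state N]) ((\sum_(y <- succ z | y != o) p z y * W y)%:E *
    law X x (taboo_at k z)))%E.
  rewrite /M; under eq_esum => y _ do rewrite law_tabooS.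
  transitivity (\esum_(y in [set: state N]) \esum_(z in [set: state N])
     ((W' y)%:E * ((p z y)%:E * law X x (taboo_at k z))))%E.
    apply: eq_esum => y _; rewrite /W'; case: ifP => _.
      by rewrite mule0 esum1// => z _; rewrite mul0e.
    by rewrite esumZl// => z; exact: mule_ge0.
  rewrite exchange_esum; last by move=> y z; rewrite !mule_ge0// lee_fin.
  apply: eq_esum => z _.
  transitivity (\esum_(y in [set: state N]) ((p z y)%:E * ((W' y)%:E * law X x (taboo_at k z))))%E.
    by apply: eq_esum => y _; rewrite muleCA.
  rewrite esum_jump_prob; last by move=> y; rewrite mule_ge0// lee_fin.
  under eq_bigr do rewrite muleA -EFinM.
  rewrite -ge0_sume_distrl; last by move=> y _; rewrite lee_fin mulr_ge0// jump_prob_ge0.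
  rewrite sumEFin [in RHS]big_mkcond; congr (_%:E * _)%E; apply: eq_bigr => y _.
  by rewrite /W'; case: eqP; rewrite ?mulr0.
rewrite law_taboo -esumZl//; last by rewrite ltW.
have S0 z : 0 <= \sum_(y <- succ z | y != o) p z y * W y.
  by apply: sumr_ge0 => y _; rewrite mulr_ge0// jump_prob_ge0.
rewrite -esumD.
- apply: le_esum => z _; rewrite -ge0_muleDl ?lee_fin ?(ltW e_gt0)//.
  by rewrite lee_wpmul2r// -EFinD lee_fin; have := W_drift z; lra.
- by move=> z _; rewrite mule_ge0// lee_fin.
- by move=> z _; rewrite mule_ge0// lee_fin ltW.
Qed.

(** The decrements of [M] telescope, starting from [W x]; the series is the mean number of jumps
    until [o] is hit. *)
Lemma taboo_summable x : (\sum_(k <oo) law X x (taboo k) <= (W x / e)%:E)%E.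
Proof.
have M0 k : (0 <= M k x)%E by apply: esum_ge0 => z _; rewrite mule_ge0// lee_fin.
have Mx : M 0 x = (W x)%:E.
  rewrite /M (esumID [set x])//; last by move=> z _; rewrite mule_ge0// lee_fin.
  rewrite !setTI esum_set1; last by rewrite mule_ge0// lee_fin.
  rewrite law_taboo0 eqxx mule1 esum1 ?adde0// => z /= zx.
  by rewrite law_taboo0; case: eqP => [xz|_]; rewrite ?mule0//; case: zx.
apply: nneseries_le_bound => // n.
have : (M n x + e%:E * \sum_(0 <= k < n) law X x (taboo k) <= (W x)%:E)%E.
  elim: n => [|n IH]; first by rewrite big_geq// mule0 adde0 Mx.
  rewrite big_nat_recr//= ge0_muleDr//; last by rewrite sume_ge0.
  rewrite addeCA; apply: le_trans IH; rewrite [leRHS]addeC.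
  by apply: leeD2l; exact: M_step.
move=> H; have {}H : (e%:E * \sum_(0 <= k < n) law X x (taboo k) <= (W x)%:E)%E.
  by apply: le_trans H; rewrite leeDr.
have := lee_wpmul2l (x := (e^-1)%:E) _ H; rewrite muleA -!EFinM mulVf ?gt_eqF// mul1e mulrC.
by apply; rewrite lee_fin invr_ge0 ltW.
Qed.

End Lyapunov.

Section Return.
Hypothesis summ : (\sum_(k <oo) law X o (taboo k) < +oo)%E.

(** The number of integers below the [k]-th holding time, on the event that [o] has not been
    revisited: a measurable majorant of the time spent there. *)
Let cnt k w : \bar R := (\sum_(m <oo)
   (\1_(taboo k `&` [set w | (m%:R%:E < hold k w)%E]) w : R)%:E)%E.

Let cnt_ge0 k w : (0 <= cnt k w)%E.
Proof. by apply: nneseries_ge0 => m _ _; rewrite lee_fin. Qed.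

Let cnt_taboo k w : taboo k w -> (hold k w <= cnt k w)%E.
Proof.
move=> tw; apply: le_trans (le_count _) _; first exact/ltW/hold_gt0.
apply: lee_nneseries => [m _ _|m _]; first by rewrite lee_fin.
rewrite lee_fin indicE; case: (boolP (_ < _)%E) => // h.
by rewrite mem_set.
Qed.

Let cnt_taboo1 k w : taboo k w -> (1 <= cnt k w)%E.
Proof.
move=> tw; apply: le_trans (nneseries_lim_ge 1 _); last first.
  by move=> m _ _; rewrite lee_fin.
by rewrite big_nat1 indicE mem_set//; split => //=; exact: hold_gt0.
Qed.

Lemma return_time_le w : (return_time o w <= \sum_(k <oo) cnt k w)%E.
Proof.
(* If [o] is never revisited, every term is at least 1 and the series diverges. Otherwise the first
   return is a jump [n], and [jump_time n] bounds the return time, even when it is infinite. *)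
have [H|H] := pselect (exists n, ~ taboo n w); last first.
  have tw k : taboo k w by apply: contrapT => nt; apply: H; exists k.
  suff -> : (\sum_(k <oo) cnt k w = +oo)%E by rewrite leey.
  apply/eqyP => r r0.
  have rn : r < (Num.truncn r).+1%:R by exact: truncnS_gt.
  apply: le_trans (nneseries_lim_ge (Num.truncn r).+1 _) => //.
  apply: (@le_trans _ _ (\sum_(0 <= k < (Num.truncn r).+1) 1)%E).
    by rewrite sumEFin big_const_nat subn0 iter_addr addr0 lee_fin ltW.
  by apply: lee_sum => k _; exact: cnt_taboo1.
pose P n := `[< ~ taboo n w >].
have exP : exists n, P n by have [n nt] := H; exists n; apply/asboolP.
pose n := ex_minn exP.
have nP : ~ taboo n w by rewrite /n; case: ex_minnP => m /asboolP.
have nmin k : (k < n)%N -> taboo k w.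
  rewrite /n; case: ex_minnP => m _ mmin km; apply: contrapT => nt.
  have Pk : P k by apply/asboolP.
  by have := mmin k Pk; rewrite leqNgt km.
have n0 : (0 < n)%N by rewrite lt0n; apply/eqP => n0; apply: nP; rewrite n0 => -[|j].
have jn : jump n w = o.
  apply: contrapT => jno; apply: nP => j /andP[j0]; rewrite leq_eqVlt => /predU1P[->|jn].
    exact/eqP.
  by apply: (nmin j jn); rewrite j0 leqnn.
apply: (@le_trans _ _ (jump_time n w)); last first.
  apply: le_trans (nneseries_lim_ge n _) => //.
  rewrite /jump_time -(big_mkord xpredT (fun k => hold k w)).
  rewrite big_nat [leRHS]big_nat; apply: lee_sum => k /andP[_ kn].
  exact/cnt_taboo/nmin.
have [fT|] := boolP (jump_time n w \is a fin_num); last first.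
  by rewrite ge0_fin_numE ?jump_time_ge0// -leNgt leye_eq => /eqP ->; exact: leey.
rewrite -(fineK fT); apply: ereal_inf_lbound; exists (fine (jump_time n w)) => //=.
split; first by rewrite fineK//; exact: jump_time_le.
exists n; rewrite fineK//; split => //.
by rewrite jump_timeS -[ltLHS]adde0 lteD2lE//; exact: hold_gt0.
Qed.

Lemma return_time_ge0 (w : paths X) : (0 <= return_time o w)%E.
Proof.
apply: le_ereal_inf_tmp => _ [t [Tt _] <-].
exact: le_trans (jump_time_ge0 1 w) Tt.
Qed.

(** Each state visited before the return is held with an exponential tail of rate at least [qmin],
    hence costs on average at most the geometric sum [(1 - expR (- qmin))^-1]. *)
Lemma return_time_integrable : (\int[law X o]_w return_time o w < +oo)%E.
Proof.
have mE k m : measurable (taboo k `&` [set w | (m%:R%:E < hold k w)%E] : set (paths X)).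
  by apply: measurableI; [exact: measurable_taboo|exact: measurable_hold_gt].
have mc k : measurable_fun setT (cnt k).
  by apply: ge0_emeasurable_sum => [m x _ _|m _]; [rewrite lee_fin|exact/measurable_EFinP/measurable_indic].
apply: le_lt_trans (ge0_le_integral_nonmeas (law X o) return_time_ge0 return_time_le) _.
rewrite integral_nneseries//.
pose a := expR (- qmin).
have a0 : 0 <= a by exact: expR_ge0.
have a1 : a < 1 by rewrite expR_lt1 oppr_lt0.
have law_le k m : (law X o (taboo k `&` [set w | (m%:R%:E < hold k w)%E]) <=
    (a ^+ m)%:E * law X o (taboo k))%E.
  rewrite law_taboo -esumZl ?exprn_ge0//.
  have -> : law X o (taboo k `&` [set w | (m%:R%:E < hold k w)%E]) =
      (\esum_(z in [set: state N]) law X o (taboo_at k z `&` [set w | (m%:R%:E < hold k w)%E]))%E.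
    rewrite (jump_part k)//; apply: eq_esum => z _; congr (law X o _).
    by rewrite setIA [_ `&` taboo k]setIC.
  apply: le_esum => z _; rewrite law_taboo_hold ?ler0n// lee_wpmul2r// lee_fin.
  by rewrite /a -expRM_natr ler_expR mulNr lerN2 ler_wpM2r.
have cle k : (\int[law X o]_w cnt k w <= ((1 - a)^-1)%:E * law X o (taboo k))%E.
  rewrite integral_nneseries//; last by move=> m; exact/measurable_EFinP/measurable_indic.
  apply: nneseries_le_bound => [m|n]; first by apply: integral_ge0 => w _; rewrite lee_fin.
  apply: (@le_trans _ _ (\sum_(0 <= m < n) (a ^+ m)%:E * law X o (taboo k))%E).
    by apply: lee_sum => m _; rewrite integral_indic// setIT law_le.
  rewrite -ge0_sume_distrl; last by move=> m _; rewrite lee_fin exprn_ge0.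
  rewrite lee_wpmul2r// sumEFin lee_fin big_mkord.
  have a1' : 0 < 1 - a by rewrite subr_gt0.
  rewrite -[leRHS]mul1r ler_pdivlMr// mulrC -opprB mulNr -subrX1 opprB gerBl exprn_ge0//.
apply: (@le_lt_trans _ _ (\sum_(k <oo) ((1 - a)^-1)%:E * law X o (taboo k))%E).
  by apply: lee_nneseries => [k _ _|k _]; [exact: integral_ge0|exact: cle].
rewrite nneseriesZl//.
have : (0 <= \sum_(k <oo) law X o (taboo k))%E by exact: nneseries_ge0.
by move: summ; case: (\sum_(k <oo) _)%E => [r||]//= _ _; rewrite -EFinM ltry.
Qed.

Section Existence.
Variable Lam : R.
Hypothesis Lam_ge : forall x, 2 * q x <= Lam.

(** The mean number of visits to [y] during one excursion from [o], counting the start but not the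
    return. *)
Let nu y : \bar R := (\sum_(k <oo) law X o (taboo_at k y))%E.

Let nu_ge0 y : (0 <= nu y)%E. Proof. exact: nneseries_ge0. Qed.

Let nu_total : (\esum_(y in [set: state N]) nu y = \sum_(k <oo) law X o (taboo k))%E.
Proof.
under eq_esum do rewrite /nu nneseries_esumT//.
rewrite exchange_esum// nneseries_esumT//; apply: eq_esum => k _.
by rewrite law_taboo.
Qed.

Let nu_fin y : nu y \is a fin_num.
Proof.
rewrite ge0_fin_numE//; apply: le_lt_trans summ; rewrite -nu_total.
rewrite (esumID [set y])// !setTI esum_set1// leeDl//; exact: esum_ge0.
Qed.

Let nuP y : (\esum_(z in [set: state N]) ((p z y)%:E * nu z) =
  \sum_(k <oo) law X o (taboo k `&` [set w | jump k.+1 w = y]))%E.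
Proof.
transitivity (\esum_(z in [set: state N]) \esum_(k in [set: nat])
    ((p z y)%:E * law X o (taboo_at k z)))%E.
  apply: eq_esum => z _; rewrite /nu -nneseriesZl// nneseries_esumT// => k.
  by rewrite mule_ge0// lee_fin jump_prob_ge0.
rewrite exchange_esum; last by move=> z k; rewrite mule_ge0// lee_fin jump_prob_ge0.
rewrite nneseries_esumT//; apply: eq_esum => k _.
by rewrite law_taboo_jump.
Qed.

(** Away from [o] this is a shift of the jump index. At [o], where [nu o = 1], it says that the
    chain returns with probability one. *)
Let nu_invariant y : (nu y <= \esum_(z in [set: state N]) ((p z y)%:E * nu z))%E.
Proof.
rewrite nuP; have [yo|yo] := eqVneq y o; last first.
  rewrite /nu nneseries_recl// law_taboo0 eq_sym (negbTE yo) add0e -nneseries_addn//.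
  apply: lee_nneseries => // k _.
  by rewrite addn1 law_tabooS (negbTE yo) law_taboo_jump.
have -> : nu y = 1%E.
  rewrite /nu nneseries_recl// law_taboo0 yo eqxx -nneseries_addn// eseries0 ?adde0//.
  by move=> k _ _; rewrite addn1 law_tabooS eqxx.
(* [D k] is the probability that the first return is jump [k.+1]. If these summed to some [r < 1],
   each [taboo n] would have probability at least [1 - r], against [summ]. *)
rewrite yo; pose D k := law X o (taboo k `&` [set w | jump k.+1 w = o]).
have mD k : measurable (taboo k `&` [set w | jump k.+1 w = o] : set (paths X)).
  by apply: measurableI => //; exact: measurable_taboo.
have Dk k : (law X o (taboo k) = law X o (taboo k.+1) + D k)%E.
  rewrite /D -measureU//; last 2 first.
  - exact: measurable_taboo.
  - apply/seteqP; split => w //= -[/(_ k.+1) + [_ wo]].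
    by rewrite leqnn wo eqxx => /(_ isT).
  congr (law X o _); apply/seteqP; split => w /=.
    move=> tw; have [wo|wo] := eqVneq (jump k.+1 w) o; first by right.
    left=> j /andP[j0]; rewrite leq_eqVlt => /predU1P[->//|jk].
    by rewrite tw// j0.
  by case=> [tw|[]//] j /andP[j0 jk]; rewrite tw// j0 leqW.
rewrite leNgt; apply/negP => lt1.
have D0 : (0 <= \sum_(k <oo) D k)%E by exact: nneseries_ge0.
have tn n : (law X o (taboo n) + \sum_(0 <= k < n) D k = 1)%E.
  elim: n => [|n IH].
    rewrite big_geq// adde0 law_taboo (esumID [set o])// !setTI esum_set1//.
    rewrite law_taboo0 eqxx esum1 ?adde0// => z /= zo.
    by rewrite law_taboo0; case: eqP => // zo'; case: zo.
  by rewrite big_nat_recr//= -IH (Dk n) -addeA [(D n + _)%E]addeC.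
move: lt1 D0; rewrite -/(D _); case E: (\sum_(k <oo) D k)%E => [r||]//; rewrite lte_fin lee_fin => r1 r0.
have tn_ge n : ((1 - r)%:E <= law X o (taboo n))%E.
  have : (\sum_(0 <= k < n) D k <= r%:E)%E by rewrite -E; exact: nneseries_lim_ge.
  move: (tn n); have: (0 <= \sum_(0 <= k < n) D k)%E by exact: sume_ge0.
  case: (law X o (taboo n)) => [a||]//; case: (\sum_(0 <= k < n) D k)%E => [b||]//.
  by rewrite -EFinD !lee_fin => b0 [ab] br; lra.
have : (\sum_(k <oo) law X o (taboo k) = +oo)%E.
  apply/eqyP => s s0.
  pose n := (Num.truncn (s / (1 - r))).+1.
  have sn : s / (1 - r) < n%:R by exact: truncnS_gt.
  apply: le_trans (nneseries_lim_ge n _) => //.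
  apply: (@le_trans _ _ (\sum_(0 <= k < n) (1 - r)%:E)%E).
    rewrite sumEFin big_const_nat subn0 iter_addr addr0 lee_fin -mulr_natl.
    by rewrite -ler_pdivrMr ?subr_gt0// ltW.
  by apply: lee_sum => k _.
by move=> sum_oo; have := summ; rewrite sum_oo ltxx.
Qed.

Lemma exists_stationary : exists pi : probability (state N) R, stationary X pi.
Proof.
(* Dividing by the mean rate of leaving turns invariance for the jump chain into balance in
   continuous time; [qmin] keeps the total weight finite. *)
pose w y := fine (nu y) / q y.
have w0 y : 0 <= w y by rewrite divr_ge0 ?exit_rate_ge0//; apply/fine_ge0/nu_ge0.
have qw y : ((q y)%:E * (w y)%:E = nu y)%E.
  by rewrite -EFinM /w mulrC divfK ?gt_eqF// fineK.
have W0 : (0 < \esum_(y in [set: state N]) (w y)%:E)%E.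
  rewrite (esumID [set o])//; last by move=> y _; rewrite lee_fin.
  rewrite !setTI esum_set1 ?lee_fin//.
  apply: (@lt_le_trans _ _ (w o)%:E); last first.
    by rewrite leeDl//; apply: esum_ge0 => y _; rewrite lee_fin.
  rewrite lte_fin divr_gt0// fine_gt0//; apply/andP; split; last first.
    by rewrite -ge0_fin_numE.
  rewrite /nu nneseries_recl// law_taboo0 eqxx.
  by rewrite (@lt_le_trans _ _ 1%E)// leeDl// -nneseries_addn// nneseries_ge0.
have Woo : (\esum_(y in [set: state N]) (w y)%:E < +oo)%E.
  apply: (@le_lt_trans _ _ ((qmin^-1)%:E * \esum_(y in [set: state N]) nu y)%E).
    rewrite -esumZl ?invr_ge0 ?(ltW qmin_gt0)//; apply: le_esum => y _.
    rewrite -(fineK (nu_fin y)) -EFinM lee_fin /w mulrC ler_wpM2r ?fine_ge0//.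
    by rewrite lef_pV2 ?posrE.
  rewrite nu_total; have : (0 <= \sum_(k <oo) law X o (taboo k))%E by exact: nneseries_ge0.
  by move: summ; case: (\sum_(k <oo) _)%E => [r||]//= _ _; rewrite -EFinM ltry.
have [pi [c [c0 piE]]] := weights_prob w0 (introT andP (conj W0 Woo)).
exists pi.
apply: (balance_stationary X rate_ge0 succ_uniq succ_irr rate_succ Lam_ge) => y.
rewrite piE EFinM muleCA qw.
have -> : (\esum_(z in [set z | z != y]) ((rate z y)%:E * pi [set z]) =
    c%:E * \esum_(z in [set: state N]) ((p z y)%:E * nu z))%E.
  rewrite -esumZl ?(ltW c0)//; last by move=> z; rewrite mule_ge0// lee_fin jump_prob_ge0.
  rewrite esum_mkcond; apply: eq_esum => z _.
  have -> : (z \in [set z | z != y]) = (z != y) by apply/idP/idP; rewrite inE.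
  have [->|zy] := eqVneq z y; first by rewrite jump_probxx mul0e mule0.
  rewrite piE jump_probE 1?eq_sym// -qw -!EFinM; congr EFin.
  by field; rewrite gt_eqF.
by rewrite lee_wpmul2l ?nu_invariant// lee_fin ltW.
Qed.

End Existence.
End Return.
End Recurrence.

(** * From a Lyapunov function to positive recurrence and a stationary law *)

Section Foster.
Context (R : realType) (N : nat) (rate : state N -> state N -> R) (X : ctmc rate).
Local Notation q := (exit_rate rate).
Local Notation p := (jump_prob rate).
Implicit Types (x y z : state N).

Hypothesis rate_ge0 : forall x y, 0 <= rate x y.
Variable succ : state N -> seq (state N).
Hypothesis succ_uniq : forall x, uniq (succ x).
Hypothesis succ_irr : forall x, x \notin succ x.
Hypothesis rate_succ : forall x y, y != x -> y \notin succ x -> rate x y = 0.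
Variable qmin : R.
Hypothesis qmin_gt0 : 0 < qmin.
Hypothesis q_ge : forall x, qmin <= q x.
Variable Lam : R.
Hypothesis Lam_ge : forall x, 2 * q x <= Lam.
Hypothesis irr : forall x y, reach rate x y.

Let q_gt0 x : 0 < q x. Proof. exact: lt_le_trans (q_ge x). Qed.
Let p_ge0 x y : 0 <= p x y. Proof. exact: jump_prob_ge0. Qed.
Let sum_p x : \sum_(y <- succ x) p x y = 1.
Proof. exact: (sum_jump_prob rate_ge0 succ_uniq succ_irr rate_succ qmin_gt0 q_ge). Qed.

Section Survival.
Variable o : state N.

(** The probability that none of the first [k] jumps from [z] leads to [o]. *)
Fixpoint survival k z : R :=
  if k is k'.+1 then \sum_(y <- succ z | y != o) p z y * survival k' y else 1.

Lemma survival_ge0 k z : 0 <= survival k z.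
Proof.
elim: k z => [|k IH] z; first exact: ler01.
by apply: sumr_ge0 => y _; exact: (mulr_ge0 (p_ge0 _ _) (IH _)).
Qed.

Lemma survival_decr k z : survival k.+1 z <= survival k z.
Proof.
elim: k z => [|k IH] z.
  rewrite /= -[leRHS](sum_p z) big_mkcond; apply: ler_sum => y _.
  by case: ifP => _; rewrite ?mulr1 ?p_ge0.
by apply: ler_sum => y _; rewrite ler_wpM2l ?p_ge0 ?IH.
Qed.

Lemma survival_le k m z : (k <= m)%N -> survival m z <= survival k z.
Proof.
move=> /subnK <-; elim: (m - k)%N => // n IH.
exact: le_trans (survival_decr _ _) IH.
Qed.

Let exits z := exists k, survival k z < 1.

Let exits_step y z : z != y -> 0 < rate y z -> z = o \/ exits z -> exits y.
Proof.
move=> zy r Hz; have pz : 0 < p y z.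
  by rewrite (jump_probE qmin_gt0 q_ge zy) divr_gt0.
have zs : z \in succ y by apply: contraLR r => zs; rewrite -leNgt rate_succ.
have s1 k y' : survival k y' <= 1 by have := survival_le y' (leq0n k).
have le_rem (g : state N -> R) : (forall y', 0 <= g y' <= 1) -> g z < 1 ->
    \sum_(y' <- succ y) p y y' * g y' < 1.
  move=> g01 gz; rewrite -[ltRHS](sum_p y) (big_rem _ zs) [ltRHS](big_rem _ zs)/=.
  apply: ltr_leD; first by rewrite gtr_pMr.
  by apply: ler_sum => y' _; have /andP[_ g1] := g01 y'; exact: (ler_piMr (p_ge0 _ _) g1).
case: Hz => [zo|[k Sk]].
  have ind01 y' : 0 <= ((y' != o)%:R : R) <= 1 by case: (y' != o); rewrite ?ler01 lexx.
  have ind_lt : ((z != o)%:R : R) < 1 by rewrite zo eqxx ltr01.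
  exists 1%N; rewrite /= big_mkcond; apply: le_lt_trans (le_rem _ ind01 ind_lt).
  by apply: ler_sum => y' _; case: (y' != o); rewrite ?mulr1 ?mulr0 lexx.
exists k.+1; rewrite /= big_mkcond.
apply: le_lt_trans (le_rem (survival k) _ Sk); last by move=> y'; rewrite survival_ge0 s1.
by apply: ler_sum => y' _; case: ifP => _; rewrite ?lexx// mulr_ge0 ?survival_ge0 ?p_ge0.
Qed.

Let exits_reach x y : reach rate x y -> y = o \/ exits y -> x = o \/ exits x.
Proof.
elim=> // y' z _ IH r Hz; apply: IH.
have [<-|zy] := eqVneq z y'; first exact: Hz.
by right; exact: exits_step zy r Hz.
Qed.

Lemma survival_lt1 x : exists k, survival k x < 1.
Proof.
have alt y : y = o \/ exits y by apply: exits_reach (irr y o) _; left.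
have [y ys r] : exists2 y, y \in succ x & 0 < rate x y.
  apply: contrapT => H; have := q_gt0 x.
  rewrite (exit_rateE rate_ge0 succ_uniq succ_irr rate_succ) big_seq big1 ?ltxx// => y ys.
  by apply/eqP; rewrite eq_le rate_ge0 andbT leNgt; apply/negP => r; apply: H; exists y.
apply: exits_step r (alt y); apply: contraTneq ys => ->; exact: succ_irr.
Qed.

Lemma survival_uniform (F : seq (state N)) :
  exists (m : nat) (d : R), 0 < d /\ forall x, x \in F -> survival m x <= 1 - d.
Proof.
elim: F => [|x F [m [d [d0 H]]]]; first by exists 0%N, 1.
have [k kx] := survival_lt1 x.
exists (maxn m k), (Num.min d (1 - survival k x)); split.
  by rewrite lt_min d0 subr_gt0.
move=> y; rewrite inE => /predU1P[->|yF].
  apply: le_trans (survival_le x (leq_maxr m k)) _.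
  by rewrite lerBrDl -lerBrDr ge_min lexx orbT.
apply: le_trans (survival_le y (leq_maxl m k)) _; apply: le_trans (H y yF) _.
by rewrite lerB// ge_min lexx.
Qed.
End Survival.

Variables (V : state N -> R) (b : R) (F : seq (state N)).
Hypothesis V_ge0 : forall x, 0 <= V x.
Hypothesis V_bound : forall x, gen rate succ V x <= b.
Hypothesis V_drift : forall x, x \notin F -> gen rate succ V x <= -1.

(** [V] may increase on the finite set [F]. A multiple of the mean hitting time of [o] truncated at
    [m] jumps, namely the sum of the [survival] values, is added to it; this part decreases
    uniformly on [F] by irreducibility. *)
Let taboo_finite (o : state N) : (\sum_(k <oo) law X o (taboo o k) < +oo)%E.
Proof.
have Lam0 : 0 < Lam by apply: lt_le_trans (Lam_ge o); rewrite mulr_gt0.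
have q_le x : q x <= Lam.
  by apply: le_trans (Lam_ge x); rewrite ler_peMl ?ler1n// ltW.
have [m [d [d0 md]]] := survival_uniform o F.
pose b' := Num.max b 0.
(* On [F] the added term drops by at least [B * d], which pays for a mean increase [b' / qmin] of
   [V] per jump and leaves the required [Lam^-1]. *)
pose B := (b' / qmin + Lam^-1) / d.
have b'0 : 0 <= b' by rewrite /b' le_max lexx orbT.
have B0 : 0 <= B.
  by rewrite divr_ge0 ?(ltW d0)// addr_ge0 ?divr_ge0 ?invr_ge0// ltW.
pose W z := V z + B * \sum_(k < m) survival o k z.
have W0 z : 0 <= W z.
  by rewrite addr_ge0// mulr_ge0// sumr_ge0// => k _; exact: survival_ge0.
have e0 : 0 < Lam^-1 by rewrite invr_gt0.
have PV z : \sum_(y <- succ z) p z y * V y = V z + gen rate succ V z / q z.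
  rewrite /gen mulr_suml -[V z in RHS]mul1r -{1}(sum_p z) mulr_suml -big_split/=.
  apply: eq_big_seq => y ys.
  rewrite (jump_prob_succ succ_irr qmin_gt0 q_ge ys); field.
  by rewrite gt_eqF.
have Wd z : \sum_(y <- succ z | y != o) p z y * W y <= W z - Lam^-1.
  rewrite /W; under eq_bigr => y _ do rewrite mulrDr mulrCA.
  rewrite big_split/= -mulr_sumr.
  (* One jump raises the index of [survival] by one, so the truncated hitting time loses
     [1 - survival o m z]. *)
  have S : \sum_(y <- succ z | y != o) p z y * (\sum_(k < m) survival o k y) =
      \sum_(k < m) survival o k z - 1 + survival o m z.
    under eq_bigr => y _ do rewrite mulr_sumr.
    rewrite exchange_big/= -[LHS]/(\sum_(k < m) survival o k.+1 z).
    have : \sum_(k < m.+1) survival o k z = \sum_(k < m.+1) survival o k z by [].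
    rewrite {1}big_ord_recl [RHS]big_ord_recr/= => H.
    by rewrite addrAC -H addrC addKr.
  rewrite S.
  have V1 : \sum_(y <- succ z | y != o) p z y * V y <= V z + gen rate succ V z / q z.
    rewrite -PV big_mkcond; apply: ler_sum => y _; case: ifP => _; rewrite ?lexx//.
    exact: (mulr_ge0 (p_ge0 _ _) (V_ge0 _)).
  have sm1 : survival o m z <= 1 by have := survival_le o z (leq0n m).
  suff : gen rate succ V z / q z - B * (1 - survival o m z) <= - Lam^-1 by lra.
  have [zF|zF] := boolP (z \in F); last first.
    have : gen rate succ V z / q z <= - (q z)^-1.
      by rewrite -mulN1r ler_wpM2r ?V_drift// invr_ge0 ltW.
    have : Lam^-1 <= (q z)^-1 by rewrite lef_pV2 ?posrE.
    have : 0 <= B * (1 - survival o m z) by rewrite mulr_ge0// subr_ge0.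
    lra.
  have : gen rate succ V z / q z <= b' / qmin.
    apply: (@le_trans _ _ (b' / q z)).
      by rewrite ler_wpM2r ?invr_ge0 ?(ltW (q_gt0 z))// (le_trans (V_bound z))// /b' le_max lexx.
    by rewrite ler_wpM2l// lef_pV2 ?posrE.
  have : B * d <= B * (1 - survival o m z).
    by rewrite ler_wpM2l// lerBrDl -lerBrDr md.
  have -> : B * d = b' / qmin + Lam^-1 by rewrite /B divfK// gt_eqF.
  lra.
apply: le_lt_trans (taboo_summable X rate_ge0 succ_uniq rate_succ qmin_gt0 q_ge W0 e0 Wd o) _.
exact: ltry.
Qed.

Lemma foster_positive_recurrent : positive_recurrent X.
Proof.
move=> o; right.
exact: (return_time_integrable qmin_gt0 q_ge (taboo_finite o)).
Qed.

Lemma foster_stationary : exists pi : probability (state N) R, stationary X pi.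
Proof.
exact: (exists_stationary rate_ge0 succ_uniq succ_irr rate_succ qmin_gt0 q_ge
  (taboo_finite point) Lam_ge).
Qed.

End Foster.

(** * Transitions of the TABS chain *)

Section Occupancy.
Implicit Types (Q : seq nat) (i j : nat).

Lemma nth_nonincreasing Q : sorted geq Q -> forall j, (nth 0%N Q j.+1 <= nth 0%N Q j)%N.
Proof.
move=> /(sortedP 0%N) sQ j; have [jQ|jQ] := ltnP j.+1 (size Q); first exact: sQ.
by rewrite nth_default.
Qed.

Lemma sorted_nonincreasing Q : (forall j, (nth 0%N Q j.+1 <= nth 0%N Q j)%N) -> sorted geq Q.
Proof. by move=> H; apply/(sortedP 0%N) => j _; exact: H. Qed.

(** The zeros of a nonincreasing sequence come last, so removing them moves no entry, and the
    default value of [nth] replaces them. *)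
Lemma nth_filter_pos Q j : sorted geq Q -> nth 0%N [seq k <- Q | k != 0%N] j = nth 0%N Q j.
Proof.
elim: Q j => [|a Q IH] j //= aQ; have sQ := path_sorted aQ.
case: (eqVneq a 0%N) aQ => [->|a0] aQ /=; last by case: j => //= j; exact: IH.
have Q0 : all (fun k => k <= 0)%N Q.
  by apply: order_path_min aQ => x y z /= yx zy; exact: leq_trans zy yx.
have -> : [seq k <- Q | k != 0%N] = [::].
  apply/eqP; rewrite -[_ == _]negbK -has_filter; apply/hasPn => k kQ.
  by rewrite negbK -leqn0; exact: (allP Q0).
rewrite nth_nil; case: j => //= j; have [jQ|jQ] := ltnP j (size Q); last by rewrite nth_default.
by apply/esym/eqP; rewrite -leqn0; exact: (allP Q0 _ (mem_nth _ jQ)).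
Qed.

Lemma nth_decr_nth Q i j : sorted geq Q -> (0 < exactly Q i)%N ->
  nth 0%N (decr_nth Q i) j = (nth 0%N Q j - (i == j))%N.
Proof.
move=> sQ ex; rewrite /decr_nth nth_filter_pos.
  by rewrite nth_set_nth /= [j == i]eq_sym; case: eqP => [->|_]; rewrite ?subn1 ?subn0.
apply: sorted_nonincreasing => k; rewrite !nth_set_nth /=.
have kk := nth_nonincreasing sQ k.
move: ex; rewrite /exactly subn_gt0 => ex.
case: (eqVneq k.+1 i) => e1; case: (eqVneq k i) => e2 //; last by subst i; lia.
by subst i; apply: leq_trans (leq_pred _) kk.
Qed.

Lemma head_nth0 Q : head 0%N Q = nth 0%N Q 0%N. Proof. by case: Q. Qed.

Lemma exactlyE (R : realType) Q i : sorted geq Q ->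
  (exactly Q i)%:R = (nth 0%N Q i)%:R - (nth 0%N Q i.+1)%:R :> R.
Proof. by move=> sQ; rewrite /exactly natrB// nth_nonincreasing. Qed.

Lemma sorted_incr_nth Q i : sorted geq Q -> (i = 0%N \/ (0 < exactly Q i.-1)%N) ->
  sorted geq (incr_nth Q i).
Proof.
move=> sQ Hi; apply: sorted_nonincreasing => j; rewrite !nth_incr_nth.
have := nth_nonincreasing sQ j; case: Hi => [->|].
  by rewrite eqE /=; case: (0%N == j); lia.
rewrite /exactly; case: i => [|i] /= ex; first by case: (0%N == j); lia.
rewrite eqSS; have [<-|ij] := eqVneq i j; first by case: (_ == _); lia.
by case: (_ == _); lia.
Qed.

Lemma pos_incr_nth Q i : 0%N \notin Q -> (i <= size Q)%N -> 0%N \notin incr_nth Q i.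
Proof.
move=> Q0 iQ; apply/negP => /(nthP 0%N)[j]; rewrite size_incr_nth nth_incr_nth => jQ.
have [jQ'|jQ'] := ltnP j (size Q).
  move=> /eqP; rewrite addn_eq0 => /andP[_ /eqP Qj].
  by move: Q0; rewrite -Qj mem_nth.
rewrite nth_default// addn0; have -> : j = i by move: jQ; case: (ltnP i (size Q)); lia.
by rewrite eqxx.
Qed.

Lemma sorted_decr_nth Q i : sorted geq Q -> (0 < exactly Q i)%N -> sorted geq (decr_nth Q i).
Proof.
move=> sQ ex; apply: sorted_nonincreasing => j; rewrite !nth_decr_nth//.
have := nth_nonincreasing sQ j; move: ex; rewrite /exactly.
have [<-|ij] := eqVneq i j; first by case: (_ == _); lia.
by case: (_ == _); lia.
Qed.

Lemma pos_decr_nth Q i : 0%N \notin decr_nth Q i.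
Proof. by rewrite /decr_nth mem_filter eqxx. Qed.

End Occupancy.

Section Transitions.
Context (R : realType) (lambda mu nu : R) (N : nat).
Hypotheses (lambda_gt0 : 0 < lambda) (mu_gt0 : 0 < mu) (nu_gt0 : 0 < nu).
Local Notation trans := (transitions lambda mu nu N).
Local Notation rate := (@tabs_rate R lambda mu nu N).
Implicit Types (x y : state N) (Q : seq nat) (c : nat -> R).

Lemma transitions_ge0 (r : raw_state) e : e \in trans r -> 0 <= e.1.
Proof.
case: r => [[Q U] S]; rewrite /transitions !mem_cat => /or3P[].
- case: ifP => _; first by rewrite inE => /eqP -> /=; rewrite mulr_ge0// ltW.
  rewrite /blocked_arrivals; case: ifP => _.
    by rewrite inE => /eqP -> /=; rewrite mulr_ge0// ltW.
  by move=> /mapP[i _ ->] /=; rewrite !mulr_ge0 ?invr_ge0// ltW.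
- by move=> /mapP[i _ ->].
- by rewrite !inE => /orP[]/eqP -> /=; rewrite mulr_ge0// ltW.
Qed.

(** Listed transitions of rate 0 may have invalid targets, for instance a departure from a level
    where [exactly] vanishes; a positive rate excludes these. *)
Lemma transitions_valid (r : raw_state) e :
  valid_state N r -> e \in trans r -> 0 < e.1 -> valid_state N e.2.
Proof.
case: r => [[Q U] S] /and3P[sQ Q0 QN]; rewrite /transitions !mem_cat => /or3P[].
- case: ifP => idle.
    rewrite inE => /eqP -> _ /=; rewrite sorted_incr_nth//; last by left.
    rewrite pos_incr_nth// head_nth0 nth_incr_nth -head_nth0 /=; lia.
  rewrite /blocked_arrivals; case: ifP => Q1.
    rewrite inE => /eqP -> _; rewrite /= sQ Q0 /=.
    by case: (U) QN => [|u]; lia.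
  move=> /mapP[i + ->] /=; rewrite mem_iota /= => iQ re.
  have ex : (0 < exactly Q i)%N.
    by rewrite lt0n; apply: contraTneq re => ->; rewrite mul0r mulr0 ltxx.
  rewrite sorted_incr_nth//; last by right.
  rewrite pos_incr_nth// head_nth0 nth_incr_nth -head_nth0 /=.
  by case: (U) QN => [|u]; lia.
- move=> /mapP[i + ->] /=; rewrite mem_iota /= ltr0n => iQ ex.
  rewrite sorted_decr_nth// pos_decr_nth head_nth0 nth_decr_nth// -head_nth0 /=; lia.
- rewrite !inE => /orP[]/eqP -> /= H; rewrite sQ Q0 /=.
    have : (0 < N - (head 0%N Q + U + S))%N.
      by rewrite lt0n; apply: contraTneq H => ->; rewrite mulr0 ltxx.
    lia.
  lia.
Qed.

Lemma tabs_rate_ge0 x y : 0 <= rate x y.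
Proof. by rewrite /tabs_rate big_seq_cond sumr_ge0// => e /andP[/transitions_ge0]. Qed.

Definition tabs_succ x : seq (state N) :=
  [seq y <- undup (pmap insub [seq e.2 | e <- trans (val x)]) | y != x].

Lemma tabs_succ_uniq x : uniq (tabs_succ x).
Proof. by rewrite filter_uniq// undup_uniq. Qed.

Lemma tabs_succ_irr x : x \notin tabs_succ x.
Proof. by rewrite mem_filter eqxx. Qed.

Lemma mem_tabs_succ x y : (y \in tabs_succ x) =
  (y != x) && (val y \in [seq e.2 | e <- trans (val x)]).
Proof. by rewrite mem_filter mem_undup mem_pmap_sub. Qed.

Lemma tabs_rate_succ x y : y != x -> y \notin tabs_succ x -> rate x y = 0.
Proof.
move=> yx; rewrite mem_tabs_succ yx /= => yt.
rewrite /tabs_rate big_seq_cond big_pred0// => e.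
apply/negbTE; apply: contra yt => /andP[et /eqP <-].
by apply/mapP; exists e.
Qed.

Definition raw_gen (f : raw_state -> R) (r : raw_state) : R :=
  \sum_(e <- trans r) e.1 * (f e.2 - f r).

(** Replaces the sum over successor states by the list of transitions: entries with a common target
    add up, those that change nothing contribute zero, and invalid targets have rate 0. *)
Lemma tabs_genE (f : raw_state -> R) x :
  gen rate tabs_succ (f \o val) x = raw_gen f (val x).
Proof.
rewrite /gen /raw_gen /tabs_rate.
transitivity (\sum_(y <- tabs_succ x) \sum_(e <- trans (val x))
    (e.2 == val y)%:R * (e.1 * (f e.2 - f (val x)))).
  apply: eq_bigr => y _; rewrite mulr_suml big_mkcond; apply: eq_bigr => e _.
  by case: eqP => [->|_]; rewrite ?mul1r ?mul0r.
rewrite exchange_big/=; apply: eq_big_seq => e et.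
rewrite -mulr_suml.
have [e0|e0] := eqVneq e.1 0; first by rewrite e0 !mul0r mulr0.
have [ex|ex] := eqVneq e.2 (val x); first by rewrite ex subrr !mulr0.
have ev : valid_state N e.2.
  by apply: (transitions_valid (valP x) et); rewrite lt0r e0 (transitions_ge0 et).
pose y : state N := Sub e.2 ev.
have ys : y \in tabs_succ x.
  rewrite mem_tabs_succ; apply/andP; split; first by rewrite -val_eqE SubK.
  by rewrite SubK; apply/mapP; exists e.
rewrite (bigD1_seq y)//= ?tabs_succ_uniq// eqxx big1 ?addr0 ?mul1r// => z zy.
by case: eqP => // ez; move: zy; rewrite -val_eqE SubK ez eqxx.
Qed.

Lemma raw_genE (f : raw_state -> R) Q U S :
  let idle := (N - (head 0%N Q + U + S))%N in
  let U' := U.-1 in let S' := (S + (0 < U))%N in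
  raw_gen f (Q, U, S) =
  (if (0 < idle)%N then lambda * N%:R * (f (incr_nth Q 0%N, U, S) - f (Q, U, S))
   else if head 0%N Q == 0%N then lambda * N%:R * (f (Q, U', S') - f (Q, U, S))
   else \sum_(i < size Q) lambda * N%:R * ((exactly Q i)%:R / (head 0%N Q)%:R)
          * (f (incr_nth Q i.+1, U', S') - f (Q, U, S)))
  + \sum_(i < size Q) (exactly Q i)%:R * (f (decr_nth Q i, U, S) - f (Q, U, S))
  + mu * idle%:R * (f (Q, U.+1, S) - f (Q, U, S))
  + nu * S%:R * (f (Q, U, S.-1) - f (Q, U, S)).
Proof.
move=> idle U' S'.
have iota_sum (F : nat -> R) n : \sum_(i <- iota 0 n) F i = \sum_(i < n) F i.
  by rewrite -(big_mkord xpredT) /index_iota subn0.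
rewrite /raw_gen /transitions -/idle !big_cat big_map iota_sum !big_cons !big_nil /= addr0.
rewrite !addrA; congr (_ + _ + _ + _).
case: ifP => _; first by rewrite big_cons big_nil /= addr0.
rewrite /blocked_arrivals; case: ifP => _; first by rewrite big_cons big_nil /= addr0.
by rewrite big_map iota_sum.
Qed.

Definition weight (c : nat -> R) Q : R := \sum_(i < size Q) c i * (nth 0%N Q i)%:R.

Lemma weight_widen c Q n : (size Q <= n)%N -> \sum_(i < n) c i * (nth 0%N Q i)%:R = weight c Q.
Proof.
move=> Qn; rewrite /weight -!(big_mkord xpredT (fun i => c i * (nth 0%N Q i)%:R)).
rewrite (@big_cat_nat _ _ _ (size Q) 0 n)//= [X in _ + X]big_nat_cond [X in _ + X]big1 ?addr0// => i.
by rewrite andbT => /andP[Qi _]; rewrite nth_default// mulr0.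
Qed.

Lemma weight_incr c Q i : weight c (incr_nth Q i) = weight c Q + c i.
Proof.
pose n := maxn (size Q) i.+1.
have Qn : (size Q <= n)%N by rewrite leq_maxl.
have iN : (i < n)%N by rewrite leq_maxr.
rewrite -(@weight_widen c (incr_nth Q i) n); last first.
  by rewrite size_incr_nth; case: ifP => // _; rewrite leq_max ltnSn orbT.
rewrite -(weight_widen c Qn).
under eq_bigr => j _ do rewrite nth_incr_nth natrD mulrDr.
rewrite big_split/= addrC; congr (_ + _).
rewrite (bigD1 (Ordinal iN))//= eqxx mulr1 big1 ?addr0// => j ji.
by rewrite -val_eqE /= eq_sym in ji; rewrite (negbTE ji) mulr0.
Qed.

Lemma size_decr_nth Q i : (i < size Q)%N -> (size (decr_nth Q i) <= size Q)%N.
Proof.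
move=> iQ; rewrite /decr_nth size_filter; apply: leq_trans (count_size _ _) _.
by rewrite size_set_nth geq_max iQ leqnn.
Qed.

Lemma weight_decr c Q i : sorted geq Q -> (0 < exactly Q i)%N ->
  weight c (decr_nth Q i) = weight c Q - c i.
Proof.
move=> sQ ex.
have Qi : (0 < nth 0%N Q i)%N by move: ex; rewrite /exactly; lia.
have iQ : (i < size Q)%N by rewrite ltnNge; apply/negP => /(nth_default 0%N) Q0; rewrite Q0 in Qi.
rewrite -(weight_widen c (size_decr_nth iQ)) /weight.
transitivity (\sum_(j < size Q) (c j * (nth 0%N Q j)%:R - c j * (i == j)%:R)).
  apply: eq_bigr => j _; rewrite nth_decr_nth// natrB ?mulrBr//.
  by case: eqP => [<-|].
rewrite sumrB; congr (_ - _); rewrite (bigD1 (Ordinal iQ))//= eqxx mulr1 big1 ?addr0// => j ji.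
by rewrite -val_eqE /= eq_sym in ji; rewrite (negbTE ji) mulr0.
Qed.

(** Summation by parts. *)
Lemma sum_exactly (c : nat -> R) Q : sorted geq Q ->
  \sum_(i < size Q) (exactly Q i)%:R * c i =
  c 0%N * (head 0%N Q)%:R + \sum_(i < size Q) (c i.+1 - c i) * (nth 0%N Q i.+1)%:R.
Proof.
move=> sQ; have H n : \sum_(i < n) (exactly Q i)%:R * c i =
    c 0%N * (head 0%N Q)%:R - c n * (nth 0%N Q n)%:R
    + \sum_(i < n) (c i.+1 - c i) * (nth 0%N Q i.+1)%:R.
  elim: n => [|n IH]; first by rewrite !big_ord0 head_nth0; ring.
  by rewrite !big_ord_recr/= IH (exactlyE _ _ sQ); ring.
by rewrite H nth_default// mulr0 subr0.
Qed.

Lemma sum_exactly1 Q : sorted geq Q -> \sum_(i < size Q) (exactly Q i)%:R = (head 0%N Q)%:R :> R.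
Proof.
move=> sQ; have := sum_exactly (fun _ => 1) sQ.
under eq_bigr do rewrite mulr1.
by move=> ->; rewrite mul1r big1 ?addr0// => i _; rewrite subrr mul0r.
Qed.

Definition tasks Q : R := weight (fun _ => 1) Q.
(** A server with [k] tasks contributes [1 + ... + k], so this is a quadratic function of the queue
    lengths. *)
Definition levels Q : R := weight (fun i => i.+1%:R) Q.

Lemma sum_exactlyS Q : sorted geq Q -> \sum_(i < size Q) (exactly Q i)%:R * i.+1%:R = tasks Q.
Proof.
move=> sQ; rewrite (sum_exactly (fun i => i.+1%:R) sQ) /tasks mul1r head_nth0.
rewrite (eq_bigr (fun i : 'I_(size Q) => 1 * (nth 0%N Q i.+1)%:R)); last first.
  by move=> i _; rewrite -natrB// subSnn.
rewrite -(weight_widen (fun _ => 1) (leqnSn (size Q))) big_ord_recl/= mul1r.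
by congr (_ + _).
Qed.

Let lamN_ge0 : 0 <= lambda * N%:R. Proof. by rewrite mulr_ge0// ltW. Qed.

Lemma sum_blocked Q : sorted geq Q -> head 0%N Q != 0%N ->
  \sum_(i < size Q) lambda * N%:R * ((exactly Q i)%:R / (head 0%N Q)%:R) = lambda * N%:R.
Proof.
move=> sQ h0; rewrite -mulr_sumr -mulr_suml sum_exactly1// divff ?mulr1//.
by rewrite pnatr_eq0.
Qed.

Definition fast (phi : nat -> nat -> nat -> R) (r : raw_state) : R :=
  phi (head 0%N r.1.1) r.1.2 r.2.

(** Blocked arrivals leave the number of busy servers unchanged, and so do departures from queues
    longer than one. Beyond the three arguments of [phi], only the second occupancy enters. *)
Lemma raw_gen_fast phi Q U S : sorted geq Q ->
  let h := head 0%N Q in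
  let idle := (N - (h + U + S))%N in
  raw_gen (fast phi) (Q, U, S) =
  lambda * N%:R * ((if (0 < idle)%N then phi h.+1 U S else phi h U.-1 (S + (0 < U))%N)
     - phi h U S)
  + (h%:R - (nth 0%N Q 1)%:R) * (phi h.-1 U S - phi h U S)
  + mu * idle%:R * (phi h U.+1 S - phi h U S) + nu * S%:R * (phi h U S.-1 - phi h U S).
Proof.
move=> sQ h idle; rewrite raw_genE -/h -/idle /fast /= -/h.
have hincr i : head 0%N (incr_nth Q i.+1) = h by rewrite head_nth0 nth_incr_nth -head_nth0.
congr (_ + _ + _ + _).
  case: ifP => _.
    by rewrite (_ : head 0%N (incr_nth Q 0%N) = h.+1)// /h; case: (Q).
  case: eqVneq => [//|h0].
  under eq_bigr do rewrite hincr.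
  by rewrite -mulr_suml sum_blocked.
case E: (size Q) => [|n].
  move/eqP: E; rewrite size_eq0 => /eqP Q0; rewrite big_ord0 /h Q0 /=.
  by rewrite subrr mul0r.
rewrite big_ord_recl /= big1 ?addr0.
  have ex0 : (exactly Q 0)%:R = h%:R - (nth 0%N Q 1)%:R :> R by rewrite exactlyE// -head_nth0.
  rewrite -ex0; have [->|e0] := posnP (exactly Q 0); first by rewrite !mul0r.
  congr (_ * (phi _ _ _ - _)).
  by rewrite head_nth0 nth_decr_nth// eqxx -head_nth0 subn1.
move=> i _; rewrite /bump /= add1n; have [->|e0] := posnP (exactly Q i.+1); first by rewrite mul0r.
by rewrite [head 0%N (decr_nth _ _)]head_nth0 nth_decr_nth// subn0 -head_nth0 subrr mulr0.
Qed.

Lemma raw_gen_tasks Q U S : sorted geq Q ->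
  raw_gen (tasks \o fst \o fst) (Q, U, S) <= lambda * N%:R - (head 0%N Q)%:R.
Proof.
move=> sQ; rewrite raw_genE /= !subrr !mulr0 !addr0 /tasks.
apply: lerD.
  case: ifP => _; first by rewrite weight_incr addrAC subrr add0r mulr1.
  case: eqVneq => [_|h0]; first exact: lamN_ge0.
  under eq_bigr do rewrite weight_incr addrAC subrr add0r mulr1.
  by rewrite sum_blocked.
rewrite -(sum_exactly1 sQ) -[leRHS]mulN1r mulr_sumr le_eqVlt; apply/orP; left; apply/eqP.
apply: eq_bigr => i _; have [->|ex] := posnP (exactly Q i); first by rewrite mul0r mulr0.
by rewrite weight_decr// addrAC subrr add0r mulrN1 mulN1r.
Qed.

Lemma tasks_ge0 Q : 0 <= tasks Q.
Proof. by apply: sumr_ge0 => i _; rewrite mul1r. Qed.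

Lemma levels_ge0 Q : 0 <= levels Q.
Proof. by apply: sumr_ge0 => i _; rewrite mulr_ge0. Qed.

Lemma tasks_head0 Q : sorted geq Q -> head 0%N Q = 0%N -> tasks Q = 0.
Proof.
case: Q => [|a Q] sQ /=; first by rewrite /tasks /weight big_ord0.
move=> a0; rewrite -sum_exactlyS// big1// => i _.
have := sum_exactly1 sQ; rewrite /= a0 => /eqP; rewrite psumr_eq0// => /allP/(_ i).
by rewrite mem_index_enum => /(_ isT)/eqP ->; rewrite mul0r.
Qed.

(** The rate at which each busy server receives tasks while arrivals are blocked; with nobody busy,
    the quotient by zero is 0. *)
Definition congestion (r : raw_state) : R :=
  if (0 < N - (head 0%N r.1.1 + r.1.2 + r.2))%N then 0
  else lambda * N%:R / (head 0%N r.1.1)%:R.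

(** A departure from a queue of length [i.+1] removes [i.+1], so departures contribute [- tasks Q].
    A blocked arrival joins a busy server chosen uniformly and adds its queue length plus one, on
    average [tasks Q / head 0 Q + 1]. *)
Lemma raw_gen_levels Q U S : sorted geq Q ->
  raw_gen (levels \o fst \o fst) (Q, U, S) <=
  lambda * N%:R + tasks Q * (congestion (Q, U, S) - 1).
Proof.
move=> sQ; rewrite raw_genE /= !subrr !mulr0 !addr0 /levels.
have dep : \sum_(i < size Q) (exactly Q i)%:R *
    (weight (fun i => i.+1%:R) (decr_nth Q i) - weight (fun i => i.+1%:R) Q) = - tasks Q.
  rewrite -(sum_exactlyS sQ) -[RHS]mulN1r mulr_sumr; apply: eq_bigr => i _.
  have [->|ex] := posnP (exactly Q i); first by rewrite !mul0r mulr0.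
  by rewrite weight_decr// addrAC subrr add0r mulrN mulN1r.
rewrite dep /congestion /=; case: ifP => _.
  by rewrite weight_incr addrAC subrr add0r mulr1 sub0r mulrN1.
case: eqVneq => [h0|h0].
  by rewrite (tasks_head0 sQ h0) oppr0 mul0r !addr0; exact: lamN_ge0.
under eq_bigr do rewrite weight_incr addrAC subrr add0r.
rewrite (_ : \sum_(i < size Q) _ = lambda * N%:R * (tasks Q / (head 0%N Q)%:R + 1)).
  by rewrite le_eqVlt; apply/orP; left; apply/eqP; field; rewrite pnatr_eq0.
have hR : (head 0%N Q)%:R != 0 :> R by rewrite pnatr_eq0.
transitivity (lambda * N%:R / (head 0%N Q)%:R *
   (\sum_(i < size Q) (exactly Q i)%:R * i.+1%:R + \sum_(i < size Q) (exactly Q i)%:R)).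
  rewrite -big_split/= mulr_sumr; apply: eq_bigr => i _.
  by rewrite -(natr1 i.+1); ring.
by rewrite sum_exactlyS// sum_exactly1//; field.
Qed.

Definition rate_bound : R := N%:R * (lambda + 1 + mu + nu).

Lemma sum_transitions (r : raw_state) : valid_state N r ->
  \sum_(e <- trans r) e.1 <= rate_bound.
Proof.
case: r => [[Q U] S] /and3P[sQ Q0 QN].
have iota_sum (F : nat -> R) n : \sum_(i <- iota 0 n) F i = \sum_(i < n) F i.
  by rewrite -(big_mkord xpredT) /index_iota subn0.
rewrite /transitions !big_cat big_map iota_sum !big_cons !big_nil /= addr0 sum_exactly1//.
set A := (X in X + _ <= _).
have AN : A <= lambda * N%:R.
  rewrite /A; case: ifP => _; first by rewrite big_cons big_nil /= addr0.
  rewrite /blocked_arrivals; case: ifP => [_|/negbT h0]; first by rewrite big_cons big_nil /= addr0.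
  by rewrite big_map iota_sum sum_blocked.
have hN : (head 0%N Q)%:R <= N%:R :> R by rewrite ler_nat; lia.
have UN : (N - (head 0%N Q + U + S))%:R <= N%:R :> R by rewrite ler_nat; lia.
have SN : S%:R <= N%:R :> R by rewrite ler_nat; lia.
have := ler_wpM2l (ltW mu_gt0) UN; have := ler_wpM2l (ltW nu_gt0) SN.
rewrite /rate_bound; lra.
Qed.

Lemma tasks_step (r : raw_state) e : valid_state N r -> e \in trans r -> 0 < e.1 ->
  tasks e.2.1.1 <= tasks r.1.1 + 1.
Proof.
case: r => [[Q U] S] /and3P[sQ Q0 QN]; rewrite /transitions !mem_cat => /or3P[].
- case: ifP => _; first by rewrite inE => /eqP -> /=; rewrite /tasks weight_incr.
  rewrite /blocked_arrivals; case: ifP => _.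
    by rewrite inE => /eqP -> _ /=; rewrite lerDl.
  by move=> /mapP[i _ ->] _ /=; rewrite /tasks weight_incr.
- move=> /mapP[i _ ->] /=; rewrite ltr0n => ex.
  by rewrite /tasks weight_decr// lerD// lerN10.
- by rewrite !inE => /orP[]/eqP -> _ /=; rewrite lerDl.
Qed.

Lemma tasks_sumn Q : tasks Q = (sumn Q)%:R.
Proof.
rewrite sumnE (big_nth 0%N) big_mkord natr_sum /tasks /weight.
by apply: eq_bigr => i _; rewrite mul1r.
Qed.

Lemma sumn_decr_nth Q i : sorted geq Q -> (0 < exactly Q i)%N ->
  sumn Q = (sumn (decr_nth Q i)).+1.
Proof.
move=> sQ ex; apply: (@Num.Theory.mulrIn R 1 (oner_neq0 R)).
by rewrite -natr1 -!tasks_sumn /tasks weight_decr// subrK.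
Qed.

Section ExitRates.
Hypothesis N_gt0 : (0 < N)%N.

Let exit_raw x : exit_rate rate x = raw_gen (fun r => (r != val x)%:R) (val x).
Proof.
rewrite -tabs_genE (exit_rateE tabs_rate_ge0 tabs_succ_uniq tabs_succ_irr tabs_rate_succ).
apply: eq_big_seq => y ys; rewrite /= eqxx subr0.
have -> : val y != val x; last by rewrite mulr1.
by rewrite val_eqE; apply: contraTneq ys => ->; exact: tabs_succ_irr.
Qed.

Lemma tabs_exit_le x : exit_rate rate x <= rate_bound.
Proof.
rewrite exit_raw /raw_gen; apply: le_trans (sum_transitions (valP x)).
rewrite big_seq [leRHS]big_seq; apply: ler_sum => e et.
rewrite eqxx subr0 ler_piMr ?(transitions_ge0 et)//.
by case: (_ != _); rewrite ?lexx ?ler01.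
Qed.

Definition rate_min : R := Num.min 1 (Num.min lambda nu).

Lemma rate_min_gt0 : 0 < rate_min.
Proof. by rewrite /rate_min !lt_min ltr01 lambda_gt0 nu_gt0. Qed.

(** Some clock always changes the state: a departure if a server is busy, else an arrival if some
    server is idle-on or idle-off, else the end of a setup, all servers being in setup. *)
Lemma tabs_exit_ge x : rate_min <= exit_rate rate x.
Proof.
rewrite exit_raw; case: (val x) (valP x) => [[Q U] S] /and3P[sQ Q0 QN].
rewrite raw_genE eqxx.
have nn (b : bool) : 0 <= (b%:R - 0 : R) by rewrite subr0.
set A := (X in X + _ + _ + _); set B := (X in _ + X + _ + _).
set C := (X in _ + _ + X + _); set D := (X in _ + _ + _ + X).
have lN : lambda <= lambda * N%:R by rewrite ler_peMr ?ler1n// ltW.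
have A0 : 0 <= A.
  rewrite /A; case: ifP => _; first by rewrite mulr_ge0.
  case: ifP => _; first by rewrite mulr_ge0.
  by apply: sumr_ge0 => i _; rewrite mulr_ge0// mulr_ge0// divr_ge0.
have B0 : 0 <= B by apply: sumr_ge0 => i _; rewrite mulr_ge0.
have C0 : 0 <= C by rewrite mulr_ge0// mulr_ge0// ltW.
have D0 : 0 <= D by rewrite mulr_ge0// mulr_ge0// ltW.
have pred_neq k : (0 < k)%N -> (k.-1 != k)%N by case: k => // k _; rewrite neq_ltn ltnSn.
have [m1 ml mn] : [/\ rate_min <= 1, rate_min <= lambda & rate_min <= nu].
  by rewrite /rate_min !ge_min !lexx !orbT.
have [h0|h0] := posnP (head 0%N Q); last first.
  suff : 1 <= B by lra.
  apply: (@le_trans _ _ (head 0%N Q)%:R); first by rewrite ler1n.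
  rewrite -sum_exactly1//; apply: ler_sum => i _.
  have [->|ex] := posnP (exactly Q i); first by rewrite mul0r.
  rewrite ler_peMr// subr0; have -> // : (decr_nth Q i, U, S) != (Q, U, S).
  by apply/negP => /eqP[dQ]; have := sumn_decr_nth sQ ex; rewrite dQ => /n_Sn.
suff [|] : lambda <= A \/ nu <= D by lra.
rewrite /A /D h0 /=; case: ifP => idle.
  left; rewrite subr0 (_ : (incr_nth Q 0, U, S) != (Q, U, S)) ?mulr1//.
  by case: (Q) h0 => [|a s] /= => [|->].
have [U0|U0] := posnP U; last first.
  left; rewrite subr0 (_ : (Q, U.-1, _) != (Q, U, S)) ?mulr1//.
  by apply/negP => /eqP[e _]; have := pred_neq _ U0; rewrite e eqxx.
right; have SN : S = N.
  by move/negbT: idle; rewrite U0 add0n -leqNgt leqn0 subn_eq0 => NS; apply/eqP; rewrite eqn_leq NS andbT; move: QN; rewrite U0 h0.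
rewrite (_ : (Q, U, S.-1) != (Q, U, S)) ?subr0 ?mulr1; last first.
  by apply/negP => /eqP[e]; have := pred_neq S; rewrite e eqxx SN N_gt0 => /(_ isT).
by rewrite ler_peMr ?(ltW nu_gt0)// ler1n SN.
Qed.

End ExitRates.

(** * Irreducibility of the chain *)

Section Irreducibility.
Implicit Types r : raw_state.

(** Vacuous when [r] is not a valid state, so validity need not be carried through a chain of
    moves. *)
Inductive raw_reach r r' : Prop := RawReach of
  (forall x, val x = r -> exists2 y, val y = r' & reach rate x y).

Let raw_refl r : raw_reach r r.
Proof. by split=> x <-; exists x => //; exact: reach_refl. Qed.

Let raw_trans r r' r'' : raw_reach r r' -> raw_reach r' r'' -> raw_reach r r''.
Proof.
move=> [H] [H']; split=> x xr; have [y yr xy] := H x xr; have [z zr yz] := H' y yr.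
by exists z => //; exact: reach_trans xy yz.
Qed.

Let raw_step r e : e \in trans r -> 0 < e.1 -> raw_reach r e.2.
Proof.
move=> et e0; split=> x xr; have ev : valid_state N e.2.
  by apply: (transitions_valid _ et e0); rewrite -xr; exact: valP.
exists (Sub e.2 ev); first by rewrite SubK.
apply: reach_step (reach_refl _ _) _.
rewrite /tabs_rate xr SubK (big_rem _ et)/= eqxx ltr_pwDl//.
by rewrite big_seq_cond sumr_ge0// => e' /andP[/mem_rem /transitions_ge0].
Qed.

Let step_departure Q U S i : (0 < exactly Q i)%N -> raw_reach (Q, U, S) (decr_nth Q i, U, S).
Proof.
move=> ex; have iQ : (i < size Q)%N.
  by rewrite ltnNge; apply/negP => /(nth_default 0%N) Q0; move: ex; rewrite /exactly Q0.
apply: (@raw_step _ ((exactly Q i)%:R, (decr_nth Q i, U, S))); last by rewrite ltr0n.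
rewrite /transitions !mem_cat; apply/or3P/Or32/mapP; exists i => //.
by rewrite mem_iota.
Qed.

Let step_off Q U S : (head 0%N Q + U + S < N)%N -> raw_reach (Q, U, S) (Q, U.+1, S).
Proof.
move=> QN; apply: (@raw_step _ (mu * (N - (head 0%N Q + U + S))%:R, (Q, U.+1, S))).
  by rewrite /transitions !mem_cat; apply/or3P/Or33; rewrite mem_head.
by rewrite mulr_gt0// ltr0n subn_gt0.
Qed.

Let step_setup Q U S : raw_reach (Q, U, S.+1) (Q, U, S).
Proof.
apply: (@raw_step _ (nu * S.+1%:R, (Q, U, S))); last by rewrite mulr_gt0.
by rewrite /transitions !mem_cat; apply/or3P/Or33; rewrite !inE eqxx orbT.
Qed.

Let step_arrival Q U S : (head 0%N Q + U + S < N)%N ->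
  raw_reach (Q, U, S) (incr_nth Q 0, U, S).
Proof.
move=> QN; apply: (@raw_step _ (lambda * N%:R, (incr_nth Q 0, U, S))).
  by rewrite /transitions subn_gt0 QN !mem_cat mem_head.
by rewrite mulr_gt0// ltr0n; lia.
Qed.

Let step_lost U S : (0 < N)%N -> (U + S)%N = N ->
  raw_reach ([::], U, S) ([::], U.-1, (S + (0 < U))%N).
Proof.
move=> N0 US; apply: (@raw_step _ (lambda * N%:R, ([::], U.-1, (S + (0 < U))%N))).
  by rewrite /transitions /= add0n US subnn /= mem_head.
by rewrite mulr_gt0// ltr0n.
Qed.

Let step_blocked Q U S i : (0 < N)%N -> sorted geq Q -> (head 0%N Q + U + S)%N = N ->
  (0 < exactly Q i)%N ->
  raw_reach (Q, U, S) (incr_nth Q i.+1, U.-1, (S + (0 < U))%N).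
Proof.
move=> N0 sQ QN ex; have iQ : (i < size Q)%N.
  by rewrite ltnNge; apply/negP => /(nth_default 0%N) Q0; move: ex; rewrite /exactly Q0.
have h0 : head 0%N Q != 0%N.
  rewrite -lt0n; apply: leq_trans (_ : nth 0%N Q i <= _)%N; first by move: ex; rewrite /exactly; lia.
  rewrite head_nth0; elim: i {ex iQ} => // i IH.
  exact: leq_trans (nth_nonincreasing sQ i) IH.
apply: (@raw_step _ (lambda * N%:R * ((exactly Q i)%:R / (head 0%N Q)%:R),
   (incr_nth Q i.+1, U.-1, (S + (0 < U))%N))); last first.
  by rewrite !mulr_gt0 ?invr_gt0 ?ltr0n// lt0n.
rewrite /transitions QN subnn /= (negbTE h0) mem_cat; apply/orP; left.
by apply/mapP; exists i; rewrite ?mem_iota.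
Qed.

Let pos_seq_eq Q Q' : 0%N \notin Q -> 0%N \notin Q' ->
  (forall j, nth 0%N Q j = nth 0%N Q' j) -> Q = Q'.
Proof.
have size_le A B : 0%N \notin A -> (forall j, nth 0%N A j = nth 0%N B j) -> (size A <= size B)%N.
  move=> A0 AB; rewrite leqNgt; apply/negP => BA.
  by move: A0; rewrite -(nth_default 0%N (leqnn (size B))) -AB mem_nth.
move=> Q0 Q0' QQ; apply: (@eq_from_nth _ 0%N) => // .
by apply/eqP; rewrite eqn_leq !size_le.
Qed.

Let departures Q Q' U S : sorted geq Q -> 0%N \notin Q -> sorted geq Q' -> 0%N \notin Q' ->
  (forall j, (nth 0%N Q' j <= nth 0%N Q j)%N) -> raw_reach (Q, U, S) (Q', U, S).
Proof.
move: {2}(sumn Q) (leqnn (sumn Q)) => n; elim: n Q => [|n IH] Q Qn sQ Q0 sQ' Q0' QQ.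
  suff -> : Q' = Q by exact: raw_refl.
  apply: pos_seq_eq => // j; apply/eqP; rewrite eqn_leq QQ /=.
  have [jQ|jQ] := ltnP j (size Q); last by rewrite nth_default.
  have : (nth 0%N Q j <= sumn Q)%N.
    by rewrite sumnE (big_rem (nth 0%N Q j)) ?mem_nth//= leq_addr.
  lia.
have [E|] := pselect (forall j, nth 0%N Q' j = nth 0%N Q j).
  by rewrite (pos_seq_eq Q0' Q0 E); exact: raw_refl.
move=> /existsNP[j0 /eqP j0P].
(* At the last level where [Q] exceeds [Q'] there is a server with exactly that queue length, and
   its departure keeps [Q] above [Q']. *)
pose P j := (nth 0%N Q' j < nth 0%N Q j)%N.
have exP : exists j, P j by exists j0; rewrite /P ltn_neqAle j0P QQ.
have bP j : P j -> (j <= size Q)%N.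
  by rewrite /P => H; rewrite leqNgt; apply/negP => /ltnW /(nth_default 0%N) E; rewrite E in H.
case: (ex_maxnP exP bP) => j Pj jmax.
have ex : (0 < exactly Q j)%N.
  rewrite /exactly subn_gt0; have [H|] := boolP (P j.+1).
    by have := jmax _ H; rewrite ltnn.
  rewrite /P -leqNgt => H; apply: leq_ltn_trans H (leq_ltn_trans _ Pj).
  exact: nth_nonincreasing.
apply: raw_trans (step_departure (i := j) U S ex) _; apply: IH => //.
- by have := sumn_decr_nth sQ ex; lia.
- exact: sorted_decr_nth.
- exact: pos_decr_nth.
- move=> k; rewrite nth_decr_nth//; have := QQ k; have [<-|_] := eqVneq j k; last by lia.
  by move: Pj; rewrite /P; lia.
Qed.

Let off_all Q U S k : (head 0%N Q + U + S + k <= N)%N -> raw_reach (Q, U, S) (Q, (U + k)%N, S).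
Proof.
elim: k U => [|k IH] U H; first by rewrite addn0.
apply: raw_trans (step_off _) _; first by lia.
by rewrite -addSnnS; apply: IH; lia.
Qed.

Let setup_all Q U S : raw_reach (Q, U, S) (Q, U, 0%N).
Proof. by elim: S => [|S IH] //; exact: raw_trans (step_setup _ _ _) IH. Qed.

Let lost_all U S k : (0 < N)%N -> (U + S)%N = N -> (k <= U)%N ->
  raw_reach ([::], U, S) ([::], (U - k)%N, (S + k)%N).
Proof.
move=> N0; elim: k U S => [|k IH] U S US kU; first by rewrite subn0 addn0.
apply: raw_trans (step_lost N0 US) _; have -> : (0 < U)%N = true by lia.
have -> : (U - k.+1 = U.-1 - k)%N by lia.
have -> : (S + k.+1 = S + true + k)%N by rewrite /=; lia.
by apply: IH; rewrite /=; lia.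
Qed.

Let fill k : (k <= N)%N -> raw_reach ([::], 0%N, 0%N) ((if k == 0%N then [::] else [:: k]), 0%N, 0%N).
Proof.
elim: k => [|k IH] kN //; apply: raw_trans (IH (ltnW kN)) _.
have := @step_arrival (if k == 0%N then [::] else [:: k]) 0 0.
by case: (k) kN => [|k'] /= kN; rewrite !addn0; apply.
Qed.

(** Induction on the number of tasks: the task on top of the last level of [Q] can be the latest
    blocked arrival. No server is idle-off, so no setup is started. *)
Let build Q : (0 < N)%N -> sorted geq Q -> 0%N \notin Q -> head 0%N Q = N ->
  raw_reach ([:: N], 0%N, 0%N) (Q, 0%N, 0%N).
Proof.
move=> N0; move: {2}(sumn Q) (leqnn (sumn Q)) => n; elim: n Q => [|n IH] Q Qn sQ Q0 hQ.
  by exfalso; move: hQ Qn; case: (Q) => [|a s] /=; lia.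
have s0 : (0 < size Q)%N by case: (Q) hQ => //=; lia.
have [s1|s1] := leqP (size Q) 1.
  have -> : Q = [:: N]; last exact: raw_refl.
  by case: (Q) hQ s0 s1 => [|a [|b s]] //= ->.
pose L := (size Q).-1.
have LQ : L.+1 = size Q by rewrite /L prednK.
have QL : (0 < nth 0%N Q L)%N.
  by rewrite lt0n; apply: contra Q0 => /eqP <-; apply: mem_nth; rewrite LQ.
have QL1 : nth 0%N Q L.+1 = 0%N by rewrite nth_default// LQ.
have ex : (0 < exactly Q L)%N by rewrite /exactly QL1 subn0.
pose Q' := decr_nth Q L.
have sQ' : sorted geq Q' by exact: sorted_decr_nth.
have L0 : (0 < L)%N by rewrite -ltnS LQ.
have hQ' : head 0%N Q' = N.
  by rewrite head_nth0 nth_decr_nth// -head_nth0 hQ gtn_eqF// subn0.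
have ex' : (0 < exactly Q' L.-1)%N.
  rewrite /exactly !nth_decr_nth//; have := nth_nonincreasing sQ L.-1.
  rewrite prednK// eqxx; have -> : (L == L.-1) = false by lia.
  by rewrite subn0 /=; lia.
have Q'n : (sumn Q' <= n)%N by have := sumn_decr_nth sQ ex; rewrite -/Q'; lia.
have sizeQ' : (L <= size Q')%N.
  rewrite leqNgt; apply/negP => Ls.
  move: ex'; rewrite /exactly (nth_default 0%N (n := L.-1)); last by lia.
  by rewrite sub0n.
apply: raw_trans (IH Q' Q'n sQ' (pos_decr_nth _ _) hQ') _.
have -> : Q = incr_nth Q' L.-1.+1.
  apply: pos_seq_eq => //.
    by rewrite prednK//; apply: pos_incr_nth => //; exact: pos_decr_nth.
  move=> j; rewrite prednK// nth_incr_nth nth_decr_nth//.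
  by have [<-|_] := eqVneq L j; rewrite ?subn0//= addnBA ?QL// addKn.
have := @step_blocked Q' 0 0 L.-1 N0 sQ' _ ex'.
by rewrite hQ' !addn0; apply.
Qed.

(** A blocked arrival that starts a setup also adds a task, which a departure then removes; with
    nobody busy the task is simply lost. *)
Let setups Q U k : (0 < N)%N -> sorted geq Q -> 0%N \notin Q ->
  (head 0%N Q + U)%N = N -> (k <= U)%N -> raw_reach (Q, U, 0%N) (Q, (U - k)%N, k).
Proof.
move=> N0 sQ Q0 QU; elim: k => [|k IH] kU; first by rewrite subn0; exact: raw_refl.
apply: raw_trans (IH (ltnW kU)) _.
have pU : (0 < U - k)%N by lia.
have [h0|h0] := posnP (head 0%N Q).
  have -> : Q = [::].
    by case: (Q) h0 Q0 => //= a s ->; rewrite mem_head.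
  have := @step_lost (U - k) k N0; rewrite pU addn1.
  have -> : ((U - k).-1 = U - k.+1)%N by lia.
  by apply; lia.
pose L := (size Q).-1.
have LQ : L.+1 = size Q by rewrite /L prednK//; case: (Q) h0.
have ex : (0 < exactly Q L)%N.
  rewrite /exactly [X in (_ - X)%N]nth_default; last by rewrite LQ.
  by rewrite subn0 lt0n; apply: contra Q0 => /eqP <-; apply: mem_nth; rewrite LQ.
have := @step_blocked Q (U - k) k L N0 sQ _ ex.
rewrite pU addn1; have -> : ((U - k).-1 = U - k.+1)%N by lia.
move=> H; apply: raw_trans (H _) _; first by lia.
apply: departures => //.
- by apply: sorted_incr_nth => //; right.
- by apply: pos_incr_nth => //; rewrite LQ.
- by move=> j; rewrite nth_incr_nth leq_addl.
Qed.

Lemma tabs_irreducible x y : (0 < N)%N -> reach rate x y.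
Proof.
move=> N0.
have to_empty r : valid_state N r -> raw_reach r ([::], 0%N, 0%N).
  case: r => [[Q U] S] /and3P[sQ Q0 QN].
  apply: (@raw_trans _ ([::], U, S)).
    by apply: departures => // j; rewrite nth_nil.
  apply: raw_trans (setup_all _ _ _) _.
  have := @off_all [::] U 0 (N - U); rewrite /= add0n !addn0 subnKC; last by lia.
  move=> H; apply: raw_trans (H (leqnn _)) _.
  have := @lost_all N 0 N N0 (addn0 N) (leqnn N); rewrite subnn add0n => H'.
  exact: raw_trans H' (setup_all _ _ _).
have from_empty r : valid_state N r -> raw_reach ([::], 0%N, 0%N) r.
  case: r => [[Q U] S] /and3P[sQ Q0 QN].
  have := fill (leqnn N); rewrite gtn_eqF// => H; apply: raw_trans H _.
  pose m := (N - (U + S))%N.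
  have hm : (head 0%N Q <= m)%N by rewrite /m; lia.
  have mN : (m <= N)%N by rewrite /m leq_subr.
  (* [Q] with [k] busy servers and unchanged higher levels; for [k = N] the queues can be built by
     blocked arrivals alone. *)
  pose B k := k :: behead Q.
  have nB k j : nth 0%N (B k) j = if j == 0%N then k else nth 0%N Q j.
    by case: j => [|j] //=; rewrite nth_behead.
  have sB k : (head 0%N Q <= k)%N -> sorted geq (B k).
    move=> hk; apply: sorted_nonincreasing => j; rewrite !nB /=.
    case: eqVneq => [->|_]; last exact: nth_nonincreasing.
    by apply: leq_trans hk; rewrite head_nth0; exact: nth_nonincreasing.
  have pB k : (0 < k)%N -> 0%N \notin B k.
    move=> k0; rewrite inE negb_or neq_ltn k0 /=.
    by apply: contra Q0 => /mem_behead.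
  apply: raw_trans (build N0 (sB N _) (pB N N0) _) _ => //; first by lia.
  pose Qm := if m == 0%N then [::] else B m.
  have sQm : sorted geq Qm by rewrite /Qm; case: ifP => // _; exact: sB.
  have pQm : 0%N \notin Qm by rewrite /Qm; case: eqVneq => // m0; apply: pB; rewrite lt0n.
  have hQm : head 0%N Qm = m by rewrite /Qm; case: eqVneq.
  have QQm j : (nth 0%N Q j <= nth 0%N Qm j)%N.
    rewrite /Qm; case: eqVneq => [m0|m0].
      have h0 : head 0%N Q = 0%N by lia.
      have -> : Q = [::] by case: (Q) h0 Q0 => //= a s ->; rewrite mem_head.
      by rewrite leqnn.
    by rewrite nB; case: eqVneq => [->|_] //; rewrite -head_nth0.
  apply: (@raw_trans _ (Qm, 0%N, 0%N)).
    apply: departures => //; [by apply: sB; lia|exact: pB|].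
    move=> j; rewrite nB /Qm; case: eqVneq => [m0|m0]; first by rewrite nth_nil.
    by rewrite nB; case: eqVneq.
  have := @off_all Qm 0 0 (U + S); rewrite !addn0 add0n hQm /m => H.
  apply: raw_trans (H _) _; first by lia.
  have := @setups Qm (U + S) S N0 sQm pQm; rewrite addnK hQm /m => H'.
  apply: raw_trans (H' _ _) _; [by lia|by rewrite leq_addl|].
  exact: departures.
have [/(_ x erefl)[z z0 xz]] := to_empty _ (valP x).
have [/(_ z z0)[y' y'y zy]] := from_empty _ (valP y).
have -> : y = y' by apply: val_inj.
exact: reach_trans xz zy.
Qed.

End Irreducibility.

Fixpoint seqs_upto (n : nat) : seq (seq nat) :=
  if n is n'.+1 then [::] :: [seq a :: q | a <- iota 0 N.+1, q <- seqs_upto n'] else [:: [::]].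

Lemma mem_seqs_upto n Q : (size Q <= n)%N -> all (fun a => a <= N)%N Q -> Q \in seqs_upto n.
Proof.
elim: n Q => [|n IH] [|a Q] sQ; rewrite ?mem_head// => /andP[aN QN].
rewrite -[seqs_upto _]/([::] :: [seq a :: q | a <- iota 0 N.+1, q <- seqs_upto n]) in_cons.
apply/orP; right; apply/allpairsPdep; exists a, Q.
by rewrite mem_iota add0n ltnS; split => //; exact: IH.
Qed.

Definition few_tasks (M : nat) : seq (state N) :=
  pmap insub [seq (q, s) | q <- [seq (Q, u) | Q <- seqs_upto M, u <- iota 0 N.+1],
                           s <- iota 0 N.+1].

(** The entries of [Q] are positive and at most [N], so their number is at most the number of
    tasks. *)
Lemma mem_few_tasks (M : nat) x : tasks (val x).1.1 <= M%:R -> x \in few_tasks M.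
Proof.
case: x => [[[Q U] S] xP] /=; have /and3P[sQ Q0 QN] := xP.
rewrite tasks_sumn ler_nat => QM.
rewrite mem_pmap_sub -[X in X \in _]/(Q, U, S); apply/allpairsPdep; exists (Q, U), S; split => //; last by rewrite mem_iota; lia.
apply/allpairsPdep; exists Q, U; split => //; last by rewrite mem_iota; lia.
apply: mem_seqs_upto.
  apply: leq_trans QM; elim: (Q) Q0 => //= a s IH; rewrite inE negb_or => /andP[a0 s0].
  by have := IH s0; lia.
have nQ j : (nth 0%N Q j <= head 0%N Q)%N.
  rewrite head_nth0; elim: j => // j IH; exact: leq_trans (nth_nonincreasing sQ j) IH.
apply/allP => a /(nthP 0%N)[j _ <-]; apply: leq_trans (nQ j) (leq_trans _ QN).
by rewrite -addnA leq_addr.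
Qed.

End Transitions.

(** * Drift in scaled variables *)

Section RealBounds.
Context (R : realType).
Implicit Types (u k y z : R).

Definition pos u : R := Num.max u 0.

Lemma pos_ge0 u : 0 <= pos u. Proof. by rewrite le_max lexx orbT. Qed.
Lemma pos_ge u : u <= pos u. Proof. by rewrite le_max lexx. Qed.

Lemma posP u : (0 <= u /\ pos u = u) \/ (u < 0 /\ pos u = 0).
Proof.
rewrite /pos; have [u0|u0] := leP 0 u; [left|right]; split => //.
Qed.

Lemma pos_sq_ub u k : pos (u + k) ^+ 2 <= pos u ^+ 2 + 2 * pos u * k + k ^+ 2.
Proof.
case: (posP u) => -[u0 ->]; case: (posP (u + k)) => -[uk ->]; rewrite ?expr2.
- by rewrite le_eqVlt; apply/orP; left; apply/eqP; ring.
- by have := sqr_ge0 (u + k); rewrite expr2; lra.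
- by nra.
- by rewrite !mul0r; have := sqr_ge0 k; rewrite expr2; lra.
Qed.

Lemma pos_sq_lb u k : pos u ^+ 2 + 2 * pos u * k <= pos (u + k) ^+ 2.
Proof.
case: (posP u) => -[u0 ->]; case: (posP (u + k)) => -[uk ->]; rewrite ?expr2.
- by have := sqr_ge0 k; rewrite expr2; lra.
- by nra.
- by have := sqr_ge0 (u + k); rewrite expr2; lra.
- by lra.
Qed.

(** A Taylor bound of order three; the absolute value in the last term also covers the cases where
    [u] and [u + k] differ in sign. *)
Lemma pos_cube u k :
  pos (u + k) ^+ 3 <= pos u ^+ 3 + 3 * pos u ^+ 2 * k + 3 * pos u * k ^+ 2 + `|k| ^+ 3.
Proof.
have k3 : k ^+ 3 <= `|k| ^+ 3 by rewrite -normrX ler_norm.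
have k30 : 0 <= `|k| ^+ 3 by rewrite exprn_ge0.
case: (posP u) => -[u0 ->]; case: (posP (u + k)) => -[uk ->].
- apply: (@le_trans _ _ (u ^+ 3 + 3 * u ^+ 2 * k + 3 * u * k ^+ 2 + k ^+ 3)).
    by rewrite le_eqVlt; apply/orP; left; apply/eqP; ring.
  by rewrite lerD2l.
- have -> : `|k| = - k by rewrite ltr0_norm//; lra.
  have E : u ^+ 3 + 3 * u ^+ 2 * k + 3 * u * k ^+ 2 + (- k) ^+ 3 =
     u * (u ^+ 2 - 3 * u * (- k) + 3 * (- k) ^+ 2) + (- k) ^+ 3 by ring.
  rewrite expr0n/= E addr_ge0//; last by rewrite exprn_ge0//; lra.
  rewrite mulr_ge0//; rewrite !expr2; nra.
- rewrite !expr0n/= !mulr0 !mul0r !add0r; apply: le_trans k3.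
  by rewrite lerXn2r ?nnegrE//; lra.
- by rewrite !expr0n/= !mulr0 !mul0r !add0r.
Qed.

(* A smooth concave cutoff: it increases with slope [cap' z y] on [0, z] and is
   constant beyond z. *)
Definition cap z y : R := z / 2 - pos (z - y) ^+ 2 / (2 * z).
Definition cap' z y : R := pos (z - y) / z.

Lemma cap_incr z y k : 0 < z -> cap' z y * k - k ^+ 2 / (2 * z) <= cap z (y + k) - cap z y.
Proof.
move=> z0; have z2 : 0 < 2 * z by rewrite mulr_gt0.
have := pos_sq_ub (z - y) (- k).
have -> : z - y - k = z - (y + k) by ring.
move=> H; rewrite /cap /cap' -subr_ge0.
have -> : z / 2 - pos (z - (y + k)) ^+ 2 / (2 * z) - (z / 2 - pos (z - y) ^+ 2 / (2 * z))
   - (pos (z - y) / z * k - k ^+ 2 / (2 * z)) =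
   (pos (z - y) ^+ 2 + 2 * pos (z - y) * - k + (- k) ^+ 2 - pos (z - (y + k)) ^+ 2) / (2 * z).
  by field; rewrite gt_eqF.
by rewrite divr_ge0 ?subr_ge0// ltW.
Qed.

Lemma cap_incr_ub z y k : 0 < z -> cap z (y + k) - cap z y <= cap' z y * k.
Proof.
move=> z0; have z2 : 0 < 2 * z by rewrite mulr_gt0.
have := pos_sq_lb (z - y) (- k).
have -> : z - y - k = z - (y + k) by ring.
move=> H; rewrite /cap /cap' -subr_ge0.
have -> : pos (z - y) / z * k - (z / 2 - pos (z - (y + k)) ^+ 2 / (2 * z)
   - (z / 2 - pos (z - y) ^+ 2 / (2 * z))) =
   (pos (z - (y + k)) ^+ 2 - (pos (z - y) ^+ 2 + 2 * pos (z - y) * - k)) / (2 * z).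
  by field; rewrite gt_eqF.
by rewrite divr_ge0 ?subr_ge0// ltW.
Qed.

Lemma cap'_ge0 z y : 0 < z -> 0 <= cap' z y.
Proof. by move=> z0; rewrite divr_ge0 ?pos_ge0// ltW. Qed.

Lemma cap'_le1 z y : 0 < z -> 0 <= y -> cap' z y <= 1.
Proof.
move=> z0 y0; rewrite /cap' ler_pdivrMr// mul1r.
by case: (posP (z - y)) => -[_ ->]; lra.
Qed.

Lemma cap'0 z : 0 < z -> cap' z 0 = 1.
Proof.
by move=> z0; rewrite /cap' subr0; case: (posP z) => -[z1 ->]; [rewrite divff// gt_eqF|lra].
Qed.

(** Idle-on servers and setups disappear at rates proportional to their number; in the drift of
    [cap] such a loss stays bounded by a multiple of [z]. *)
Lemma cap'_mul z y : 0 < z -> 0 <= y -> y * cap' z y <= z.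
Proof.
move=> z0 y0; have c1 := cap'_le1 z0 y0; have c0 := cap'_ge0 y z0.
have [yz|yz] := leP y z; first by nra.
rewrite /cap'; case: (posP (z - y)) => -[zy ->]; first by lra.
by rewrite mul0r mulr0 ltW.
Qed.

Lemma cap'_half z y : 0 < z -> y <= z / 2 -> 2^-1 <= cap' z y.
Proof.
move=> z0 yz; rewrite /cap' ler_pdivlMr//.
by case: (posP (z - y)) => -[zy ->]; lra.
Qed.

Lemma cap_ge0 z y : 0 < z -> 0 <= y -> 0 <= cap z y.
Proof.
move=> z0 y0; rewrite /cap subr_ge0 ler_pdivrMr ?mulr_gt0//.
case: (posP (z - y)) => -[zy ->]; rewrite ?expr2; last by nra.
have -> : z / 2 * (2 * z) = z * z by field.
by nra.
Qed.

Lemma cap_le z y : 0 < z -> cap z y <= z / 2.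
Proof. by move=> z0; rewrite /cap lerBlDr lerDl divr_ge0 ?sqr_ge0// mulr_ge0// ltW. Qed.

End RealBounds.

Section ScaledDrift.
Context (R : realType) (lambda mu nu : R).
Hypotheses (lambda_gt0 : 0 < lambda) (mu_gt0 : 0 < mu) (nu_gt0 : 0 < nu).
Implicit Types (f : R -> R -> R -> R) (n x s i d t : R).

(* The generator in the scaled variables x (busy), s (setup), i (idle-on), for n
   servers; d is the fraction of servers with exactly one task, and b1, b2 say
   whether there are idle-on and idle-off servers. *)
Definition drift f n x s i d (b1 b2 : bool) : R :=
  n * (lambda * ((if b1 then f (x + n^-1) s (i - n^-1)
                  else if b2 then f x (s + n^-1) i else f x s i) - f x s i)
       + d * (f (x - n^-1) s (i + n^-1) - f x s i)
       + mu * i * (f x s (i - n^-1) - f x s i)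
       + nu * s * (f x (s - n^-1) (i + n^-1) - f x s i)).

(** The derivative of a function with gradient [gx], [gs], [gi] along the fluid dynamics, that is,
    the first-order part of [drift]. *)
Definition slope gx gs gi x s i d (b1 b2 : bool) : R :=
  lambda * (if b1 then gx - gi else if b2 then gs else 0)
  + d * (gi - gx) - mu * i * gi + nu * s * (gi - gs).

Definition admissible x s i d (b1 b2 : bool) : Prop :=
  [/\ 0 <= s, 0 <= i, 0 <= d <= x & x + s + i <= 1] /\
  [/\ ~~ b1 -> i = 0 & ~~ b2 -> x + s + i = 1].

Definition total_rate : R := lambda + 1 + mu + nu.

Lemma total_rate_gt0 : 0 < total_rate.
Proof. by rewrite !addr_gt0. Qed.

(** A first-order expansion from below, with error at most [c * t ^+ 2] for steps of size at most
    [t]. It does not require two derivatives, which truncated powers lack. *)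
Definition minorant f gx gs gi c t x s i : Prop :=
  forall dx ds di, `|dx| <= t -> `|ds| <= t -> `|di| <= t ->
    gx * dx + gs * ds + gi * di - c * t ^+ 2 <= f (x + dx) (s + ds) (i + di) - f x s i.

(** Each transition moves the coordinates by at most [1 / n], at total rate at most
    [n * total_rate]; the second-order errors add up to [E * total_rate / n]. *)
Lemma drift_ge f n x s i d (b1 b2 : bool) gx gs gi E :
  0 < n -> admissible x s i d b1 b2 -> 0 <= E ->
  minorant f gx gs gi E n^-1 x s i ->
  slope gx gs gi x s i d b1 b2 - E * total_rate / n <= drift f n x s i d b1 b2.
Proof.
move=> n0 [[s0 i0 /andP[d0 dx1] xsi] _] E0 H.
set t := n^-1 in H *; have t0 : 0 < t by rewrite invr_gt0.
have nt : n * t = 1 by rewrite /t divff// gt_eqF.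
have a0 : `|0 : R| <= t by rewrite normr0 ltW.
have at1 : `|t| <= t by rewrite ger0_norm// ltW.
have at2 : `|- t| <= t by rewrite normrN.
have x1 : x <= 1 by lra.
have d1 : d <= 1 by lra.
have s1 : s <= 1 by lra.
have i1 : i <= 1 by lra.
rewrite /drift -/t.
set A1 := (X in n * (lambda * X + _ + _ + _)); set A2 := (X in n * (_ + d * X + _ + _)).
set A3 := (X in n * (_ + _ + mu * i * X + _)); set A4 := (X in n * (_ + _ + _ + nu * s * X)).
have H1 : (if b1 then gx - gi else if b2 then gs else 0) * t - E * t ^+ 2 <= A1.
  rewrite /A1; case: (b1).
    have := H t 0 (- t) at1 a0 at2; rewrite addr0; lra.
  case: (b2).
    have := H 0 t 0 a0 at1 a0; rewrite !addr0; lra.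
  rewrite subrr mul0r sub0r oppr_le0 mulr_ge0// sqr_ge0//.
have H2 : (gi - gx) * t - E * t ^+ 2 <= A2.
  have := H (- t) 0 t at2 a0 at1; rewrite addr0 /A2; lra.
have H3 : - gi * t - E * t ^+ 2 <= A3.
  have := H 0 0 (- t) a0 a0 at2; rewrite !addr0 /A3; lra.
have H4 : (gi - gs) * t - E * t ^+ 2 <= A4.
  have := H 0 (- t) t a0 at2 at1; rewrite addr0 /A4; lra.
clearbody A1 A2 A3 A4.
have K1 := ler_wpM2l (ltW lambda_gt0) H1.
have K2 := ler_wpM2l d0 H2.
have K3 := ler_wpM2l (mulr_ge0 (ltW mu_gt0) i0) H3.
have K4 := ler_wpM2l (mulr_ge0 (ltW nu_gt0) s0) H4.
have Et : 0 <= E * t ^+ 2 by rewrite mulr_ge0// sqr_ge0.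
have L2 : d * (E * t ^+ 2) <= E * t ^+ 2 by rewrite ler_piMl.
have L3 : mu * i * (E * t ^+ 2) <= mu * (E * t ^+ 2).
  by rewrite ler_wpM2r// ler_piMr// ltW.
have L4 : nu * s * (E * t ^+ 2) <= nu * (E * t ^+ 2).
  by rewrite ler_wpM2r// ler_piMr// ltW.
apply: (@le_trans _ _ (n * (slope gx gs gi x s i d b1 b2 * t - total_rate * (E * t ^+ 2)))).
  rewrite le_eqVlt; apply/orP; left; apply/eqP.
  rewrite -/t mulrBr mulrCA nt mulr1; congr (_ - _).
  by rewrite -[LHS]mulr1 -nt; ring.
rewrite ler_wpM2l ?(ltW n0)// /slope /total_rate.
move: K1 K2 K3 K4; set v := if b1 then _ else _ => K1 K2 K3 K4; clearbody v.
clear H H1 H2 H3 H4; lra.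
Qed.

Lemma driftD f g n x s i d (b1 b2 : bool) :
  drift (fun x s i => f x s i + g x s i) n x s i d b1 b2 =
  drift f n x s i d b1 b2 + drift g n x s i d b1 b2.
Proof. by rewrite /drift; case: b1; case: b2; ring. Qed.

Lemma driftZ k f n x s i d (b1 b2 : bool) :
  drift (fun x s i => k * f x s i) n x s i d b1 b2 = k * drift f n x s i d b1 b2.
Proof. by rewrite /drift; case: b1; case: b2; ring. Qed.

Lemma drift_cst c n x s i d (b1 b2 : bool) :
  drift (fun _ _ _ => c) n x s i d b1 b2 = 0.
Proof. by rewrite /drift; case: b1; case: b2; ring. Qed.

Lemma slopeZ k gx gs gi x s i d (b1 b2 : bool) :
  slope (k * gx) (k * gs) (k * gi) x s i d b1 b2 = k * slope gx gs gi x s i d b1 b2.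
Proof. by rewrite /slope; case: b1; case: b2; ring. Qed.

(** Idle-on and setup servers count as future busy ones, but only up to the cutoffs, where they stop
    mattering. *)
Definition lin a b z1 z2 x s i : R := x + a * cap z1 i + b * cap z2 s.

Definition curvature a b z1 z2 : R := a / (2 * z1) + b / (2 * z2).

Lemma lin_minorant a b z1 z2 t x s i : 0 <= a -> 0 <= b -> 0 < z1 -> 0 < z2 ->
  minorant (lin a b z1 z2) 1 (b * cap' z2 s) (a * cap' z1 i) (curvature a b z1 z2) t x s i.
Proof.
move=> a0 b0 z10 z20 dx ds di _ hs hi.
have H1 := ler_wpM2l a0 (cap_incr i di z10).
have H2 := ler_wpM2l b0 (cap_incr s ds z20).
have sq k : `|k| <= t -> k ^+ 2 <= t ^+ 2.
  by move=> kt; rewrite -real_normK ?num_real// lerXn2r ?nnegrE// (le_trans _ kt).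
have K1 : a * (di ^+ 2 / (2 * z1)) <= a / (2 * z1) * t ^+ 2.
  rewrite -[leRHS]mulrA ler_wpM2l// mulrC ler_wpM2l ?sq//.
  by rewrite invr_ge0 mulr_ge0// ltW.
have K2 : b * (ds ^+ 2 / (2 * z2)) <= b / (2 * z2) * t ^+ 2.
  rewrite -[leRHS]mulrA ler_wpM2l// mulrC ler_wpM2l ?sq//.
  by rewrite invr_ge0 mulr_ge0// ltW.
rewrite /lin /curvature; lra.
Qed.

Lemma cap_lipschitz z (y k t : R) : 0 < z -> 0 <= y -> `|k| <= t -> t <= 1 ->
  `|cap z (y + k) - cap z y| <= (1 + (2 * z)^-1) * t.
Proof.
move=> z0 y0 kt t1; have t0 : 0 <= t by apply: le_trans kt.
have c1 := cap'_le1 z0 y0; have c0 := cap'_ge0 y z0.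
have ck : `|cap' z y * k| <= t.
  rewrite normrM ger0_norm// (le_trans _ kt)// ler_piMl//.
have /ler_normlP[ck1 ck2] := ck.
have z20 : 0 <= (2 * z)^-1 by rewrite invr_ge0 mulr_ge0// ltW.
have kk : k ^+ 2 / (2 * z) <= (2 * z)^-1 * t.
  rewrite mulrC ler_wpM2l// -real_normK ?num_real// expr2.
  by apply: (@le_trans _ _ (`|k| * 1)); [rewrite ler_wpM2l// (le_trans kt)|rewrite mulr1].
have H1 := cap_incr y k z0; have H2 := cap_incr_ub y k z0.
have zt : 0 <= (2 * z)^-1 * t by rewrite mulr_ge0.
by rewrite ler_norml; apply/andP; split; lra.
Qed.

Definition lip_const a b z1 z2 : R :=
  1 + a * (1 + (2 * z1)^-1) + b * (1 + (2 * z2)^-1).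

Lemma lin_lipschitz a b z1 z2 t x s i dx ds di :
  0 <= a -> 0 <= b -> 0 < z1 -> 0 < z2 -> 0 <= s -> 0 <= i -> t <= 1 ->
  `|dx| <= t -> `|ds| <= t -> `|di| <= t ->
  `|lin a b z1 z2 (x + dx) (s + ds) (i + di) - lin a b z1 z2 x s i|
     <= lip_const a b z1 z2 * t.
Proof.
move=> a0 b0 z10 z20 s0 i0 t1 hx hs hi.
have := ler_wpM2l a0 (cap_lipschitz z10 i0 hi t1).
have := ler_wpM2l b0 (cap_lipschitz z20 s0 hs t1).
rewrite -{1}(ger0_norm b0) -{1}(ger0_norm a0) -!normrM.
move/ler_normlP=> [A1 A2] /ler_normlP[B1 B2].
move/ler_normlP: hx => [C1 C2].
by rewrite /lin /lip_const ler_norml; apply/andP; split; lra.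
Qed.

Lemma lip_const_ge0 a b z1 z2 : 0 <= a -> 0 <= b -> 0 < z1 -> 0 < z2 ->
  0 <= lip_const a b z1 z2.
Proof.
move=> a0 b0 z10 z20; rewrite /lip_const !addr_ge0// mulr_ge0// addr_ge0//.
  by rewrite invr_ge0 mulr_ge0// ltW.
by rewrite invr_ge0 mulr_ge0// ltW.
Qed.

Lemma curvature_ge0 a b z1 z2 : 0 <= a -> 0 <= b -> 0 < z1 -> 0 < z2 ->
  0 <= curvature a b z1 z2.
Proof. by move=> *; rewrite addr_ge0// divr_ge0// mulr_ge0// ltW. Qed.

Lemma lin_ge a b z1 z2 x s i : 0 <= a -> 0 <= b -> 0 < z1 -> 0 < z2 ->
  0 <= s -> 0 <= i -> x <= lin a b z1 z2 x s i.
Proof.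
move=> a0 b0 z10 z20 s0 i0; rewrite /lin -addrA lerDl addr_ge0// mulr_ge0//; exact: cap_ge0.
Qed.

(** Every second-order error carries a factor [w], and the rest is of third order in [t]; for the
    square below, the error [L ^+ 2 * t ^+ 2] remains where the positive part vanishes. *)
Lemma cube_minorant (psi : R -> R -> R -> R) th gx gs gi c L t x s i :
  0 <= c -> 0 <= t -> 0 <= L ->
  minorant psi gx gs gi c t x s i ->
  (forall dx ds di, `|dx| <= t -> `|ds| <= t -> `|di| <= t ->
     `|psi (x + dx) (s + ds) (i + di) - psi x s i| <= L * t) ->
  let w := pos (th - psi x s i) in
  minorant (fun x s i => - pos (th - psi x s i) ^+ 3)
    (3 * w ^+ 2 * gx) (3 * w ^+ 2 * gs) (3 * w ^+ 2 * gi)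
    (3 * w ^+ 2 * c + 3 * w * L ^+ 2 + L ^+ 3 * t) t x s i.
Proof.
move=> c0 t0 L0 H1 H2 w dx ds di hx hs hi.
have := H1 _ _ _ hx hs hi; have := H2 _ _ _ hx hs hi.
set D := psi _ _ _ - psi _ _ _ => D1 D2.
have w0 : 0 <= w by exact: pos_ge0.
have := pos_cube (th - psi x s i) (- D).
have -> : th - psi x s i - D = th - psi (x + dx) (s + ds) (i + di) by rewrite /D; ring.
rewrite -/w normrN => K.
have w2 : 0 <= 3 * w ^+ 2 by rewrite mulr_ge0// sqr_ge0.
have M1 := ler_wpM2l w2 D2.
have DL2 : D ^+ 2 <= L ^+ 2 * t ^+ 2.
  by rewrite -real_normK ?num_real// -exprMn lerXn2r ?nnegrE// mulr_ge0.
have M2 : 3 * w * D ^+ 2 <= 3 * w * (L ^+ 2 * t ^+ 2) by rewrite ler_wpM2l// mulr_ge0.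
have M3 : `|D| ^+ 3 <= L ^+ 3 * t ^+ 3.
  by rewrite -exprMn lerXn2r ?nnegrE// mulr_ge0.
move: K; rewrite sqrrN => K; rewrite [t ^+ 3]exprSr in M3; lra.
Qed.

Lemma square_minorant (psi : R -> R -> R -> R) th gx gs gi c L t x s i :
  0 <= c -> 0 <= t -> 0 <= L ->
  minorant psi gx gs gi c t x s i ->
  (forall dx ds di, `|dx| <= t -> `|ds| <= t -> `|di| <= t ->
     `|psi (x + dx) (s + ds) (i + di) - psi x s i| <= L * t) ->
  let p := pos (th - psi x s i) in
  minorant (fun x s i => - pos (th - psi x s i) ^+ 2)
    (2 * p * gx) (2 * p * gs) (2 * p * gi) (2 * p * c + L ^+ 2) t x s i.
Proof.
move=> c0 t0 L0 H1 H2 w dx ds di hx hs hi.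
have := H1 _ _ _ hx hs hi; have := H2 _ _ _ hx hs hi.
set D := psi _ _ _ - psi _ _ _ => D1 D2.
have w0 : 0 <= w by exact: pos_ge0.
have := pos_sq_ub (th - psi x s i) (- D).
have -> : th - psi x s i - D = th - psi (x + dx) (s + ds) (i + di) by rewrite /D; ring.
rewrite -/w sqrrN => K.
have w2 : 0 <= 2 * w by rewrite mulr_ge0.
have M1 := ler_wpM2l w2 D2.
have DL2 : D ^+ 2 <= L ^+ 2 * t ^+ 2.
  by rewrite -real_normK ?num_real// -exprMn lerXn2r ?nnegrE// mulr_ge0.
lra.
Qed.

End ScaledDrift.

(** * Growth while the busy fraction is below lambda *)

Section LowLoad.
Context (R : realType) (lambda mu nu : R).
Hypotheses (lambda_gt0 : 0 < lambda) (lambda_lt1 : lambda < 1).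
Hypotheses (mu_gt0 : 0 < mu) (nu_gt0 : 0 < nu).
Implicit Types (n x s i d eps k : R).

Local Notation drift := (drift lambda mu nu).
Local Notation slope := (slope lambda mu nu).

(* While the busy fraction is below lambda, either idle-on servers are present
   and the busy fraction grows, or servers in setup are created or finish. *)
Lemma low_load_slope eps k x s i d (b1 b2 : bool) :
  0 < eps < lambda -> 0 < k -> k <= 9^-1 -> k <= eps / (8 * 16) ->
  k <= nu * (1 - lambda) / (8 * 8) ->
  admissible x s i d b1 b2 -> x <= lambda - eps ->
  eps * k / 2 <= slope 1 (4 * k * cap' (8 * lambda * k / nu) s)
    ((1 - k) * cap' (eps * k / (4 * mu)) i) x s i d b1 b2.
Proof.
move: (lambda_gt0) (lambda_lt1) (mu_gt0) (nu_gt0) => l0 l1 m0 v0.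
move=> /andP[e0 el] k0 k1 k2 k3 [[s0 i0 /andP[d0 dx] xsi] [hb1 hb2]] xl.
(* The cutoffs limit the losses: turning servers off costs at most [mu * z1 = eps * k / 4], and
   completing setups at most [4 * k * (nu * z2)], which the bound on [k] by [eps] makes at most
   [eps * k / 4] as well. *)
set z2 := 8 * lambda * k / nu; set z1 := eps * k / (4 * mu).
have z20 : 0 < z2 by rewrite divr_gt0// !mulr_gt0.
have z10 : 0 < z1 by rewrite divr_gt0 ?mulr_gt0.
have nz2 : nu * z2 = 8 * lambda * k by rewrite /z2; field; rewrite gt_eqF.
have mz1 : mu * z1 = eps * k / 4 by rewrite /z1; field; rewrite gt_eqF.
have e1 : eps <= 1 by lra.
have ek0 : 0 < eps * k by rewrite mulr_gt0.
have lk0 : eps * k <= lambda * k by rewrite ler_wpM2r// ltW.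
have cs0 := cap'_ge0 s z20; have cs1 := cap'_le1 z20 s0.
have ci0 := cap'_ge0 i z10; have ci1 := cap'_le1 z10 i0.
have scs := cap'_mul z20 s0; have ici := cap'_mul z10 i0.
have h2 : s <= z2 / 2 -> 2^-1 <= cap' z2 s by exact: cap'_half.
have hi : i = 0 -> cap' z1 i = 1 by move=> ->; exact: cap'0.
move: cs0 cs1 ci0 ci1 scs ici h2 hi; rewrite /slope.
set cs := cap' _ _; set ci := cap' _ _ => cs0 cs1 ci0 ci1 scs ici h2 hi.
clearbody cs ci z1 z2.
have ns0 : 0 <= nu * s by rewrite mulr_ge0// ltW.
(* With idle-on servers present, arrivals and departures together gain
   [(lambda - d) * (1 - (1 - k) * ci)], at least [eps * k], twice the losses. *)
case: b1 hb1 => [_|/(_ isT) iE].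
  clear h2 hi hb2 k3 xsi z20 z10 lk0 cs1 cs0.
  have gi0 : 0 <= (1 - k) * ci by rewrite mulr_ge0//; lra.
  have gi1 : (1 - k) * ci <= 1 - k by rewrite ler_piMr//; lra.
  have A1 : eps * k <= (lambda - d) * (1 - (1 - k) * ci).
    by apply: ler_pM; lra.
  have A2 : mu * i * ((1 - k) * ci) <= eps * k / 4.
    rewrite -mz1 -mulrA ler_wpM2l ?(ltW mu_gt0)//.
    apply: le_trans ici; rewrite ler_wpM2l// ler_piMl//; lra.
  have A3 : nu * s * (4 * k * cs) <= eps * k / 4.
    have -> : nu * s * (4 * k * cs) = 4 * k * (nu * (s * cs)) by ring.
    have B : nu * (s * cs) <= 8 * lambda * k by rewrite -nz2 ler_wpM2l// ltW.
    have B' : 8 * lambda * k <= 8 * (eps / (8 * 16)).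
      have : lambda * k <= 1 * (eps / (8 * 16)) by apply: ler_pM => //; lra.
      lra.
    apply: (@le_trans _ _ (4 * k * (8 * (eps / (8 * 16))))); last by lra.
    by rewrite ler_wpM2l ?(le_trans B)// mulr_ge0// ltW.
  have A4 : 0 <= nu * s * ((1 - k) * ci) by rewrite mulr_ge0.
  lra.
clear ici ci0 ci1 z10 mz1.
rewrite (hi iE) iE !mulr1 !mulr0 !mul0r !subr0.
have gs0 : 0 <= 4 * k * cs by rewrite mulr_ge0// mulr_ge0// ltW.
have gs1 : 4 * k * cs <= 4 * k by rewrite ler_piMr// mulr_ge0// ltW.
have dk : d * k <= lambda * k by rewrite ler_wpM2r ?(ltW k0)//; lra.
(* In the blocked case departures lose only [d * k], as a freed server still counts [1 - k]. Against
   this, [2 * lambda * k] is gained either from setups in progress, if [s] exceeds half its cutoff,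
   or else from a setup about to start. *)
have big : z2 / 2 <= s -> 2 * lambda * k <= nu * s * (1 - k - 4 * k * cs).
  move=> zs; have : 4 * lambda * k <= nu * s.
    have : nu * (z2 / 2) <= nu * s by rewrite ler_wpM2l// ltW.
    by lra.
  move=> H; have : nu * s * 2^-1 <= nu * s * (1 - k - 4 * k * cs) by rewrite ler_wpM2l//; lra.
  by lra.
have pos' : 0 <= nu * s * (1 - k - 4 * k * cs) by rewrite mulr_ge0//; lra.
have /orP[sz|/big zs] := le_total s (z2 / 2); last first.
  have : 0 <= lambda * (if b2 then 4 * k * cs else 0).
    by apply: mulr_ge0; [exact: ltW|case: b2 hb2].
  move: (lambda * _) => v hv; lra.
case: b2 hb2 => /= [_|/(_ isT) E].
  have : lambda * (4 * k * 2^-1) <= lambda * (4 * k * cs).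
    by rewrite ler_wpM2l ?(ltW lambda_gt0)// ler_wpM2l ?h2// mulr_ge0// ltW.
  lra.
(* With neither idle-on nor idle-off servers, all servers that are not busy are in setup, so [s] is
   not small. *)
have : z2 / 2 <= s.
  have : nu * (z2 / 2) <= nu * s.
    have -> : s = 1 - x by rewrite iE in E; lra.
    have _L : nu * (1 - lambda) <= nu * (1 - x) by rewrite ler_wpM2l ?(ltW nu_gt0)//; lra.
    have : lambda * k <= 1 * k by rewrite ler_wpM2r ?ltW.
    lra.
  by rewrite ler_pM2l.
move/big; lra.
Qed.

Definition deficit eps k x s i : R :=
  pos (lambda - eps - lin (1 - k) (4 * k) (eps * k / (4 * mu)) (8 * lambda * k / nu) x s i).

(** The inequality is kept quadratic in the deficit, with an error linear in it, so that it can be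
    scaled by [n] or by a constant. *)
Lemma deficit_drift eps : 0 < eps < lambda ->
  exists k c0 C : R, [/\ 0 < c0, 0 <= C,
   (forall x s i, 0 <= x -> 0 <= s -> 0 <= i -> 0 <= deficit eps k x s i <= 1),
   (forall x s i, x <= lambda - 2 * eps -> eps / 2 <= deficit eps k x s i) &
   (forall n x s i d b1 b2, 1 <= n -> admissible x s i d b1 b2 -> 0 <= x ->
     c0 * deficit eps k x s i ^+ 2 - C * deficit eps k x s i / n - C / n ^+ 2
      <= drift (fun x s i => - deficit eps k x s i ^+ 3) n x s i d b1 b2)].
Proof.
move: (lambda_gt0) (lambda_lt1) (mu_gt0) (nu_gt0) => l0 l1 m0 v0.
move=> heps; have /andP[e0 el] := heps.
(* The first three bounds are those of [low_load_slope]; [mu] and [nu / (8 * 16)], with the bound by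
   [eps], make both cutoff terms of [lin] at most [eps / 8], so the deficit stays comparable with
   [lambda - eps - x]. *)
pose k := Num.min (Num.min 9^-1 (eps / (8 * 16))) (Num.min (nu * (1 - lambda) / (8 * 8))
   (Num.min mu (nu / (8 * 16)))).
have l10 : 0 < 1 - lambda by lra.
have k0 : 0 < k by rewrite /k !lt_min ?invr_gt0 ?divr_gt0 ?mulr_gt0 ?ltr0n ?m0.
have [k1 k2 [k3 k4 k5]] : [/\ k <= 9^-1, k <= eps / (8 * 16) & [/\ k <= nu * (1 - lambda) / (8 * 8),
   k <= mu & k <= nu / (8 * 16)]].
  by rewrite /k !ge_min !lexx !orbT.
clearbody k.
set z2 := 8 * lambda * k / nu; set z1 := eps * k / (4 * mu).
have z20 : 0 < z2 by rewrite divr_gt0// !mulr_gt0.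
have z10 : 0 < z1 by rewrite divr_gt0 ?mulr_gt0.
have a0 : 0 <= 1 - k by lra.
have b0 : 0 <= 4 * k by lra.
set c := curvature (1 - k) (4 * k) z1 z2; set L := lip_const (1 - k) (4 * k) z1 z2.
have c0 : 0 <= c by exact: curvature_ge0.
have L0 : 0 <= L by exact: lip_const_ge0.
pose T := total_rate lambda mu nu; have T0 : 0 < T by rewrite total_rate_gt0.
exists k, (3 * (eps * k / 2)), (T * (3 * c + 3 * L ^+ 2 + L ^+ 3)).
have lxx : forall x s i, 0 <= s -> 0 <= i -> x <= lin (1 - k) (4 * k) z1 z2 x s i.
  by move=> x s i s0 i0; exact: lin_ge.
have w01 x s i : 0 <= x -> 0 <= s -> 0 <= i -> 0 <= deficit eps k x s i <= 1.
  move=> x0 s0 i0; rewrite pos_ge0/= /deficit -/z1 -/z2.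
  by have := lxx x s i s0 i0; case: (posP (lambda - eps - lin (1 - k) (4 * k) z1 z2 x s i)) => -[_ ->]; lra.
split => //.
- by rewrite !mulr_gt0// invr_gt0.
- by rewrite mulr_ge0 ?(ltW T0)// !addr_ge0// ?mulr_ge0// ?exprn_ge0.
- move=> x s i xl; apply: le_trans (pos_ge _).
  have H1 := cap_le i z10; have H2 := cap_le s z20.
  have H1' : (1 - k) * cap z1 i <= eps / 8.
    apply: (@le_trans _ _ ((1 - k) * (z1 / 2))); first by rewrite ler_wpM2l.
    have z1e : z1 <= eps / 4.
      rewrite /z1 ler_pdivrMr ?mulr_gt0//.
      have : eps * k <= eps * mu by rewrite ler_wpM2l// ltW.
      by lra.
    have : 0 <= k * z1 by rewrite mulr_ge0// ltW.
    by lra.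
  have H2' : 4 * k * cap z2 s <= eps / 8.
    apply: (@le_trans _ _ (4 * k * (z2 / 2))); first by rewrite ler_wpM2l.
    have z21 : z2 <= 16^-1.
      rewrite /z2 ler_pdivrMr//.
      have : lambda * k <= 1 * k by rewrite ler_wpM2r// ltW.
      by lra.
    have : 4 * k * (z2 / 2) <= 4 * k * (16^-1 / 2) by rewrite ler_wpM2l// ler_wpM2r.
    by lra.
  by rewrite /lin -/z1 -/z2; lra.
move=> n x s i d b1 b2 n1 adm x0.
have [[s0 i0 _ xsi] _] := adm.
have n0 : 0 < n by lra.
have t0 : 0 <= n^-1 by rewrite invr_ge0 ltW.
have t1 : n^-1 <= 1 by rewrite invf_le1.
have H1 := @lin_minorant _ _ _ _ _ n^-1 x s i a0 b0 z10 z20.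
have H2 dx ds di h1 h2 h3 := @lin_lipschitz _ _ _ _ _ _ x s i dx ds di a0 b0 z10 z20 s0 i0 t1 h1 h2 h3.
have := cube_minorant (lambda - eps) c0 t0 L0 H1 H2.
rewrite -/c -/L.
set w := pos _ => /= H3.
have w0 : 0 <= w by exact: pos_ge0.
have w1 : w <= 1 by have /andP[] := w01 x s i x0 s0 i0.
set E := 3 * w ^+ 2 * c + _ + _ in H3.
have E0 : 0 <= E by rewrite /E !addr_ge0// ?mulr_ge0// ?exprn_ge0// ?mulr_ge0.
have := drift_ge lambda_gt0 mu_gt0 nu_gt0 n0 adm E0 H3.
rewrite slopeZ -/T => H4; rewrite /deficit -/z1 -/z2 -/w.
apply: le_trans H4; set sl := (X in _ <= _ * X - _).
(* Where the slope is not controlled, [x] exceeds [lambda - eps] and the deficit is 0, because [lin]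
   is at least [x]. *)
have S : eps * k / 2 * w ^+ 2 <= w ^+ 2 * sl.
  have [xe|xe] := leP x (lambda - eps).
    by rewrite mulrC ler_wpM2l ?sqr_ge0//; exact: low_load_slope.
  suff -> : w = 0 by rewrite expr0n/= mulr0 mul0r.
  rewrite /w; case: (posP (lambda - eps - lin (1 - k) (4 * k) z1 z2 x s i)) => -[h ->]//.
  by have := lxx x s i s0 i0; lra.
clear H1 H2 w01 lxx k1 k2 k3 k4 k5 xsi s0 i0 e0 el heps z20 z10 a0 b0 l10.
have S2 : E * T / n <= T * (3 * c + 3 * L ^+ 2 + L ^+ 3) * w / n +
    T * (3 * c + 3 * L ^+ 2 + L ^+ 3) / n ^+ 2.
  have F1 : E <= (3 * c + 3 * L ^+ 2 + L ^+ 3) * (w + n^-1).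
    rewrite /E; have w2w : w ^+ 2 <= w by rewrite expr2 ler_piMl.
    have P1 : w ^+ 2 * c <= w * c by rewrite ler_wpM2r.
    have P2 : 0 <= L ^+ 3 * w by rewrite mulr_ge0// exprn_ge0.
    have P3 : 0 <= (3 * c + 3 * L ^+ 2) * n^-1 by rewrite mulr_ge0// addr_ge0// mulr_ge0// sqr_ge0.
    by lra.
  have F2 := ler_wpM2r (mulr_ge0 (ltW T0) t0) F1.
  rewrite -[in leRHS]exprVn; move: F2; rewrite expr2 [leLHS]mulrA; lra.
lra.
Qed.

End LowLoad.

(** * The bounded correction compensating congestion *)

Section Control.
Context (R : realType) (lambda mu nu : R).
Hypotheses (lambda_gt0 : 0 < lambda) (lambda_lt1 : lambda < 1).
Hypotheses (mu_gt0 : 0 < mu) (nu_gt0 : 0 < nu).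
Implicit Types (n x s i d e eps k : R).

Local Notation drift := (drift lambda mu nu).
Local Notation slope := (slope lambda mu nu).

(** The constants satisfy [K e * (lambda * e) = 32], [B * lambda = 8] and [B * nu * z e = e]: the
    gains of a blocked state exceed its congestion, and the end of setups costs at most [e] in the
    second term of [height]. *)
Let K e : R := 4 * 8 / (lambda * e).
Let B : R := 8 / lambda.
Let z e : R := e * lambda / (8 * nu).
Let gap e x s i : R := pos (lambda + 8 * e - lin 1 0 (e / mu) 1 x s i).

(** The first term grows when setups end, since departures do not change [x + i] while [i = 0]; the
    second grows when they start. The offset [8 * e] in [gap] keeps the first term active up to
    [x = lambda + 4 * e], where congestion is already below 1. *)
Definition height e x s i : R := K e / 2 * - gap e x s i ^+ 2 + B * cap (z e) s.

Let height_slope e x s i d b1 b2 : R :=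
  K e / 2 * (2 * gap e x s i * slope 1 (0 * cap' 1 s) (1 * cap' (e / mu) i) x s i d b1 b2)
  + B * slope 0 (cap' (z e) s) 0 x s i d b1 b2.

Let small e : Prop :=
  [/\ 0 < e, 8 * (8 * (9 * (9 * e))) <= lambda, 4 * (4 * e) <= 1 - lambda & e <= nu * (1 - lambda)].

Lemma gap_le2 e x s i : small e -> 0 <= x -> 0 <= s -> 0 <= i -> gap e x s i <= 2.
Proof.
move: (lambda_gt0) (lambda_lt1) => l0 l1 [e0 e1 _ _] x0 s0 i0.
have lx : x <= lin 1 0 (e / mu) 1 x s i by apply: lin_ge => //; rewrite divr_gt0.
rewrite /gap ge_max ler0n andbT; lra.
Qed.

Lemma ratio_near e x : 0 < lambda -> lambda <= 1 -> 0 < e -> e <= 1 ->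
  lambda - lambda * e / 2 <= x -> lambda / x <= 1 + e.
Proof.
move=> l0 l1 e0 e1 xl.
have le : lambda * e <= lambda * 1 by rewrite ler_wpM2l// ltW.
have xp : 0 < x by lra.
rewrite ler_pdivrMr//; have : (1 + e) * (lambda - lambda * e / 2) <= (1 + e) * x.
  by rewrite ler_wpM2l//; lra.
have : lambda * e * e <= lambda * e * 1 by rewrite ler_wpM2l// mulr_ge0// ltW.
lra.
Qed.

Lemma ratio_far e x : 0 < lambda -> x <= 1 -> 0 < e ->
  lambda + 4 * e <= x -> lambda / x <= 1 - 4 * e.
Proof.
move=> l0 x1 e0 xl; have xp : 0 < x by lra.
rewrite ler_pdivrMr//; have : e * x <= e * 1 by rewrite ler_wpM2l// ltW.
lra.
Qed.

(** The first bound is crude and holds everywhere, for use where the deficit dominates; the second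
    matters from slightly below [lambda] upwards. *)
Lemma height_slope_ge e x s i d b1 b2 : small e -> 0 <= x ->
  admissible x s i d b1 b2 ->
  - (4 * K e + 1) <= height_slope e x s i d b1 b2 /\
  (lambda - lambda * e / 2 <= x ->
    (if b1 then 0 else lambda / x) - 1 + 3 * e <= height_slope e x s i d b1 b2).
Proof.
move: (lambda_gt0) (lambda_lt1) (mu_gt0) (nu_gt0) => l0 l1 m0 v0.
move=> [e0 e1 e2 e3] x0 [[s0 i0 /andP[d0 dx] xsi] [hb1 hb2]].
have z0 : 0 < z e by rewrite /z divr_gt0 ?mulr_gt0.
have z10 : 0 < e / mu by rewrite divr_gt0.
have K0 : 0 < K e by rewrite /K divr_gt0 ?mulr_gt0.
have Kle : K e * (lambda * e) = 4 * 8 by rewrite /K; field; rewrite !gt_eqF.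
have B0 : 0 < B by rewrite /B divr_gt0.
have Bl : B * lambda = 8 by rewrite /B; field; rewrite gt_eqF.
have nz : nu * z e = e * lambda / 8 by rewrite /z; field; rewrite gt_eqF.
have mz1 : mu * (e / mu) = e by field; rewrite gt_eqF.
have cs0 := cap'_ge0 s z0; have cs1 := cap'_le1 z0 s0.
have ci0 := cap'_ge0 i z10; have ci1 := cap'_le1 z10 i0.
have scs := cap'_mul z0 s0; have ici := cap'_mul z10 i0.
have h2 : s <= z e / 2 -> 2^-1 <= cap' (z e) s by exact: cap'_half.
have hi : i = 0 -> cap' (e / mu) i = 1 by move=> ->; exact: cap'0.
have hm : i = 0 -> lin 1 0 (e / mu) 1 x s i = x.
  move=> ->; rewrite /lin /cap subr0 mul0r addr0 mul1r.
  by case: (posP (e / mu)) => -[h ->]; [field; rewrite !gt_eqF|lra].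
have lx : x <= lin 1 0 (e / mu) 1 x s i by apply: lin_ge.
have p0 : 0 <= gap e x s i by exact: pos_ge0.
have hp : gap e x s i = 0 \/ gap e x s i = lambda + 8 * e - lin 1 0 (e / mu) 1 x s i.
  by rewrite /gap; case: (posP (lambda + 8 * e - lin 1 0 (e / mu) 1 x s i)) => -[_ ->]; [right|left].
have pge : lambda + 8 * e - lin 1 0 (e / mu) 1 x s i <= gap e x s i by exact: pos_ge.
have le0 : 0 < lambda * e by rewrite mulr_gt0.
have Ke : K e * (9 * e * (9 * e)) <= 2^-1.
  have : K e * (lambda * e) * (9 * (9 * e)) <= 4 * 8 * (lambda / (8 * 8)).
    by rewrite Kle ler_wpM2l// ler_pdivlMr// mulrC -mulrA.
  have -> : K e * (lambda * e) * (9 * (9 * e)) = K e * (9 * e * (9 * e)) * lambda by ring.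
  have -> : 4 * 8 * (lambda / (8 * 8)) = 2^-1 * lambda by field.
  by rewrite ler_pM2r.
have e9 : e <= 9^-1 by lra.
have eL : e <= 1 by lra.
have x1 : x <= 1 by lra.
clear e1.
have rx := @ratio_near e x l0 (ltW l1) e0 eL.
have rx' := @ratio_far e x l0 x1 e0.
rewrite /height_slope /slope; move: cs0 cs1 ci0 ci1 scs ici h2 hi hm lx p0 hp pge.
set cs := cap' (z e) s; set ci := cap' _ _; set m := lin _ _ _ _ _ _ _; set p := gap _ _ _ _.
move=> cs0 cs1 ci0 ci1 scs ici h2 hi hm lx p0 hp pge.
move: z0 z10 K0 Kle B0 Bl nz mz1 Ke rx rx' scs ici h2; clearbody cs ci m p.
move: (K e) B (z e) (e / mu) (lambda / x) => k b y y1 r.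
move=> z0 z10 K0 Kle B0 Bl nz mz1 Ke rx rx' scs ici h2.
rewrite !mul0r !mul1r !mulr0 !subr0 !sub0r.
have ns0 : 0 <= nu * s by rewrite mulr_ge0// ltW.
have Bns : b * (nu * s * cs) <= e.
  have -> : nu * s * cs = nu * (s * cs) by ring.
  apply: (@le_trans _ _ (b * (nu * y))); last first.
    by rewrite nz; have : b * lambda * e = 8 * e by [rewrite Bl]; lra.
  by rewrite ler_wpM2l ?(ltW B0)// ler_wpM2l// ltW.
case: b1 hb1 => [_|/(_ isT) iE].
  clear rx rx' e2 e3 Bl nz Kle hm h2 hi hb2 scs cs0 cs1 z0 z10 B0 pge xsi s0 i0 d0.
  (* With an idle-on server there is no congestion, and it suffices that the losses stay below
     [1 - 3 * e]: near [lambda] they are at most [K e * (9 * e) ^+ 2 + e], and the first part is at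
     most [1 / 2] by [Ke]. *)
  have Mlow : 0 <= p -> m <= lambda + 8 * e ->
      - (9 * e) <= lambda * (1 - ci) + d * (ci - 1) - mu * i * ci + nu * s * ci.
    move=> _ mle.
    have D1 : (d - lambda) * (1 - ci) <= 8 * e.
      apply: (@le_trans _ _ (8 * e * (1 - ci))); first by rewrite ler_wpM2r; lra.
      by rewrite ler_piMr; lra.
    have D2 : mu * i * ci <= e by rewrite -mz1 -mulrA ler_wpM2l ?(ltW m0).
    have D3 : 0 <= nu * s * ci by rewrite mulr_ge0.
    by lra.
  set M := lambda * (1 - ci) + _ - _ + _ in Mlow *.
  clearbody M; clear mz1 ici ns0 v0 m0 ci0 ci1.
  have -> : k / 2 * (2 * p * M) + b * (lambda * 0 + d * 0 + nu * s * - cs) =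
     k * (p * M) - b * (nu * s * cs) by field.
  have pM q : p <= q -> 0 <= q -> - (q * (9 * e)) <= p * M.
    move=> pq q0; case: hp => [->|pE]; first by rewrite mul0r oppr_le0 mulr_ge0//; lra.
    have H := Mlow p0.
    have {}H : - (9 * e) <= M by apply: H; lra.
    apply: (@le_trans _ _ (- (p * (9 * e)))); first by rewrite lerN2 ler_wpM2r//; lra.
    by rewrite -mulrN ler_wpM2l.
  split.
    have p2 : p <= 2 by case: hp => ->; lra.
    have := ler_wpM2l (ltW K0) (pM _ p2 (ler0n _ 2)).
    have : k * e <= k * 9^-1 by rewrite ler_wpM2l ?(ltW K0)//; lra.
    lra.
  move=> xl; have le1 : lambda * e <= 1 * e by rewrite ler_wpM2r; lra.
  have p9 : p <= 9 * e by case: hp => ->; lra.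
  have := ler_wpM2l (ltW K0) (pM _ p9 (mulr_ge0 (ler0n _ 9) (ltW e0))).
  lra.
clear hp lx d0 dx Ke e9 ci0 ci1 scs ici z10 mz1.
rewrite (hi iE) iE !mulr0 !mul0r subrr !mulr0 !addr0 !subr0 !mulr1.
move: (hm iE) => {hm hi} mE; subst m.
have -> : (if b2 then 0 else 0) = 0 :> R by case: (b2).
rewrite mulr0 !add0r.
set t := lambda * (if b2 then cs else 0).
have t0 : 0 <= t by rewrite /t mulr_ge0 ?(ltW l0)//; case: (b2).
have -> : k / 2 * (2 * p * (nu * s)) + b * (t + nu * s * - cs) =
   k * p * (nu * s) + b * t - b * (nu * s * cs) by field.
have Kp : 0 <= k * p * (nu * s) by rewrite mulr_ge0// mulr_ge0// ltW.
have Bt : 0 <= b * t by rewrite mulr_ge0// ltW.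
split; first by clear xsi s0 i0 e2 rx Kle z0 B0 Bl nz cs0 cs1 pge; lra.
move=> xl; have /orP[x4|/rx' x4] := le_total x (lambda + 4 * e); last first.
  by clear xsi s0 i0 e2 e3 Kle z0 B0 Bl nz cs0 cs1 pge rx p0 ns0 x0 t0 K0 xl; lra.
have {}rx := rx xl.
suff : 5 * e <= k * p * (nu * s) + b * t.
  by clear xsi s0 i0 e2 e3 Kle z0 B0 Bl nz cs0 cs1 pge p0 ns0 x0 t0 K0 xl rx' Kp Bt; lra.
clear rx rx' Bns cs0 cs1.
have p4 : 4 * e <= p by lra.
(* With [s] at least [y / 2], setups in progress gain [8 * e]; otherwise some server is idle-off and
   the setup about to start gains [b * lambda / 2 = 4]. *)
have /orP[sz|sz] := le_total s (y / 2); last first.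
  have : k * (4 * e) * (nu * (y / 2)) <= k * p * (nu * s).
    apply: ler_pM.
    - by rewrite !mulr_ge0// ltW.
    - by rewrite mulr_ge0 ?divr_ge0// ltW.
    - by rewrite ler_wpM2l// ltW.
    - by rewrite ler_wpM2l// ltW.
  have -> : k * (4 * e) * (nu * (y / 2)) = k * (e * (nu * y)) * 2 by field.
  have -> : k * (e * (nu * y)) * 2 = k * (lambda * e) * e / 4 by rewrite nz; field.
  by rewrite Kle; lra.
case: b2 hb2 @t t0 Bt => [_ t t0 Bt|/(_ isT) E].
  have : b * (lambda * 2^-1) <= b * t.
    by rewrite ler_wpM2l ?(ltW B0)// ler_wpM2l ?(ltW l0)// h2.
  by rewrite mulrA Bl; lra.
have : nu * (y / 2) < nu * s.
  have -> : s = 1 - x by rewrite iE in E; lra.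
  have : nu * (3 / 4 * (1 - lambda)) <= nu * (1 - x) by rewrite ler_wpM2l ?(ltW v0)//; lra.
  have : e * lambda <= e * 1 by rewrite ler_wpM2l//; lra.
  by lra.
by rewrite ltr_pM2l// ltNge sz.
Qed.

Lemma height_drift e : small e -> exists2 C : R, 0 <= C &
  forall n x s i d b1 b2, 1 <= n -> admissible x s i d b1 b2 -> 0 <= x ->
  height_slope e x s i d b1 b2 - C / n <= drift (height e) n x s i d b1 b2.
Proof.
move: (lambda_gt0) (lambda_lt1) (mu_gt0) (nu_gt0) => l0 l1 m0 v0.
move=> sm; have [e0 e1 e2 e3] := sm.
have z0 : 0 < z e by rewrite /z divr_gt0 ?mulr_gt0.
have z10 : 0 < e / mu by rewrite divr_gt0.
have K0 : 0 < K e by rewrite /K divr_gt0 ?mulr_gt0.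
have B0 : 0 < B by rewrite /B divr_gt0.
set c := curvature 1 0 (e / mu) 1; set L := lip_const 1 0 (e / mu) 1.
have c0 : 0 <= c by apply: curvature_ge0.
have L0 : 0 <= L by apply: lip_const_ge0.
pose T := total_rate lambda mu nu; have T0 : 0 < T by rewrite total_rate_gt0.
have y0 : 0 <= (2 * z e)^-1 by rewrite invr_ge0 mulr_ge0// ltW.
exists (K e / 2 * ((4 * c + L ^+ 2) * T) + B * ((2 * z e)^-1 * T)).
  have P : 0 <= (4 * c + L ^+ 2) * T.
    by rewrite mulr_ge0 ?(ltW T0)// addr_ge0 ?sqr_ge0// mulr_ge0.
  have P' : 0 <= K e / 2 by rewrite divr_ge0// ltW.
  by apply: addr_ge0; apply: mulr_ge0 => //; [exact: ltW|apply: mulr_ge0 => //; exact: ltW].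
move=> n x s i d b1 b2 n1 adm x0.
have [[s0 i0 _ xsi] _] := adm.
have n0 : 0 < n by lra.
have t0 : 0 <= n^-1 by rewrite invr_ge0 ltW.
have t1 : n^-1 <= 1 by rewrite invf_le1.
rewrite /height driftD !driftZ /height_slope.
have H1 := @lin_minorant _ 1 0 (e / mu) 1 n^-1 x s i ler01 (lexx 0) z10 ltr01.
have H2 dx ds di h1 h2 h3 := @lin_lipschitz _ 1 0 (e / mu) 1 _ x s i dx ds di ler01 (lexx 0) z10 ltr01 s0 i0 t1 h1 h2 h3.
have := square_minorant (lambda + 8 * e) c0 t0 L0 H1 H2.
rewrite -/c -/L -/(gap e x s i) => /= H3.
have g2 : gap e x s i <= 2 by exact: gap_le2.
have E0 : 0 <= 2 * gap e x s i * c + L ^+ 2 by rewrite addr_ge0 ?sqr_ge0// !mulr_ge0// pos_ge0.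
have := drift_ge l0 m0 v0 n0 adm E0 H3.
have H5 : minorant (fun _ s _ => cap (z e) s) 0 (cap' (z e) s) 0 (2 * z e)^-1 n^-1 x s i.
  move=> dx ds di _ hs _; rewrite !mul0r add0r addr0.
  apply: le_trans (cap_incr s ds z0); rewrite lerD2l lerN2 mulrC ler_wpM2l//.
  by rewrite -real_normK ?num_real// lerXn2r ?nnegrE// (le_trans _ hs).
have := drift_ge l0 m0 v0 n0 adm y0 H5.
rewrite slopeZ -/T.
set S1 := slope _ _ _ _ _ _ _ _ _; set S2 := slope _ _ _ _ _ _ _ _ _.
set D1 := drift _ _ _ _ _ _ _ _; set D2 := drift _ _ _ _ _ _ _ _ => F1 F2.
have G1 := ler_wpM2l (ltW B0) F1.
have K20 : 0 <= K e / 2 by rewrite divr_ge0// ltW.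
have G2 := ler_wpM2l K20 F2.
have G3 : (2 * gap e x s i * c + L ^+ 2) * T / n <= (4 * c + L ^+ 2) * T / n.
  rewrite ler_wpM2r// ler_wpM2r ?(ltW T0)// lerD2r ler_wpM2r//; lra.
have G4 := ler_wpM2l K20 G3.
lra.
Qed.

(* The margin [e] is uniform in the number of servers, but the bound [G] on the
   correction is not. *)
Lemma control : exists2 e : R, 0 < e & exists n0 : R, forall n : R, n0 <= n ->
  exists2 G : R, 0 <= G & exists g : R -> R -> R -> R,
   (forall x s i, 0 <= x -> 0 <= s -> 0 <= i -> 0 <= g x s i <= G) /\
   (forall x s i d b1 b2, n^-1 <= x -> admissible x s i d b1 b2 ->
     drift g n x s i d b1 b2 <= 1 - e - (if b1 then 0 else lambda / x)).
Proof.
move: (lambda_gt0) (lambda_lt1) (mu_gt0) (nu_gt0) => l0 l1 m0 v0.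
have l10 : 0 < 1 - lambda by lra.
pose e := Num.min (lambda / (8 * 8 * (9 * 9))) (Num.min ((1 - lambda) / (4 * 4)) (nu * (1 - lambda))).
have e0 : 0 < e by rewrite /e !lt_min ?divr_gt0 ?mulr_gt0.
have [h1 h2 h3] : [/\ e <= lambda / (8 * 8 * (9 * 9)), e <= (1 - lambda) / (4 * 4) &
    e <= nu * (1 - lambda)] by rewrite /e !ge_min !lexx ?orbT.
have sm : small e.
  split => //.
    by move: h1; rewrite ler_pdivlMr ?mulr_gt0// mulrC !mulrA.
  by move: h2; rewrite ler_pdivlMr ?mulr_gt0// mulrC !mulrA.
have [_ e1 e2 e3] := sm.
clearbody e; exists e => //.
(* Then [lambda - 2 * eps] is exactly the threshold [lambda - lambda * e / 2] of
   [height_slope_ge]. *)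
pose eps := lambda * e / 4.
have he : 0 < eps < lambda.
  rewrite /eps; apply/andP; split; first by rewrite divr_gt0// mulr_gt0.
  by have : lambda * e <= lambda * 1 by [rewrite ler_wpM2l; lra]; lra.
have /andP[eps0 _] := he.
have [k [c0 [C [c00 C0 w01 wlow wdrift]]]] := deficit_drift l0 l1 m0 v0 he.
have [C2 C20 hdrift] := height_drift sm.
have K0 : 0 < K e by rewrite /K divr_gt0 ?mulr_gt0.
have B0 : 0 < B by rewrite /B divr_gt0.
have z0 : 0 < z e by rewrite /z divr_gt0 ?mulr_gt0.
(* As [x] is at least [1 / n], congestion is at most [lambda * n]; with this [A] the main cube term
   contributes at least [(lambda + 1) * n] wherever [x <= lambda - 2 * eps]. *)
pose A := (lambda + 1) * 4 / (c0 * eps ^+ 2).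
have A0 : 0 < A by rewrite /A divr_gt0 ?mulr_gt0 ?exprn_gt0//; lra.
(* Near [lambda] the total error is [C3 / n], where [C ^+ 2 / (4 * c0)] comes from completing the
   square in the deficit; large [n] makes it at most [2 * e]. *)
pose C3 := A * (C ^+ 2 / (4 * c0) + C) + C2.
have C30 : 0 <= C3.
  by rewrite /C3 addr_ge0// mulr_ge0 ?(ltW A0)// addr_ge0// divr_ge0 ?sqr_ge0// mulr_ge0// ltW.
exists (1 + 2 * A * C + 4 * K e + 1 + C2 + e + C3 / (2 * e)) => n hn.
have AC : 0 <= 2 * A * C by rewrite -mulrA mulr_ge0// mulr_ge0// ltW.
have C3e : 0 <= C3 / (2 * e) by rewrite divr_ge0// mulr_ge0// ltW.
have n1 : 1 <= n by lra.
have n0 : 0 < n by lra.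
exists (2 * K e + A * n + B * (z e / 2)).
  have K2 := ltW K0; have A1 := ltW A0; have B1 := ltW B0; have zz := ltW z0; have nn := ltW n0.
  by apply: addr_ge0; [apply: addr_ge0; apply: mulr_ge0|apply: mulr_ge0 => //; apply: divr_ge0].
(* The constant compensates the largest value of the cutoff term of [height], so that [g] is
   nonnegative. *)
exists (fun x s i => -1 * height e x s i +
   ((A * n) * -1 * (- deficit lambda mu nu eps k x s i ^+ 3) + B * (z e / 2))).
split=> [x s i x0 s0 i0|x s i d b1 b2 xn adm].
  have g0 : 0 <= gap e x s i by exact: pos_ge0.
  have g2 : gap e x s i <= 2 by exact: gap_le2.
  have gg : K e * gap e x s i ^+ 2 <= K e * 4.
    by rewrite ler_wpM2l ?(ltW K0)// expr2; have : gap e x s i * gap e x s i <= 2 * 2 by [apply: ler_pM]; lra.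
  have gg0 : 0 <= K e * gap e x s i ^+ 2 by rewrite mulr_ge0 ?sqr_ge0// ltW.
  have bc : B * cap (z e) s <= B * (z e / 2) by rewrite ler_wpM2l ?cap_le// ltW.
  have bc0 : 0 <= B * cap (z e) s by rewrite mulr_ge0 ?cap_ge0// ltW.
  have /andP[w0 w1] := w01 x s i x0 s0 i0.
  have w3 : A * n * deficit lambda mu nu eps k x s i ^+ 3 <= A * n.
    by rewrite ler_piMr ?exprn_ile1// mulr_ge0// ltW.
  have w30 : 0 <= A * n * deficit lambda mu nu eps k x s i ^+ 3.
    by rewrite mulr_ge0 ?exprn_ge0// mulr_ge0// ltW.
  by rewrite /height; lra.
have x0 : 0 < x by apply: lt_le_trans xn; rewrite invr_gt0.
have [[s0 i0 _ _] _] := adm.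
rewrite (driftD _ _ _ (fun x s i => -1 * height e x s i)) (driftZ _ _ _ (-1) (height e)).
rewrite (driftD _ _ _ (fun x s i => A * n * -1 * - deficit lambda mu nu eps k x s i ^+ 3)).
rewrite (driftZ _ _ _ (A * n * -1)) drift_cst.
have H1 := hdrift n x s i d b1 b2 n1 adm (ltW x0).
have H2 := wdrift n x s i d b1 b2 n1 adm (ltW x0).
have [S1 S2] := height_slope_ge sm (ltW x0) adm.
have /andP[w0 w1] := w01 x s i (ltW x0) s0 i0.
have rn : (if b1 then 0 else lambda / x) <= lambda * n.
  case: (b1); first by rewrite mulr_ge0// ltW.
  by rewrite ler_wpM2l ?(ltW l0)// invf_ple ?posrE.
have wl := wlow x s i.
clear wdrift w01 wlow hdrift sm h1 h2 h3 he e1 e2 e3 l10 x0 xn adm s0 i0 B0 z0.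
move: S1 S2 H1 H2 rn w0 w1 wl.
set r := if b1 then 0 else _; set w := deficit _ _ _ _ _ _ _ _; set D1 := drift (height e) _ _ _ _ _ _ _.
set D2 := drift _ _ _ _ _ _ _ _; set HS := height_slope _ _ _ _ _ _ _.
move=> S1 S2 H1 H2 rn w0 w1 wl.
have H3 : A * (c0 * n * w ^+ 2 - C * w - C / n) <= A * n * D2.
  rewrite -[leRHS]mulrA ler_wpM2l ?(ltW A0)//.
  apply: le_trans (ler_wpM2l (ltW n0) H2).
  by rewrite le_eqVlt; apply/orP; left; apply/eqP; field; rewrite gt_eqF.
suff : r - 1 + e <= D1 + A * n * D2 by lra.
have Cn : C / n <= C by rewrite ler_pdivrMr// ler_peMr.
have C2n : C2 / n <= C2 by rewrite ler_pdivrMr// ler_peMr.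
have [xl|xl] := leP x (lambda - 2 * eps).
  have {}wl := wl xl.
  have W2 : (eps / 2) ^+ 2 <= w ^+ 2 by rewrite lerXn2r// ?nnegrE// divr_ge0// ltW.
  have H4 : (lambda + 1) * n <= A * (c0 * n * w ^+ 2).
    have -> : (lambda + 1) * n = A * (c0 * n * (eps / 2) ^+ 2).
      by rewrite /A; field; rewrite !gt_eqF.
    by rewrite ler_wpM2l ?(ltW A0)// ler_wpM2l// mulr_ge0// ltW.
  have H5 : A * (C * w) <= A * C by rewrite ler_wpM2l ?(ltW A0)// ler_piMr.
  have H6 : A * (C / n) <= A * C by rewrite ler_wpM2l// ltW.
  by lra.
have {}S2 : r - 1 + 3 * e <= HS by apply: S2; rewrite /eps in xl; lra.
have H7 : - (C ^+ 2 / (4 * c0) / n) <= c0 * n * w ^+ 2 - C * w.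
  rewrite -subr_ge0.
  have -> : c0 * n * w ^+ 2 - C * w - - (C ^+ 2 / (4 * c0) / n) =
    (2 * c0 * n * w - C) ^+ 2 / (4 * c0 * n) by field; rewrite !gt_eqF.
  by rewrite divr_ge0 ?sqr_ge0// !mulr_ge0// ltW.
have H8 : A * (- (C ^+ 2 / (4 * c0) / n) - C / n) <= A * (c0 * n * w ^+ 2 - C * w - C / n).
  by rewrite ler_wpM2l ?(ltW A0)//; lra.
have H9 : C3 / n <= 2 * e.
  rewrite ler_pdivrMr//; have : C3 / (2 * e) <= n by lra.
  by rewrite ler_pdivrMr ?mulr_gt0// mulrC.
have : C3 / n = A * (C ^+ 2 / (4 * c0) / n + C / n) + C2 / n by rewrite /C3; ring.
lra.
Qed.

End Control.

(** * Stability *)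

Section Scaling.
Context (R : realType) (lambda mu nu : R) (N : nat).
Hypothesis N_gt0 : (0 < N)%N.
Implicit Types (f : R -> R -> R -> R) (r : raw_state).

Local Notation raw_gen := (raw_gen lambda mu nu N).

Definition idle r : nat := (N - (head 0%N r.1.1 + r.1.2 + r.2))%N.
Definition frac (a : nat) : R := a%:R / N%:R.
Definition busy_frac r : R := frac (head 0%N r.1.1).
Definition idle_frac r : R := frac (idle r).
Definition setup_frac r : R := frac r.2.
(* Fraction of the servers with exactly one task. *)
Definition single_frac r : R := busy_frac r - frac (nth 0%N r.1.1 1).

Definition scaled f r : R := f (busy_frac r) (setup_frac r) (idle_frac r).

Definition raw_drift f r : R :=
  drift lambda mu nu f N%:R (busy_frac r) (setup_frac r) (idle_frac r) (single_frac r)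
    (0 < idle r)%N (0 < r.1.2)%N.

Lemma frac_ge0 a : 0 <= frac a.
Proof. exact: divr_ge0. Qed.

Lemma fracS a : frac a.+1 = frac a + N%:R^-1.
Proof. by rewrite /frac -natr1 mulrDl mul1r. Qed.

Lemma fracP a : (0 < a)%N -> frac a.-1 = frac a - N%:R^-1.
Proof. by case: a => // a _; rewrite fracS addrK. Qed.

Lemma mulN_frac a : N%:R * frac a = a%:R.
Proof. by rewrite /frac mulrC divfK// pnatr_eq0 -lt0n. Qed.

Lemma frac_total r : valid_state N r ->
  busy_frac r + setup_frac r + idle_frac r + frac r.1.2 = 1.
Proof.
case: r => [[Q U] S] /and3P[sQ Q0 QN]; have N0 : 0 < N%:R :> R by rewrite ltr0n.
rewrite /busy_frac /setup_frac /idle_frac /frac -!mulrDl -!natrD /idle /=.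
have -> : (head 0%N Q + S + (N - (head 0%N Q + U + S)) + U = N)%N by lia.
by rewrite divff// gt_eqF.
Qed.

Lemma valid_admissible r : valid_state N r ->
  admissible (busy_frac r) (setup_frac r) (idle_frac r) (single_frac r)
    (0 < idle r)%N (0 < r.1.2)%N.
Proof.
case: r => [[Q U] S] vr; have /and3P[sQ Q0 QN] := vr.
have N0 : 0 < N%:R :> R by rewrite ltr0n.
have Q1 : (nth 0%N Q 1 <= head 0%N Q)%N by rewrite head_nth0; exact: nth_nonincreasing.
have total := frac_total vr.
have U0 := frac_ge0 U; split; split.
- exact: frac_ge0.
- exact: frac_ge0.
- rewrite /single_frac subr_ge0 lerBlDr lerDl frac_ge0 andbT.
  by rewrite /busy_frac /frac ler_pM2r ?invr_gt0// ler_nat.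
- move: total => /=; lra.
- by rewrite -leqNgt leqn0 => /eqP iE; rewrite /idle_frac iE /frac mul0r.
- rewrite -leqNgt leqn0 => /eqP /= uE; move: total; rewrite uE /frac mul0r; lra.
Qed.

(** At the boundary the truncated predecessors are not shifts by [1 / N], but the corresponding
    rates vanish there. *)
Lemma raw_gen_scaled f r : valid_state N r -> raw_gen (scaled f) r = raw_drift f r.
Proof.
case: r => [[Q U] S] /and3P[sQ Q0 QN].
pose phi h U S := f (frac h) (frac S) (frac (N - (h + U + S))).
rewrite (_ : scaled f = fast phi)//.
rewrite (raw_gen_fast _ _ _ _ phi U S sQ) /phi /raw_drift /drift /single_frac /busy_frac
  /idle_frac /setup_frac /idle /=.
set h := head 0%N Q in QN *; set I := (N - (h + U + S))%N.
rewrite -(mulN_frac h) -(mulN_frac (nth 0%N Q 1)) -(mulN_frac I) -(mulN_frac S).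
rewrite ![N%:R * (_ + _)]mulrDr; congr (_ + _ + _ + _).
- rewrite mulrA [N%:R * lambda]mulrC; congr (_ * (_ - _)).
  case: ifP => I0.
    rewrite fracS (_ : (N - (h.+1 + U + S) = I.-1)%N) ?fracP// /I; lia.
  case: posnP => U0; first by rewrite addn0 /I U0.
  by rewrite addn1 fracS (_ : (N - (h + U.-1 + S.+1) = I)%N)// /I; lia.
- have [h0|h0] := posnP h.
    suff -> : nth 0%N Q 1 = 0%N by rewrite h0 /frac !(mul0r, subrr, mulr0).
    have := nth_nonincreasing sQ 0; rewrite -head_nth0 -/h h0; lia.
  rewrite -mulrBr mulrA fracP//; congr (_ * (f _ _ _ - _)).
  by rewrite -fracS; congr frac; rewrite /I; lia.
- have [I0|I0] := posnP I; first by rewrite I0 /frac !(mul0r, mulr0).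
  have -> : frac (N - (h + U.+1 + S)) = frac I - N%:R^-1.
    by rewrite -fracP//; congr frac; rewrite /I; lia.
  by ring.
- have [S0|S0] := posnP S; first by rewrite S0 /frac !(mul0r, mulr0).
  have -> : frac (N - (h + U + S.-1)) = frac I + N%:R^-1.
    by rewrite -fracS; congr frac; rewrite /I; lia.
  by rewrite fracP//; ring.
Qed.

End Scaling.

Section Stability.
Context (R : realType) (lambda mu nu : R).
Hypotheses (lambda_gt0 : 0 < lambda) (lambda_lt1 : lambda < 1).
Hypotheses (mu_gt0 : 0 < mu) (nu_gt0 : 0 < nu).

Local Notation rate N := (@tabs_rate R lambda mu nu N).

(* [levels] dominates the work blocked by congestion; the bounded factor g from
   [control] compensates the congestion on average. *)
Lemma lyapunov : exists n0 : R, forall N, n0 <= N%:R -> (0 < N)%N ->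
  exists2 V : state N -> R, (forall x, 0 <= V x) &
  exists (b : R) (F : seq (state N)),
    (forall x, gen (rate N) (@tabs_succ R lambda mu nu N) V x <= b) /\
    (forall x, x \notin F -> gen (rate N) (@tabs_succ R lambda mu nu N) V x <= -1).
Proof.
have [e e0 [n0 ctl]] := control lambda_gt0 lambda_lt1 mu_gt0 nu_gt0.
exists n0 => N hN N0; have [G G0 [g [gb gd]]] := ctl _ hN.
pose C := lambda * N%:R + rate_bound lambda mu nu N * G.
pose W (r : raw_state) : R := levels R r.1.1 + tasks R r.1.1 * scaled N g r.
have gW r : 0 <= scaled N g r <= G by apply: gb; exact: frac_ge0.
have WE r : valid_state N r -> raw_gen lambda mu nu N W r <= C - e * tasks R r.1.1.
  case: r => [[Q U] S] vr; have /and3P[sQ Q0 QN] := vr.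
  (* Product rule for [tasks * g]: [D] collects the change of [tasks], weighted by [g] after the
     transition. As [tasks] grows by at most one and [g] lies between 0 and [G], this remainder is
     bounded whatever the number of tasks. *)
  pose D r' : R := (tasks R r'.1.1 - tasks R Q) * scaled N g r'.
  have -> : raw_gen lambda mu nu N W (Q, U, S) =
      raw_gen lambda mu nu N (levels R \o fst \o fst) (Q, U, S)
      + tasks R Q * raw_gen lambda mu nu N (scaled N g) (Q, U, S)
      + \sum_(t <- transitions lambda mu nu N (Q, U, S)) t.1 * D t.2.
    rewrite /raw_gen mulr_sumr -!big_split /=; apply: eq_bigr => t _.
    by rewrite /W /D /=; ring.
  have T0 := tasks_ge0 R Q.
  have H1 : \sum_(t <- transitions lambda mu nu N (Q, U, S)) t.1 * D t.2 <=
            rate_bound lambda mu nu N * G.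
    apply: (@le_trans _ _ ((\sum_(t <- transitions lambda mu nu N (Q, U, S)) t.1) * G)).
      rewrite mulr_suml big_seq [leRHS]big_seq; apply: ler_sum => t tin.
      have := transitions_ge0 lambda_gt0 mu_gt0 nu_gt0 tin.
      rewrite le_eqVlt => /predU1P[<-|t0]; first by rewrite !mul0r.
      rewrite ler_wpM2l ?(ltW t0)//.
      have step : tasks R t.2.1.1 - tasks R Q <= 1.
        by rewrite lerBlDl; exact: (tasks_step lambda_gt0 mu_gt0 nu_gt0 vr tin t0).
      have /andP[s0 sG] := gW t.2; rewrite /D.
      apply: (@le_trans _ _ (1 * scaled N g t.2)); last by rewrite mul1r.
      by rewrite ler_wpM2r.
    by rewrite ler_wpM2r//; exact: sum_transitions.
  have H2 : raw_gen lambda mu nu N (levels R \o fst \o fst) (Q, U, S)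
      + tasks R Q * raw_gen lambda mu nu N (scaled N g) (Q, U, S)
      <= lambda * N%:R - e * tasks R Q.
    have HL := raw_gen_levels N lambda_gt0 mu_gt0 nu_gt0 U S sQ.
    apply: le_trans (lerD HL (lexx _)) _.
    (* With nobody busy there are no tasks, so [g] does not enter; [control] applies only to [x] at
       least [1 / N]. *)
    have [h0|h0] := posnP (head 0%N Q).
      by rewrite (tasks_head0 _ sQ h0) !mul0r mulr0 subr0 !addr0.
    rewrite raw_gen_scaled// -addrA lerD2l -mulrDr mulrC -mulNr ler_wpM2r//.
    have hx : N%:R^-1 <= busy_frac R N (Q, U, S).
      by rewrite /busy_frac /frac /= ler_peMl ?invr_ge0// ler1n.
    have := gd _ _ _ _ _ _ hx (valid_admissible R N0 vr).
    rewrite -/(raw_drift lambda mu nu N g (Q, U, S)) /busy_frac /frac /congestion /idle /=.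
    rewrite invf_div [lambda * (_ / _)]mulrA.
    by move: (if _ then _ else _) => c Hc; lra.
  rewrite /C /=; lra.
have C0 : 0 <= C.
  rewrite /C /rate_bound addr_ge0// ?mulr_ge0// ?(ltW lambda_gt0)//.
  by rewrite !addr_ge0// ltW.
exists (W \o val) => [x|].
  have /andP[s0 _] := gW (val x).
  by rewrite /= /W addr_ge0 ?levels_ge0// mulr_ge0// tasks_ge0.
(* Beyond [M] tasks, [e * tasks] exceeds [C + 1]. *)
pose M := (Num.truncn ((C + 1) / e)).+1.
exists C, (few_tasks N M); split => [x|x xM].
  rewrite tabs_genE//; apply: le_trans (WE _ (valP x)) _.
  by rewrite lerBlDr lerDl mulr_ge0 ?tasks_ge0// ltW.
rewrite tabs_genE//; apply: le_trans (WE _ (valP x)) _.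
have xT : M%:R < tasks R (val x).1.1.
  rewrite ltNge; apply/negP => H; move/negP: xM; apply.
  exact: (mem_few_tasks lambda_gt0 mu_gt0 nu_gt0 H).
have : (C + 1) / e <= tasks R (val x).1.1.
  by apply: le_trans (ltW xT); apply: ltW; exact: truncnS_gt.
rewrite ler_pdivrMr// mulrC; lra.
Qed.

Lemma tabs_stable : exists n0 : R, forall N, n0 <= N%:R -> (0 < N)%N ->
  forall X : ctmc (rate N), positive_recurrent X /\
  exists pi : probability (state N) R, stationary X pi /\
    forall pi' : probability (state N) R, stationary X pi' -> forall A, pi' A = pi A.
Proof.
have [n0 H] := lyapunov; exists n0 => N hN N0 X.
have [V V0 [b [F [Vb VF]]]] := H N hN N0.
have rg0 := @tabs_rate_ge0 _ _ _ _ N lambda_gt0 mu_gt0 nu_gt0.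
have su := @tabs_succ_uniq R lambda mu nu N.
have si := @tabs_succ_irr R lambda mu nu N.
have rs := @tabs_rate_succ R lambda mu nu N.
have rm := @rate_min_gt0 R _ _ lambda_gt0 nu_gt0.
have qm := @tabs_exit_ge _ _ _ _ N lambda_gt0 mu_gt0 nu_gt0 N0.
have Lm x : 2 * exit_rate (rate N) x <= 2 * rate_bound lambda mu nu N.
  by rewrite ler_wpM2l//; exact: tabs_exit_le.
have irr x y : reach (rate N) x y by exact: tabs_irreducible.
split; first exact: (foster_positive_recurrent X rg0 su si rs rm qm Lm irr V0 Vb VF).
have [pi st] := foster_stationary X rg0 su si rs rm qm Lm irr V0 Vb VF.
exists pi; split => // pi' st' A.
exact: (stationary_unique rg0 su si rs Lm irr st' st A).
Qed.

End Stability.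

(** * Convergence of the stationary laws *)

Section LocalFunctions.
Context (R : realType) (N : nat).
Implicit Types r : raw_state.

Definition summary r : nat * nat * nat * nat :=
  (head 0%N r.1.1, nth 0%N r.1.1 1, r.1.2, r.2).

(** For fixed [N] the numbers in [summary] take finitely many values, so local functions are bounded
    and [stationary_gen] applies to them. The second occupancy is included because drifts depend on
    it through [single_frac]. *)
Definition local (g : raw_state -> R) : Prop :=
  forall r r', summary r = summary r' -> g r = g r'.

Definition code (x : state N) :
    'I_N.+1 * 'I_N.+1 * 'I_N.+1 * 'I_N.+1 :=
  (inord (head 0%N (val x).1.1), inord (nth 0%N (val x).1.1 1), inord (val x).1.2,
   inord (val x).2).

Lemma code_inj x y : code x = code y -> summary (val x) = summary (val y).
Proof.
case: x => [[[Q U] S] xP]; case: y => [[[Q' U'] S'] yP]; rewrite /code /=.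
have /and3P[sQ _ QN] := xP; have /and3P[sQ' _ QN'] := yP.
have H1 := nth_nonincreasing sQ 0; have H1' := nth_nonincreasing sQ' 0.
rewrite -head_nth0 in H1; rewrite -head_nth0 in H1'.
move=> [] /(congr1 val) + /(congr1 val) + /(congr1 val) + /(congr1 val).
by rewrite /= !inordK /summary /=; [move=> -> -> -> ->|lia..].
Qed.

Lemma local_factor (g : raw_state -> R) : local g ->
  exists c : _ -> R, forall x, g (val x) = c (code x).
Proof.
move=> lg; exists (fun k => g (val (get [set x | code x = k]))) => x.
apply: lg; apply: code_inj; apply/esym.
exact: (@getPex _ [set y | code y = code x] (ex_intro _ x erefl)).
Qed.

Lemma local_bdd (g : raw_state -> R) : local g -> bdd (fun x : state N => g (val x)).
Proof.
move=> /local_factor[c cE]; exists (\sum_k `|c k|) => x.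
by rewrite cE (bigD1 (code x))//= lerDl sumr_ge0.
Qed.

End LocalFunctions.

Section Convergence.
Context (R : realType) (lambda mu nu : R).
Hypotheses (lambda_gt0 : 0 < lambda) (lambda_lt1 : lambda < 1).
Hypotheses (mu_gt0 : 0 < mu) (nu_gt0 : 0 < nu).
Implicit Types (f : R -> R -> R -> R) (r : raw_state) (N : nat) (g h : nat -> raw_state -> R).

Local Notation rate N := (@tabs_rate R lambda mu nu N).
Local Notation rdrift := (raw_drift lambda mu nu).

Section FixedN.
Context (N : nat).
Hypothesis N_gt0 : (0 < N)%N.

Lemma local_scaled f : local (scaled N f).
Proof. by move=> [[Q U] S] [[Q' U'] S'] [] /= h1 _ h3 h4; rewrite /scaled /busy_frac /idle_frac /setup_frac /idle /= h1 h3 h4. Qed.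

Lemma local_drift f : local (rdrift N f).
Proof.
move=> [[Q U] S] [[Q' U'] S'] [] /= h1 h2 h3 h4.
by rewrite /raw_drift /single_frac /busy_frac /idle_frac /setup_frac /idle /= h1 h2 h3 h4.
Qed.

Context (X : ctmc (rate N)) (pi : probability (state N) R) (st : stationary X pi).

Lemma mean_gen_local (g : raw_state -> R) : local g ->
  (\int[pi]_x raw_gen lambda mu nu N g (val x) = 0)%R.
Proof.
move=> /(local_factor N)[c cE].
have Lm x : 2 * exit_rate (rate N) x <= 2 * rate_bound lambda mu nu N.
  by rewrite ler_wpM2l//; exact: tabs_exit_le.
have := stationary_gen (@tabs_rate_ge0 _ _ _ _ N lambda_gt0 mu_gt0 nu_gt0)
  (@tabs_succ_uniq R lambda mu nu N) (@tabs_succ_irr R lambda mu nu N)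
  (@tabs_rate_succ R lambda mu nu N) Lm st (@code N) c.
apply: etrans; apply: eq_Rintegral => x _.
rewrite -(tabs_genE lambda_gt0 mu_gt0 nu_gt0).
by apply: eq_gen => y; exact: cE.
Qed.

Lemma mean_drift f : (\int[pi]_x rdrift N f (val x) = 0)%R.
Proof.
rewrite -(mean_gen_local (@local_scaled f)); apply: eq_Rintegral => x _.
by rewrite raw_gen_scaled// (valP x).
Qed.

End FixedN.

(* The means tend to zero as N grows, uniformly over the stationary laws. *)
Definition vanishing (g : nat -> raw_state -> R) : Prop :=
  forall eps, 0 < eps -> exists n0 : R, forall N, n0 <= N%:R -> (0 < N)%N ->
    forall (X : ctmc (rate N)) (pi : probability (state N) R), stationary X pi ->
      (\int[pi]_x g N (val x))%R <= eps.

Lemma vanishing_mean (g h : nat -> raw_state -> R) :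
  vanishing g -> (forall N, local (g N)) ->
  (forall eps, 0 < eps -> exists2 K : R, 0 <= K &
     forall N, (0 < N)%N ->
     forall (X : ctmc (rate N)) (pi : probability (state N) R), stationary X pi ->
     (\int[pi]_x h N (val x))%R <= eps + K * (\int[pi]_x g N (val x))%R + K / N%:R) ->
  vanishing h.
Proof.
move=> vg lg H eps eps0.
have e3 : 0 < eps / 3 by rewrite divr_gt0.
have [K K0 HK] := H _ e3.
have K1 : 0 < K + 1 by rewrite ltr_wpDl.
have eK : 0 < eps / 3 / (K + 1) by rewrite divr_gt0.
have [n0 Hn] := vg _ eK.
exists (Num.max n0 (K / (eps / 3))) => N; rewrite ge_max => /andP[Nn0 NK] N0 X pi st.
apply: le_trans (HK _ N0 _ _ st) _.
have G1 := ler_wpM2l K0 (Hn _ Nn0 N0 _ _ st).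
have G2 : K / N%:R <= eps / 3.
  by rewrite ler_pdivrMr ?ltr0n// mulrC -ler_pdivrMr.
have G3 : K * (eps / 3 / (K + 1)) <= eps / 3.
  rewrite mulrCA ler_piMr ?(ltW e3)// ler_pdivrMr// mul1r lerDl//.
lra.
Qed.

Lemma vanishing0 : vanishing (fun _ _ => 0).
Proof. by move=> eps eps0; exists 0 => N _ _ X pi _; rewrite mean_cst ltW. Qed.

(** A drift has mean zero under a stationary law, so a pointwise bound up to a drift is a bound on
    means. *)
Lemma vanishing_drift (g h : nat -> raw_state -> R) :
  vanishing g -> (forall N, local (g N)) -> (forall N, local (h N)) ->
  (forall eps, 0 < eps -> exists2 K : R, 0 <= K &
     forall N, (0 < N)%N -> exists f, forall r, valid_state N r ->
       h N r <= eps + K * g N r + K / N%:R + rdrift N f r) ->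
  vanishing h.
Proof.
move=> vg lg lh H; apply: (vanishing_mean vg lg) => eps eps0.
have [K K0 HK] := H _ eps0; exists K => // N N0 X pi st; have [f Hf] := HK _ N0.
have bg := local_bdd N (lg N); have bd := local_bdd N (@local_drift N f).
have bg' := bddZ K bg; have bc := bdd_cst N eps; have bc' := bdd_cst N (K / N%:R).
have b1 := bddD (bddD (bddD bc bg') bc') bd.
apply: (@le_trans _ _ (\int[pi]_x (eps + K * g N (val x) + K / N%:R + rdrift N f (val x)))%R).
  by apply: mean_le => //; [exact: local_bdd|move=> x; exact: Hf (valP x)].
rewrite meanD//; last exact: bddD (bddD bc bg') bc'.
rewrite meanD//; last exact: bddD bc bg'.
by rewrite meanD// !mean_cst meanZ// (mean_drift N0 st) addr0.
Qed.

Lemma vanishingD (g h : nat -> raw_state -> R) :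
  vanishing g -> vanishing h -> (forall N, local (g N)) -> (forall N, local (h N)) ->
  vanishing (fun N r => g N r + h N r).
Proof.
move=> vg vh lg lh eps eps0; have e2 : 0 < eps / 2 by rewrite divr_gt0.
have [n0 Hg] := vg _ e2; have [n1 Hh] := vh _ e2.
exists (Num.max n0 n1) => N; rewrite ge_max => /andP[Nn0 Nn1] N0 X pi st.
rewrite [leRHS]splitr meanD; last 2 first.
- exact: local_bdd (lg N).
- exact: local_bdd (lh N).
by apply: lerD; [exact: (Hg _ Nn0 N0 _ _ st)|exact: (Hh _ Nn1 N0 _ _ st)].
Qed.

Lemma vanishing_dominated (g h : nat -> raw_state -> R) :
  vanishing g -> (forall N, local (g N)) -> (forall N, local (h N)) ->
  (forall eps, 0 < eps -> exists2 K : R, 0 <= K &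
     forall N, (0 < N)%N -> forall r, valid_state N r -> h N r <= eps + K * g N r) ->
  vanishing h.
Proof.
move=> vg lg lh H; apply: (vanishing_drift vg) => // eps eps0.
have [K K0 HK] := H _ eps0; exists K => // N N0; exists (fun _ _ _ => 0) => r vr.
rewrite /raw_drift drift_cst addr0 (le_trans (HK _ N0 _ vr))// lerDl.
by rewrite divr_ge0.
Qed.

Definition shortage N r : R := pos (lambda - busy_frac R N r).
Definition busy_error N r : R := `|busy_frac R N r - lambda|.
Definition blocked_setup N r : R := if (0 < idle N r)%N then 0 else setup_frac R N r.
Definition setup_start N r : R := (~~ (0 < idle N r)%N && (0 < r.1.2)%N)%:R.
Definition blocked N r : R := (~~ (0 < idle N r)%N)%:R.
Definition off_error N r : R := `|frac R N r.1.2 - (1 - lambda)|.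
Definition second_frac N r : R := frac R N (nth 0%N r.1.1 1).

Local Ltac solve_local :=
  move=> [[? ?] ?] [[? ?] ?] [] /=;
  rewrite /shortage /busy_error /blocked_setup /setup_start /blocked /off_error /second_frac
    /busy_frac /idle_frac /setup_frac /idle /=;
  repeat (let E := fresh in intro E; rewrite ?E; clear E); reflexivity.

Lemma local_shortage N : local (shortage N). Proof. solve_local. Qed.
Lemma local_busy_error N : local (busy_error N). Proof. solve_local. Qed.
Lemma local_blocked_setup N : local (blocked_setup N). Proof. solve_local. Qed.
Lemma local_setup_start N : local (setup_start N). Proof. solve_local. Qed.
Lemma local_blocked N : local (blocked N). Proof. solve_local. Qed.
Lemma local_off_error N : local (off_error N). Proof. solve_local. Qed.
Lemma local_second_frac N : local (second_frac N). Proof. solve_local. Qed.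
Lemma local_setup_frac N : local (setup_frac R N). Proof. solve_local. Qed.
Lemma local_idle_frac N : local (idle_frac R N). Proof. solve_local. Qed.
Lemma local_busy_frac N : local (busy_frac R N). Proof. solve_local. Qed.
Lemma local_setup_sq N : local (fun r => setup_frac R N r ^+ 2).
Proof. by move=> r r' E; rewrite (@local_setup_frac N r r' E). Qed.

Lemma vanishing_shortage : vanishing shortage.
Proof.
move: (lambda_gt0) (lambda_lt1) => l0 l1.
apply: (vanishing_drift vanishing0) => // [N|eps eps0]; first exact: local_shortage.
pose e := Num.min (eps / 4) (lambda / 2).
have e0 : 0 < e by rewrite /e lt_min !divr_gt0.
have [ee el] : e <= eps / 4 /\ e <= lambda / 2 by rewrite /e !ge_min !lexx orbT.
clearbody e; have he : 0 < e < lambda by rewrite e0/=; lra.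
have [k [c0 [C [c00 C0 w01 wlow wdrift]]]] := deficit_drift l0 l1 mu_gt0 nu_gt0 he.
(* Normalised so that [a * c0 * (e / 2) ^+ 2 = 1], which is more than the shortage can be. *)
pose a := 4 / e ^+ 2 / c0.
have a0 : 0 < a by rewrite !divr_gt0// exprn_gt0.
exists (2 * a * C) => [|N N0]; first by rewrite -mulrA mulr_ge0// mulr_ge0// ltW.
exists (fun x s i => a * (- deficit lambda mu nu e k x s i ^+ 3)) => r vr.
have adm := valid_admissible R N0 vr; have [[s0 i0 _ _] _] := adm.
have n1 : 1 <= N%:R :> R by rewrite ler1n.
have n0 : 0 < N%:R :> R by rewrite ltr0n.
have x0 : 0 <= busy_frac R N r by exact: frac_ge0.
have := wdrift _ _ _ _ _ _ _ n1 adm x0.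
have := w01 _ _ _ x0 s0 i0; have := wlow (busy_frac R N r) (setup_frac R N r) (idle_frac R N r).
rewrite /raw_drift driftZ; set w := deficit _ _ _ _ _ _ _ _; set D := drift _ _ _ _ _ _ _ _ _ _ _.
move=> wl /andP[w0 w1] wd.
have t1 : N%:R^-1 <= 1 :> R by rewrite invf_le1.
have t0 : 0 <= N%:R^-1 :> R by rewrite invr_ge0 ltW.
have Cw : C * w / N%:R <= C / N%:R by rewrite ler_wpM2r// ler_piMr.
have Cn : C / N%:R ^+ 2 <= C / N%:R.
  rewrite ler_wpM2l// lef_pV2 ?posrE ?exprn_gt0// expr2 ler_peMr// ltW.
have : c0 * w ^+ 2 <= D + 2 * C / N%:R by lra.
move=> /(ler_wpM2l (ltW a0)) H.
rewrite mulr0 addr0.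
apply: (@le_trans _ _ (2 * e + a * (c0 * w ^+ 2))); last by lra.
have aw : 0 <= a * (c0 * w ^+ 2) by rewrite mulr_ge0 ?(ltW a0)// mulr_ge0 ?sqr_ge0// ltW.
rewrite /shortage; case: (posP (lambda - busy_frac R N r)) => -[h ->]; last by lra.
have [xl|xl] := leP (busy_frac R N r) (lambda - 2 * e); last by lra.
have W2 : (e / 2) ^+ 2 <= w ^+ 2 by rewrite lerXn2r ?nnegrE// ?wl// divr_ge0// ltW.
have : a * (c0 * (e / 2) ^+ 2) <= a * (c0 * w ^+ 2).
  by rewrite ler_wpM2l ?(ltW a0)// ler_wpM2l// ltW.
have -> : a * (c0 * (e / 2) ^+ 2) = 1 by rewrite /a; field; rewrite !gt_eqF.
lra.
Qed.

(** * The mean busy fraction is at most lambda *)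

Section MeanBusy.
Context (N : nat).
Hypothesis N_gt0 : (0 < N)%N.
Context (X : ctmc (rate N)) (pi : probability (state N) R) (st : stationary X pi).

Let few M : set (state N) := [set x | (sumn (val x).1.1 < M)%N].

Let truncated_drift M r : valid_state N r ->
  raw_gen lambda mu nu N (fun r => (minn (sumn r.1.1) M)%:R) r <=
  (if (sumn r.1.1 < M)%N then lambda * N%:R - (head 0%N r.1.1)%:R else 0).
Proof.
case: r => [[Q U] S] vr; have /and3P[sQ _ _] := vr; case: ifP => QM /=.
  apply: le_trans (raw_gen_tasks N lambda_gt0 mu_gt0 nu_gt0 U S sQ).
  rewrite /raw_gen big_seq [leRHS]big_seq; apply: ler_sum => e ein /=.
  have := transitions_ge0 lambda_gt0 mu_gt0 nu_gt0 ein.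
  move=> e0; rewrite ler_wpM2l// !tasks_sumn lerB// ler_nat ?geq_minl//.
  by move: QM; rewrite /minn => ->.
rewrite /raw_gen big_seq; apply: sumr_le0 => e ein /=.
have e0 := transitions_ge0 lambda_gt0 mu_gt0 nu_gt0 ein.
rewrite mulr_ge0_le0// subr_le0 ler_nat.
by move/negbT: QM; rewrite -leqNgt => QM; rewrite (minn_idPr QM) geq_minr.
Qed.

(** The number of tasks is unbounded, so the balance equation is applied to its truncation at [M].
    This bounds the excess of [x] on [few M]; elsewhere [x - lambda] is at most 1. *)
Let few_bound M : (\int[pi]_x busy_frac R N (val x))%R - lambda <= 1 - fine (pi (few M)).
Proof.
move: (lambda_gt0) (lambda_lt1) => l0 l1.
have Lm x : 2 * exit_rate (rate N) x <= 2 * rate_bound lambda mu nu N.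
  by rewrite ler_wpM2l//; exact: tabs_exit_le.
have Z := stationary_gen (@tabs_rate_ge0 _ _ _ _ N lambda_gt0 mu_gt0 nu_gt0)
  (@tabs_succ_uniq R lambda mu nu N) (@tabs_succ_irr R lambda mu nu N)
  (@tabs_rate_succ R lambda mu nu N) Lm st
  (fun x => inord (minn (sumn (val x).1.1) M) : 'I_M.+1) (fun k => k%:R).
have bx := local_bdd N (@local_busy_frac N).
have bF := bdd_indic R (few M).
have n0 : 0 < N%:R :> R by rewrite ltr0n.
have bl : bdd (fun x : state N => busy_frac R N (val x) - lambda) by apply: bddB => //; exact: bdd_cst.
have H : 0 <= (\int[pi]_x (N%:R * (\1_(few M) x * (lambda - busy_frac R N (val x)))))%R.
  rewrite -Z; apply: mean_le.
  - apply: (bdd_gen (@tabs_rate_ge0 _ _ _ _ N lambda_gt0 mu_gt0 nu_gt0)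
      (@tabs_succ_uniq R lambda mu nu N) (@tabs_succ_irr R lambda mu nu N)
      (@tabs_rate_succ R lambda mu nu N) Lm).
    by exists M%:R => x; rewrite normr_nat ler_nat -ltnS ltn_ord.
  - by apply: bddZ; apply: bddM => //; apply: bddB => //; exact: bdd_cst.
  move=> x; rewrite (@eq_gen _ _ _ _ _ ((fun r => (minn (sumn r.1.1) M)%:R : R) \o val)); last first.
    by move=> y /=; rewrite inordK// ltnS geq_minr.
  rewrite tabs_genE//; apply: le_trans (truncated_drift M (valP x)) _.
  rewrite indicE /few; have [QM|QM] := boolP (sumn (val x).1.1 < M)%N.
    rewrite mem_set// mul1r mulrBr [N%:R * lambda]mulrC.
    by rewrite /busy_frac mulN_frac.
  by rewrite memNset ?mul0r ?mulr0//; apply/negP.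
have bfl : bdd (fun x => \1_(few M) x * (lambda - busy_frac R N (val x))).
  by apply: bddM => //; apply: bddB => //; exact: bdd_cst.
move: H; rewrite meanZ// pmulr_rge0// => H.
have : (\int[pi]_x (busy_frac R N (val x) - lambda))%R <=
   (\int[pi]_x (1 - \1_(few M) x - \1_(few M) x * (lambda - busy_frac R N (val x))))%R.
  apply: mean_le => //.
    by apply: bddB => //; apply: bddB => //; exact: bdd_cst.
  move=> x; have x1 : busy_frac R N (val x) <= 1.
    have [[s0 i0 _ xsi] _] := valid_admissible R N_gt0 (valP x); lra.
  rewrite indicE; case: (_ \in _) => /=; lra.
rewrite !meanB//; do ?[exact: bdd_cst|apply: bddB => //; exact: bdd_cst].
rewrite !mean_cst mean_indic; lra.
Qed.

Lemma mean_busy_le : (\int[pi]_x busy_frac R N (val x))%R <= lambda.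
Proof.
rewrite -subr_le0; set d := _ - lambda.
have H M : (pi (few M) <= (1 - d)%:E)%E.
  rewrite -EFin_prob lee_fin; have := few_bound M; rewrite -/d; lra.
have few_cvg : pi (few M) @[M --> \oo] --> pi (\bigcup_M few M).
  apply: nondecreasing_cvg_mu => //.
  move=> m n mn; apply/subsetPset => x /=; rewrite /few /= => H'; exact: leq_trans mn.
have few_all : \bigcup_M few M = setT.
  by apply/seteqP; split => // x _; exists (sumn (val x).1.1).+1 => //; rewrite /few /= ltnS leqnn.
move: few_cvg; rewrite few_all => /cvg_lim; rewrite (probability_setT pi) => E.
have : (1 <= (1 - d)%:E)%E.
  rewrite -(E _)//; apply: lime_le; last by apply: nearW => M; exact: H.
  by apply: ereal_nondecreasing_is_cvgn => m n mn; rewrite le_measure ?inE// => x /= /leq_trans; apply.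
by rewrite lee_fin; lra.
Qed.

End MeanBusy.

(** The absolute error is the signed error, of nonpositive mean, plus twice the shortage. *)
Lemma vanishing_busy_error : vanishing busy_error.
Proof.
apply: (vanishing_mean vanishing_shortage) => [N|eps eps0]; first exact: local_shortage.
exists 2 => // N N0 X pi st.
have b1 := local_bdd N (@local_busy_frac N); have b2 := local_bdd N (@local_shortage N).
have b3 := bdd_cst N lambda; have b4 := bddB b1 b3; have b5 := bddZ 2 b2.
apply: (@le_trans _ _ (\int[pi]_x (busy_frac R N (val x) - lambda + 2 * shortage N (val x)))%R).
  apply: mean_le => //; [exact: local_bdd (@local_busy_error N)|exact: bddD|move=> x].
  rewrite /busy_error /shortage; case: (posP (lambda - busy_frac R N (val x))) => -[h ->].
    by rewrite ler0_norm; lra.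
  by rewrite ger0_norm; lra.
rewrite meanD// meanB// mean_cst meanZ//.
have := mean_busy_le N0 st; have : 0 <= 2 / N%:R :> R by rewrite divr_ge0.
lra.
Qed.

Lemma minorant_affine (ax as_ ai t x s i : R) :
  minorant (fun x s i => ax * x + as_ * s + ai * i) ax as_ ai 0 t x s i.
Proof. by move=> dx ds di _ _ _; rewrite mul0r; lra. Qed.

Lemma affine_drift N r (ax as_ ai : R) : (0 < N)%N -> valid_state N r ->
  slope lambda mu nu ax as_ ai (busy_frac R N r) (setup_frac R N r) (idle_frac R N r)
    (single_frac R N r) (0 < idle N r)%N (0 < r.1.2)%N <=
  rdrift N (fun x s i => ax * x + as_ * s + ai * i) r.
Proof.
move=> N0 vr; have n0 : 0 < N%:R :> R by rewrite ltr0n.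
have := drift_ge lambda_gt0 mu_gt0 nu_gt0 n0 (valid_admissible R N0 vr) (lexx 0)
  (@minorant_affine ax as_ ai _ _ _ _).
by rewrite !mul0r subr0.
Qed.

(** In a blocked state [x + cap z i] grows at rate [nu * s]. In the others it decreases at rate at
    most the busy error plus [mu * z], and [z] is chosen so that [mu * z / nu = eps]. *)
Lemma vanishing_blocked_setup : vanishing blocked_setup.
Proof.
apply: (vanishing_drift vanishing_busy_error) => [N|N|eps eps0];
  [exact: local_busy_error|exact: local_blocked_setup|].
pose z := eps * nu / mu; have z0 : 0 < z by rewrite divr_gt0// mulr_gt0.
set c := curvature 1 0 z 1; have c0 : 0 <= c by apply: curvature_ge0.
have T0 := total_rate_gt0 lambda_gt0 mu_gt0 nu_gt0; set T := total_rate _ _ _ in T0.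
have v0 : 0 < nu^-1 by rewrite invr_gt0.
have vn : nu^-1 * nu = 1 by rewrite mulVf// gt_eqF.
have cT : 0 <= c * T * nu^-1 by rewrite mulr_ge0 ?(ltW v0)// mulr_ge0// ltW.
exists (nu^-1 + c * T * nu^-1) => [|N N0]; first by rewrite addr_ge0// ltW.
exists (fun x s i => nu^-1 * lin 1 0 z 1 x s i) => r vr.
have n0 : 0 < N%:R :> R by rewrite ltr0n.
have adm := valid_admissible R N0 vr.
have M := @lin_minorant _ 1 0 z 1 N%:R^-1 (busy_frac R N r) (setup_frac R N r) (idle_frac R N r)
  ler01 (lexx 0) z0 ltr01.
have := drift_ge lambda_gt0 mu_gt0 nu_gt0 n0 adm c0 M.
rewrite /raw_drift driftZ -/T; set D := drift _ _ _ _ _ _ _ _ _ _ _ => HD.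
have {HD} : nu * blocked_setup N r - busy_error N r - mu * z - c * T / N%:R <= D.
  apply: le_trans HD; rewrite lerD2r.
  have [[s0 i0 /andP[d0 dx] xsi] [hb1 hb2]] := adm.
  have ci0 := cap'_ge0 (idle_frac R N r) z0; have ci1 := cap'_le1 z0 i0.
  have ici := cap'_mul z0 i0; have hi : idle_frac R N r = 0 -> cap' z (idle_frac R N r) = 1.
    by move=> ->; exact: cap'0.
  have e1 : busy_frac R N r - lambda <= busy_error N r by exact: ler_norm.
  have e0 : 0 <= busy_error N r by exact: normr_ge0.
  move: e1 e0 ci0 ci1 ici hi; rewrite /slope /blocked_setup.
  move: (busy_error N r) (cap' z _) => be ci e1 e0 ci0 ci1 ici hi.
  rewrite mul0r mul1r.
  case: (0 < idle N r)%N hb1 => [_|/(_ isT) iE].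
    have P1 : (single_frac R N r - lambda) * (1 - ci) <= be.
      apply: (@le_trans _ _ (be * (1 - ci))); first by rewrite ler_wpM2r; lra.
      by rewrite ler_piMr; lra.
    have P2 : mu * idle_frac R N r * ci <= mu * z by rewrite -mulrA ler_wpM2l// ltW.
    have P3 : 0 <= nu * setup_frac R N r * ci by rewrite !mulr_ge0// ltW.
    by rewrite mulr0; lra.
  rewrite (hi iE) iE; have mz : 0 <= mu * z by rewrite mulr_ge0// ltW.
  have -> : (if (0 < r.1.2)%N then 0 else 0) = 0 :> R by case: ifP.
  lra.
move=> /(ler_wpM2l (ltW v0)).
have -> : nu^-1 * (nu * blocked_setup N r - busy_error N r - mu * z - c * T / N%:R) =
   (nu^-1 * nu) * blocked_setup N r - nu^-1 * busy_error N r - (nu^-1 * nu) * eps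
   - c * T * nu^-1 / N%:R by rewrite /z; field; rewrite !gt_eqF.
rewrite vn.
have B0 : 0 <= c * T * nu^-1 * busy_error N r by rewrite mulr_ge0// normr_ge0.
have B1 : 0 <= nu^-1 / N%:R by rewrite mulr_ge0 ?invr_ge0// ltW.
lra.
Qed.

(** Setups started and completed balance also when weighted by [s]: completions give [nu * s ^+ 2],
    and starts, possible only in blocked states, at most [lambda] times [blocked_setup]. *)
Lemma vanishing_setup_sq : vanishing (fun N r => setup_frac R N r ^+ 2).
Proof.
apply: (vanishing_drift vanishing_blocked_setup) => [N|N|eps eps0];
  [exact: local_blocked_setup|exact: local_setup_sq|].
have T0 := total_rate_gt0 lambda_gt0 mu_gt0 nu_gt0; set T := total_rate _ _ _ in T0.
pose a := (2 * nu)^-1; have a0 : 0 < a by rewrite invr_gt0 mulr_gt0.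
have aT : 0 <= a * T by rewrite mulr_ge0// ltW.
have la : 0 <= 2 * lambda * a by rewrite mulr_ge0 ?mulr_ge0// ltW.
exists (2 * lambda * a + a * T) => [|N N0]; first by rewrite addr_ge0.
exists (fun x s i => a * (- s ^+ 2)) => r vr.
have n0 : 0 < N%:R :> R by rewrite ltr0n.
have adm := valid_admissible R N0 vr.
have M : minorant (fun _ s _ : R => - s ^+ 2) 0 (- 2 * setup_frac R N r) 0 1 N%:R^-1
    (busy_frac R N r) (setup_frac R N r) (idle_frac R N r).
  move=> dx ds di _ hs _; have : ds ^+ 2 <= N%:R^-1 ^+ 2.
    by rewrite -real_normK ?num_real// lerXn2r ?nnegrE// invr_ge0 ltW.
  by rewrite sqrrD; lra.
have := drift_ge lambda_gt0 mu_gt0 nu_gt0 n0 adm ler01 M.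
rewrite /raw_drift driftZ -/T; set D := drift _ _ _ _ _ _ _ _ _ _ _ => HD.
have [[s0 _ _ _] _] := adm.
have {HD} : 2 * nu * setup_frac R N r ^+ 2 - 2 * lambda * blocked_setup N r - T / N%:R <= D.
  apply: le_trans HD; rewrite mul1r lerD2r /slope /blocked_setup.
  have ls : 0 <= lambda * setup_frac R N r by rewrite mulr_ge0// ltW.
  by case: (0 < idle N r)%N; case: (0 < r.1.2)%N; lra.
move=> /(ler_wpM2l (ltW a0)).
have an : a * (2 * nu) = 1 by rewrite mulVf// gt_eqF// mulr_gt0.
have -> : a * (2 * nu * setup_frac R N r ^+ 2 - 2 * lambda * blocked_setup N r - T / N%:R) =
  (a * (2 * nu)) * setup_frac R N r ^+ 2 - 2 * lambda * a * blocked_setup N r - a * T / N%:R by ring.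
rewrite an.
have b0 : 0 <= blocked_setup N r by rewrite /blocked_setup; case: ifP.
have B0 : 0 <= a * T * blocked_setup N r by rewrite mulr_ge0.
have B1 : 0 <= 2 * lambda * a / N%:R by rewrite mulr_ge0 ?invr_ge0// ltW.
lra.
Qed.

Lemma vanishing_setup : vanishing (setup_frac R).
Proof.
apply: (vanishing_dominated vanishing_setup_sq) => [N|N|eps eps0];
  [exact: local_setup_sq|exact: local_setup_frac|].
exists eps^-1 => [|N N0 r vr]; first by rewrite invr_ge0 ltW.
have s0 : 0 <= setup_frac R N r by exact: frac_ge0.
rewrite -subr_ge0; have -> : eps + eps^-1 * setup_frac R N r ^+ 2 - setup_frac R N r =
  eps^-1 * ((setup_frac R N r - eps / 2) ^+ 2 + 3 / 4 * eps ^+ 2).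
  by field; rewrite gt_eqF.
by rewrite mulr_ge0 ?invr_ge0 ?(ltW eps0)// addr_ge0 ?sqr_ge0// mulr_ge0 ?sqr_ge0// divr_ge0.
Qed.

(** In the mean, setups start as often as they are completed, which is at rate [nu * s]. *)
Lemma vanishing_setup_start : vanishing setup_start.
Proof.
apply: (vanishing_drift vanishing_setup) => [N|N|eps eps0];
  [exact: local_setup_frac|exact: local_setup_start|].
have l1 : lambda^-1 * lambda = 1 by rewrite mulVf// gt_eqF.
have v0 : 0 <= lambda^-1 * nu by rewrite mulr_ge0 ?invr_ge0// ltW.
exists (lambda^-1 * nu) => // N N0; exists (fun x s i => 0 * x + lambda^-1 * s + 0 * i) => r vr.
apply: le_trans (lerD (lexx _) (affine_drift 0 lambda^-1 0 N0 vr)).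
have B0 : 0 <= lambda^-1 * nu / N%:R by rewrite divr_ge0.
rewrite /slope /setup_start.
case: (0 < idle N r)%N; case: (0 < r.1.2)%N => /=; rewrite ?[lambda * lambda^-1]mulrC ?l1; lra.
Qed.

(** The fraction [x + s + i] of servers that are not off gains only by starting setups and loses at
    rate [mu * i]. *)
Lemma vanishing_idle : vanishing (idle_frac R).
Proof.
apply: (vanishing_drift vanishing_setup_start) => [N|N|eps eps0];
  [exact: local_setup_start|exact: local_idle_frac|].
have m1 : mu^-1 * mu = 1 by rewrite mulVf// gt_eqF.
have v0 : 0 <= mu^-1 * lambda by rewrite mulr_ge0 ?invr_ge0// ltW.
exists (mu^-1 * lambda) => // N N0.
exists (fun x s i => - mu^-1 * x + - mu^-1 * s + - mu^-1 * i) => r vr.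
apply: le_trans (lerD (lexx _) (affine_drift (- mu^-1) (- mu^-1) (- mu^-1) N0 vr)).
have B0 : 0 <= mu^-1 * lambda / N%:R by rewrite divr_ge0.
have i1 : mu * idle_frac R N r * mu^-1 = idle_frac R N r.
  by rewrite mulrC mulrA m1 mul1r.
rewrite /slope /setup_start mulrN i1.
case: (0 < idle N r)%N; case: (0 < r.1.2)%N => /=; lra.
Qed.

Lemma vanishing_off_error : vanishing off_error.
Proof.
have v1 := vanishingD vanishing_busy_error vanishing_setup local_busy_error local_setup_frac.
have l1 N : local (fun r => busy_error N r + setup_frac R N r).
  by move=> r r' E; rewrite (@local_busy_error N r r' E) (@local_setup_frac N r r' E).
have v2 := vanishingD v1 vanishing_idle l1 local_idle_frac.
apply: (vanishing_dominated v2) => [N|N|eps eps0]; last 1 first.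
- exists 1 => // N N0 r vr; have := frac_total R N0 vr.
  have s0 : 0 <= setup_frac R N r by exact: frac_ge0.
  have i0 : 0 <= idle_frac R N r by exact: frac_ge0.
  have := ler_norm (busy_frac R N r - lambda); have := ler_norm (lambda - busy_frac R N r).
  rewrite distrC -/(busy_error N r) /off_error mul1r => A B C.
  by rewrite ler_norml; apply/andP; split; lra.
- by move=> r r' E; rewrite (l1 N r r' E) (@local_idle_frac N r r' E).
- exact: local_off_error.
Qed.

(** A blocked arrival that starts no setup finds no idle-off server, and then [off_error] equals
    [1 - lambda], which is positive. *)
Lemma vanishing_blocked : vanishing blocked.
Proof.
have l10 : 0 < 1 - lambda by rewrite subr_gt0.
have v1 := vanishingD vanishing_setup_start vanishing_off_error local_setup_start local_off_error.
apply: (vanishing_dominated v1) => [N|N|eps eps0]; last 1 first.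
- exists (1 + (1 - lambda)^-1) => [|N N0 r vr].
    by rewrite addr_ge0// invr_ge0 ltW.
  have o0 : 0 <= off_error N r by exact: normr_ge0.
  have i0 : 0 <= (1 - lambda)^-1 by rewrite invr_ge0 ltW.
  rewrite /blocked /setup_start; case: (0 < idle N r)%N => /=.
    by rewrite add0r addr_ge0 ?(ltW eps0)// mulr_ge0// addr_ge0.
  have [u0|u0] := posnP r.1.2.
    have : off_error N r = 1 - lambda.
      by rewrite /off_error u0 /frac mul0r sub0r normrN gtr0_norm.
    move=> ->; rewrite add0r mulrDl mulVf ?gt_eqF//; lra.
  have P : 0 <= (1 - lambda)^-1 * off_error N r by rewrite mulr_ge0.
  by rewrite mulr1n; lra.
- by move=> r r' E; rewrite (@local_setup_start N r r' E) (@local_off_error N r r' E).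
- exact: local_blocked.
Qed.

(** The busy fraction gains [lambda] unless arrivals are blocked and loses the fraction of servers
    with exactly one task, which is [x] minus the second occupancy. *)
Lemma vanishing_second : vanishing second_frac.
Proof.
have l0 : 0 < lambda by [].
have v1 := vanishingD vanishing_busy_error vanishing_blocked local_busy_error local_blocked.
apply: (vanishing_drift v1) => [N|N|eps eps0]; last 1 first.
- exists (1 + lambda) => [|N N0]; first by rewrite addr_ge0// ltW.
  exists (fun x s i => 1 * x + 0 * s + 0 * i) => r vr.
  apply: le_trans (lerD (lexx _) (affine_drift 1 0 0 N0 vr)).
  have B0 : 0 <= (1 + lambda) / N%:R by rewrite divr_ge0// addr_ge0// ltW.
  have e1 : busy_frac R N r - lambda <= busy_error N r by exact: ler_norm.
  have e0 : 0 <= lambda * busy_error N r by rewrite mulr_ge0 ?(ltW l0)// normr_ge0.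
  rewrite /slope /single_frac -/(second_frac N r) /blocked.
  case: (0 < idle N r)%N; case: (0 < r.1.2)%N => /=; lra.
- by move=> r r' E; rewrite (@local_busy_error N r r' E) (@local_blocked N r r' E).
- exact: local_second_frac.
Qed.

End Convergence.

(** * From vanishing means to weak convergence *)

Section WeakConvergence.
Context (R : realType) (lambda mu nu : R).
Hypotheses (lambda_gt0 : 0 < lambda) (lambda_lt1 : lambda < 1).
Hypotheses (mu_gt0 : 0 < mu) (nu_gt0 : 0 < nu).

Local Notation rate N := (@tabs_rate R lambda mu nu N).

(** Uniform convergence of all coordinates implies convergence in the product topology: if no radius
    worked, points outside [W] at uniform distance below [m.+1%:R^-1] would converge to [z0]. *)
Lemma fraction_space_nbhs (z0 : fraction_space R) (W : set (fraction_space R)) : nbhs z0 W ->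
  exists2 d : R, 0 < d & forall z : fraction_space R,
    (forall i, `|z.1 i - z0.1 i| < d) -> `|z.2.1 - z0.2.1| < d -> `|z.2.2 - z0.2.2| < d -> W z.
Proof.
move=> W0; apply: contrapT => H.
have : forall m : nat, exists z : fraction_space R,
    [/\ forall i, `|z.1 i - z0.1 i| < m.+1%:R^-1, `|z.2.1 - z0.2.1| < m.+1%:R^-1,
        `|z.2.2 - z0.2.2| < m.+1%:R^-1 & ~ W z].
  move=> m; apply: contrapT => Hm; apply: H; exists m.+1%:R^-1 => // z h1 h2 h3.
  by apply: contrapT => nW; apply: Hm; exists z.
move=> /choice[u Hu].
have cvg_of (a : nat -> R) l : (forall m, `|a m - l| < m.+1%:R^-1) -> a m @[m --> \oo] --> l.
  move=> al; apply/cvgrPdist_lt => e e0; near=> m.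
  rewrite distrC; apply: (lt_trans (al m)); near: m.
  exact: (near_infty_natSinv_lt (PosNum e0)).
have c1 : (fun m => (u m).1) @ \oo --> (z0.1 : {ptws nat -> R}).
  apply/pointwise_cvgP => i; apply: cvg_of => m; by have [] := Hu m.
have c2 : (u m).2.1 @[m --> \oo] --> z0.2.1 by apply: cvg_of => m; have [] := Hu m.
have c3 : (u m).2.2 @[m --> \oo] --> z0.2.2 by apply: cvg_of => m; have [] := Hu m.
have uz : u m @[m --> \oo] --> z0.
  have -> : u = fun m => ((u m).1, ((u m).2.1, (u m).2.2)).
    by apply/funext => m; case: (u m) => [? []].
  rewrite (_ : z0 = (z0.1, (z0.2.1, z0.2.2))); last by case: (z0) => [? []].
  exact: cvg_pair c1 (cvg_pair c2 c3).
have [m _ Wm] := uz _ W0.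
by have [_ _ _] := Hu m; apply; apply: Wm => /=.
Unshelve. all: by end_near.
Qed.

Lemma fractions_in_domain N (x : state N) : (0 < N)%N -> fraction_domain (@fractions R N x).
Proof.
move=> N0; have [[s0 i0 /andP[d0 dx] xsi] _] := valid_admissible R N0 (valP x).
have total := frac_total R N0 (valP x).
case: x s0 i0 d0 dx xsi total => [[[Q U] S] xP] /=.
rewrite /fractions /fraction_domain /idle_frac /setup_frac /busy_frac /=.
have /and3P[sQ _ QN] := xP => s0 i0 d0 dx xsi total.
have n0 : 0 < N%:R :> R by rewrite ltr0n.
have u0 := frac_ge0 R N U; have x0 := frac_ge0 R N (head 0%N Q).
have mono i : frac R N (nth 0%N Q i.+1) <= frac R N (nth 0%N Q i).
  by rewrite /frac ler_pM2r ?invr_gt0// ler_nat nth_nonincreasing.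
have q1 i : frac R N (nth 0%N Q i) <= 1.
  by elim: i => [|i IH]; [rewrite -head_nth0; lra|exact: le_trans (mono i) IH].
split; last split => //.
- split=> [i||]; first by apply/andP; split; [exact: frac_ge0|exact: q1].
    by apply/andP; split; [exact: frac_ge0|rewrite -/(frac R N U); lra].
  by apply/andP; split; [exact: frac_ge0|rewrite -/(frac R N S); lra].
- by rewrite -/(frac R N U) -/(frac R N S) -/(frac R N (nth 0%N Q 0)) -head_nth0; lra.
Qed.

Lemma fixed_point_in_domain : fraction_domain (fixed_point lambda).
Proof.
move: (lambda_gt0) (lambda_lt1) => l0 l1.
split=> /=; first split=> [i||].
- by case: eqP => _; apply/andP; split; lra.
- by apply/andP; split; lra.
- by apply/andP; split; lra.
by split=> [i|]; [case: eqP => _; lra|lra].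
Qed.

(** Four terms control infinitely many coordinates, since all occupancies beyond the first are at
    most the second and have limit 0. *)
Definition distance N (r : raw_state) : R :=
  busy_error lambda N r + second_frac R N r + (off_error lambda N r + setup_frac R N r).

Lemma distanceP N (x : state N) (d : R) : (0 < N)%N -> distance N (val x) < d ->
  [/\ forall i, `|(fractions R x).1 i - (fixed_point lambda).1 i| < d,
      `|(fractions R x).2.1 - (fixed_point lambda).2.1| < d &
      `|(fractions R x).2.2 - (fixed_point lambda).2.2| < d].
Proof.
move=> N0; case: x => [[[Q U] S] xP] /=; have /and3P[sQ _ QN] := xP.
rewrite /distance /busy_error /second_frac /off_error /setup_frac /busy_frac /fractions /=.
have n0 : 0 < N%:R :> R by rewrite ltr0n.
have a0 := normr_ge0 (frac R N (head 0%N Q) - lambda).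
have b0 := normr_ge0 (frac R N U - (1 - lambda)).
have s0 := frac_ge0 R N S; have q0 := frac_ge0 R N (nth 0%N Q 1).
move=> H; split.
- case=> [|i] /=; first by rewrite -head_nth0 -/(frac R N (head 0%N Q)); lra.
  rewrite subr0 -/(frac R N (nth 0%N Q i.+1)) ger0_norm ?frac_ge0//.
  have : frac R N (nth 0%N Q i.+1) <= frac R N (nth 0%N Q 1).
    rewrite /frac ler_pM2r ?invr_gt0// ler_nat.
    by elim: i => // i; apply: leq_trans; exact: nth_nonincreasing.
  lra.
- by rewrite -/(frac R N U); lra.
- by rewrite subr0 -/(frac R N S) ger0_norm//; lra.
Qed.

Lemma local_distance N : local (distance N).
Proof.
move=> r r' E; rewrite /distance.
by rewrite (@local_busy_error _ lambda N r r' E) (@local_second_frac R N r r' E)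
  (@local_off_error _ lambda N r r' E) (@local_setup_frac R N r r' E).
Qed.

Lemma vanishing_distance : vanishing lambda mu nu distance.
Proof.
have v1 := vanishingD (vanishing_busy_error lambda_gt0 lambda_lt1 mu_gt0 nu_gt0)
  (vanishing_second lambda_gt0 lambda_lt1 mu_gt0 nu_gt0)
  (@local_busy_error _ lambda) (@local_second_frac R).
have v2 := vanishingD (vanishing_off_error lambda_gt0 lambda_lt1 mu_gt0 nu_gt0)
  (vanishing_setup lambda_gt0 lambda_lt1 mu_gt0 nu_gt0)
  (@local_off_error _ lambda) (@local_setup_frac R).
apply: (vanishingD v1 v2) => N r r' E.
  by rewrite (@local_busy_error _ lambda N r r' E) (@local_second_frac R N r r' E).
by rewrite (@local_off_error _ lambda N r r' E) (@local_setup_frac R N r r' E).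
Qed.

(** Near the limit point [f] varies by at most [eps / 2]. Elsewhere it varies by at most [2 * M],
    and there [distance] is at least [d], so [K * distance] with [K = 2 * M / d] covers that case;
    only the mean of [distance] is then needed. *)
Lemma stationary_weak_cvg (X : forall N : nat, ctmc (rate N))
    (pi : forall N : nat, probability (state N) R) :
  (\forall N \near \oo, stationary (X N) (pi N)) ->
  weak_cvg_to_point (@fraction_domain R) pi (@fractions R) (fixed_point lambda).
Proof.
move=> st f fcont [M fM].
set z := fixed_point lambda; have zE := fixed_point_in_domain.
have M0 : 0 <= M by apply: le_trans (fM _ zE).
have bf N : (0 < N)%N -> bdd (fun x : state N => f (fractions R x)).
  by move=> N0; exists M => x; exact/fM/fractions_in_domain.
apply/fine_cvgP; split.
  near=> N; rewrite -meanE//; apply: bf; near: N; exact: nbhs_infty_gt.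
rewrite -/z; apply/cvgrPdist_le => eps eps0.
have fz : f @ within (@fraction_domain R) (nbhs z) --> f z.
  by move/(@subspace_continuousP _ (@fraction_domain R)): fcont; exact.
have e2 : 0 < eps / 2 by rewrite divr_gt0.
have /fraction_space_nbhs[d d0 Hd] :
    nbhs z [set u | fraction_domain u -> `|f z - f u| < eps / 2].
  by move/cvgrPdist_lt : fz => /(_ _ e2).
pose K := 2 * M / d; have K0 : 0 <= K by rewrite divr_ge0 ?mulr_ge0// ltW.
have eK : 0 < eps / 2 / (K + 1) by rewrite divr_gt0// ltr_wpDl.
have [n0 Hn0] := vanishing_distance eK.
near=> N; have N0 : (0 < N)%N by near: N; exact: nbhs_infty_gt.
have Nn : n0 <= N%:R by near: N; exact: nbhs_infty_ger.
have stN : stationary (X N) (pi N) by near: N; exact: st.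
have mean_dist := Hn0 _ Nn N0 _ _ stN.
have close (x : state N) : `|f z - f (fractions R x)| <= eps / 2 + K * distance N (val x).
  have xE := fractions_in_domain x N0.
  have dist0 : 0 <= distance N (val x).
    by rewrite /distance !addr_ge0 ?normr_ge0 ?frac_ge0//; exact: frac_ge0.
  have [xd|xd] := ltP (distance N (val x)) d.
    have [h1 h2 h3] := distanceP N0 xd.
    by rewrite (le_trans (ltW (Hd _ h1 h2 h3 xE)))// lerDl mulr_ge0.
  have : K * d <= K * distance N (val x) by rewrite ler_wpM2l.
  rewrite /K divfK ?gt_eqF// -/K => H.
  have := ler_normB (f z) (f (fractions R x)); have := fM _ zE; have := fM _ xE.
  lra.
have bfN := bf _ N0; have bd := local_bdd N (@local_distance N).
have bb : bdd (fun x : state N => eps / 2 + K * distance N (val x)).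
  by apply: bddD; [exact: bdd_cst|exact: bddZ].
have bz := bdd_cst N (f z).
have Kd : K * (\int[pi N]_x distance N (val x))%R <= eps / 2.
  apply: le_trans (ler_wpM2l K0 mean_dist) _.
  by rewrite mulrCA ler_piMr ?(ltW e2)// ler_pdivrMr ?mul1r ?lerDl// ltr_wpDl.
have Eb : (\int[pi N]_x (eps / 2 + K * distance N (val x)))%R <= eps.
  rewrite meanD//; [|exact: bdd_cst|exact: bddZ].
  by rewrite mean_cst meanZ//; lra.
have -> : (fine \o (fun n => \int[pi n]_x (f (fractions R x))%:E)%E) N =
   (\int[pi N]_x f (fractions R x))%R by [].
have H1 : (\int[pi N]_x (f z - f (fractions R x)))%R <= eps.
  apply: le_trans Eb; apply: mean_le => //; first exact: bddB.
  by move=> x; apply: le_trans (close x); exact: ler_norm.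
have H2 : (\int[pi N]_x (f (fractions R x) - f z))%R <= eps.
  apply: le_trans Eb; apply: mean_le => //; first exact: bddB.
  by move=> x; apply: le_trans (close x); rewrite distrC; exact: ler_norm.
move: H1 H2; rewrite !meanB// !mean_cst => H1 H2.
by rewrite ler_norml; apply/andP; split; lra.
Unshelve. all: by end_near.
Qed.

End WeakConvergence.

Theorem theorem2p2 (R : realType) (lambda mu nu : R)
    (mu_gt0 : 0 < mu) (nu_gt0 : 0 < nu) (lambda_gt0 : 0 < lambda)
    (lambda_lt1 : lambda < 1)
    (X : forall N : nat, ctmc (@tabs_rate R lambda mu nu N)) :
  (\forall N \near \oo,
     positive_recurrent (X N) /\
     exists pi : probability (state N) R, stationary (X N) pi /\
       forall pi' : probability (state N) R, stationary (X N) pi' ->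
         forall A, pi' A = pi A)
  /\
  (forall pi : forall N : nat, probability (state N) R,
     (\forall N \near \oo, stationary (X N) (pi N)) ->
     weak_cvg_to_point (@fraction_domain R) pi (@fractions R) (fixed_point lambda)).
Proof.
split; last by move=> pi; exact: stationary_weak_cvg.
have [n0 H] := tabs_stable lambda_gt0 lambda_lt1 mu_gt0 nu_gt0.
near=> N; apply: H; near: N; [exact: nbhs_infty_ger|exact: nbhs_infty_gt].
Unshelve. all: by end_near.
Qed.
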